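(* Let $n\ge1$, $\hbar>0$, $m>0$, and let $\omega_1,\dots,\omega_n$ be such that each $\omega_j^2$ is real (i.e. each $\omega_j$ is real or purely imaginary). Let $u$, with $u(\cdot,t)\in\mathcal{S}(\mathbb{R}^n)$, be the solution of the Schrödinger equation of the harmonic oscillator $$i\hbar\frac{\partial u}{\partial t}(x,t)=\left(-\frac{\hbar^2}{2m}\Delta+\frac m2\left(\omega_1^2x_1^2+\dots+\omega_n^2x_n^2\right)\right)u(x,t).$$ Suppose that at time $t=0$ and at time $t=T$ the solution satisfies, for all $x\in\mathbb{R}^n$, $$|u(x,0)|\le Ke^{-\alpha|x|^2}\quad\text{and}\quad|u(x,T)|\le Ke^{-\beta|x|^2}$$ for some constants $\alpha,\beta,K>0$. If $$\sin(\omega_jT)\ne0\ \text{ for all } j=1,2,\dots,n\quad\text{and}\quad\alpha\beta\left(\frac{2\hbar}{m}\right)^2\max_{j}\left|\frac{\sin(\omega_jT)}{\omega_j}\right|^2>1,$$ then $u\equiv0$.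
   Context: $\mathcal{S}(\mathbb{R}^n)$ is the Schwartz space and $\Delta$ is the Laplacian in $x\in\mathbb{R}^n$. For purely imaginary $\omega_j$, $\sin$ is the complex sine, so $|\sin(\omega_jT)|=|\sinh(|\omega_j|T)|$. *)

(* Defs.v *)
From mathcomp Require Import all_boot all_order all_algebra.
From mathcomp Require Import complex.
From mathcomp Require Import all_classical all_reals all_analysis.
Set Implicit Arguments.
Unset Strict Implicit.
Unset Printing Implicit Defensive.
Import Order.TTheory GRing.Theory Num.Theory.
Import numFieldNormedType.Exports.

Local Open Scope ring_scope.
Local Open Scope complex_scope.

Section ComplexValued.
Context {R : realType}.
Implicit Types z : R[i].

Definition cexp z : R[i] :=
  (expR (complex.Re z))%:C
  * (cos (complex.Im z) +i* sin (complex.Im z)).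

Definition csin z : R[i] := (cexp ('i * z) - cexp (- ('i * z))) / (2%:R * 'i).

(* R[i] is not a normedModType over R, so complex-valued functions of real
   variables are differentiated componentwise. *)
Definition ccontinuous {V : normedModType R} (f : V -> R[i]) : Prop :=
  continuous (fun x => complex.Re (f x) : R^o) /\
  continuous (fun x => complex.Im (f x) : R^o).

Definition cderivable {V : normedModType R} (f : V -> R[i]) (x v : V) : Prop :=
  derivable (fun y => complex.Re (f y) : R^o) x v /\
  derivable (fun y => complex.Im (f y) : R^o) x v.

Definition cderive {V : normedModType R} (v : V) (f : V -> R[i]) (x : V) : R[i] :=
  ('D_v (fun y => complex.Re (f y) : R^o) x)
  +i* ('D_v (fun y => complex.Im (f y) : R^o) x).

End ComplexValued.

Section EuclideanSpace.
Context {R : realType} {n : nat}.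
Implicit Types (f : 'rV[R]_n -> R[i]) (x : 'rV[R]_n).

Definition basis_vec (j : 'I_n) : 'rV[R]_n := delta_mx 0 j.

Definition partial (j : 'I_n) f : 'rV[R]_n -> R[i] := cderive (basis_vec j) f.

(* Every multi-index derivative is iter_partial s f for some list s of
   coordinates. *)
Definition iter_partial (s : seq 'I_n) f : 'rV[R]_n -> R[i] :=
  foldr partial f s.

Definition smooth f : Prop :=
  forall s : seq 'I_n, ccontinuous (iter_partial s f) /\
    forall (j : 'I_n) x, cderivable (iter_partial s f) x (basis_vec j).

Definition monomial (a : 'I_n -> nat) x : R := \prod_(j < n) x 0 j ^+ a j.

Definition schwartz f : Prop :=
  smooth f /\
  forall (a : 'I_n -> nat) (s : seq 'I_n), exists C : R,
    forall x, Normc.normc ((monomial a x)%:C * iter_partial s f x) <= C.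

Definition laplacian f x : R[i] := \sum_(j < n) partial j (partial j f) x.

(* The library norm on 'rV[R]_n is the sup norm, hence this definition. *)
Definition sqr_enorm x : R := \sum_(j < n) x 0 j ^+ 2.

Definition oscillator_hamiltonian (hbar m : R) (omega : 'I_n -> R[i]) f x : R[i] :=
  - (hbar ^+ 2 / (2 * m))%:C * laplacian f x
  + (m / 2)%:C * (\sum_(j < n) omega j ^+ 2 * (x 0 j ^+ 2)%:C) * f x.

Definition solves_oscillator (hbar m : R) (omega : 'I_n -> R[i])
    (u : 'rV[R]_n -> R -> R[i]) : Prop :=
  forall x (t : R), cderivable (u x : R^o -> R[i]) t 1 /\
    'i * hbar%:C * cderive (1 : R^o) (u x) t =
      oscillator_hamiltonian hbar m omega (u^~ t) x.

End EuclideanSpace.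

(* Main.v *)
(**
Write lam = m / (2 hbar). For a Gaussian phi evolving by -i hbar phi_t = H phi the
pairing of u(t) with phi(t) is constant in t. With phi(0) equal to
exp(sum_k i lam r_k x_k^2 - B_k (x_k - X_k)^2) and r_k = omega_k cot(omega_k T),
phi(T) is a multiple of a Gaussian whose k-th quadratic coefficient has real part
- lam^2 omega_k^2 / (B_k sin^2(omega_k T)). In one coordinate j this reads
P(B) = A Q(1/B), where A^2 is a constant multiple of 1/B. The decay of u(0) and u(T)
makes P a power series in B for |B| < alpha and Q a power series in 1/B for
|B| > lam^2 omega_j^2 / (beta sin^2(omega_j T)); the assumption on the product of
alpha and beta says exactly that these domains overlap in an annulus. On the
annulus sqrt(B) P(B) and Q(1/B) agree up to a constant factor, but once around
the origin the first changes sign and the second does not. So both vanish, and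
B -> oo yields u(0) = 0; pairing once more gives u(t) = 0.

Since u is only differentiable in t pointwise in x, the conservation of the pairing
needs a bound on u and H u that is uniform for t in a compact interval. A dispersive
estimate propagates such a bound from a single time to short time intervals, given
a bound of finitely many weighted derivatives at that time, and Baire's theorem
applied to the sets of times where the latter are at most k does the rest.
*)
Require Import Defs.
From mathcomp Require Import all_boot all_order all_algebra.
From mathcomp Require Import complex.
From mathcomp Require Import all_classical all_reals all_analysis.
From mathcomp Require Import measurable_realfun.
From mathcomp Require Import ring lra.
Set Implicit Arguments.
Unset Strict Implicit.
Unset Printing Implicit Defensive.
Import Order.TTheory GRing.Theory Num.Theory.
Import numFieldNormedType.Exports.
Local Open Scope ring_scope.
Local Open Scope complex_scope.

(** The value of [r_k] comes from the propagator. With S_k = sin(omega_k T) / omega_k, its kernel in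
    coordinate k is a constant times exp(i lam (r_k x^2 - 2 x y / S_k + r_k y^2)). Multiplying u(0)
    by the chirp exp(i lam r_k y^2) and u(T) by the inverse chirp leaves a Fourier transform, so the
    theorem is an uncertainty principle of Hardy type. It is applied in a single coordinate j for
    which the product exceeds 1; the Gaussian factors of the other coordinates stay fixed and are
    absorbed into u(0) and u(T). The factor A is known through its square, so squares are compared
    and a sign is settled locally. With B = e^s the annulus becomes a strip, the two sides become
    series in e^((k + 1/2) s) and e^(-k s), and continuation is carried out on moments of partial
    sums. The dispersive estimate is the same Gaussian identity with B -> oo in all coordinates. It
    presupposes some bound on the whole time interval and returns one that depends only on the data
    at one end; this gain is what the Baire argument feeds on. *)

Local Notation nc := Normc.normc.
Local Notation cRe := complex.Re.
Local Notation cIm := complex.Im.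

(** * Complex-valued functions of a real variable *)

Section ComplexBasics.
Context {R : realType}.
Implicit Types (z w : R[i]) (x y t : R).

Lemma ncM z w : nc (z * w) = nc z * nc w.
Proof. exact: Normc.normcM. Qed.

Lemma ncD z w : nc (z + w) <= nc z + nc w.
Proof. exact: (@le_normcD R z w). Qed.

Lemma ncN z : nc (- z) = nc z.
Proof. exact: (@normcN R z). Qed.

Lemma nc_ge0 z : 0 <= nc z.
Proof. by case: z => a b; exact: sqrtr_ge0. Qed.

Lemma ncB z w : nc (z - w) <= nc z + nc w.
Proof. by rewrite -(ncN w); exact: ncD. Qed.

Lemma nc_distC z w : nc (z - w) = nc (w - z).
Proof. by rewrite -ncN opprB. Qed.

Lemma nc_real x : nc (x%:C) = `|x|.
Proof. by rewrite /= expr0n addr0 sqrtr_sqr. Qed.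

Lemma nc_eq0 z : (nc z == 0) = (z == 0).
Proof.
by apply/eqP/eqP => [/Normc.eq0_normc//|->]; rewrite Normc.normc0.
Qed.

Lemma nc_gt0 z : (0 < nc z) = (z != 0).
Proof. by rewrite lt_def nc_ge0 andbT nc_eq0. Qed.

Lemma nc_X z n : nc (z ^+ n) = nc z ^+ n.
Proof. by elim: n => [|n IH]; rewrite ?expr0 ?Normc.normc1 // !exprS ncM IH. Qed.

Lemma nc_Re z : `|cRe z| <= nc z.
Proof.
case: z => a b /=; rewrite -sqrtr_sqr ler_wsqrtr//.
by rewrite lerDl sqr_ge0.
Qed.

Lemma nc_Im z : `|cIm z| <= nc z.
Proof.
case: z => a b /=; rewrite -sqrtr_sqr ler_wsqrtr//.
by rewrite lerDr sqr_ge0.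
Qed.

Lemma complexRI z : z = (cRe z)%:C + 'i%C * (cIm z)%:C.
Proof. by case: z => a b; apply/eqP; rewrite eq_complex /=; apply/andP; split; apply/eqP; ring. Qed.

Lemma nc_i : nc ('i%C : R[i]) = 1.
Proof. by rewrite /= expr0n expr1n add0r sqrtr1. Qed.

Lemma i_neq0 : 'i%C != 0 :> R[i].
Proof. by rewrite -nc_gt0 nc_i ltr01. Qed.

Lemma invr_i : 'i%C^-1 = - 'i%C :> R[i].
Proof. by apply: (mulfI i_neq0); rewrite divff ?i_neq0// mulrN -expr2 sqr_i opprK. Qed.

Lemma nc_le_ReIm z : nc z <= `|cRe z| + `|cIm z|.
Proof.
rewrite {1}(complexRI z); apply: le_trans (ncD _ _) _.
by rewrite ncM nc_i mul1r !nc_real.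
Qed.

Lemma nc_sum (I : Type) (r : seq I) (P : pred I) (F : I -> R[i]) :
  nc (\sum_(i <- r | P i) F i) <= \sum_(i <- r | P i) nc (F i).
Proof.
apply: (big_ind2 (fun a b => nc a <= b)) => //; first by rewrite Normc.normc0.
by move=> a b c d ab cd; apply: le_trans (ncD _ _) (lerD ab cd).
Qed.

Lemma nc_prod (I : Type) (r : seq I) (P : pred I) (F : I -> R[i]) :
  nc (\prod_(i <- r | P i) F i) = \prod_(i <- r | P i) nc (F i).
Proof.
by elim/big_rec2: _ => [|i y1 y2 _ <-]; [exact: Normc.normc1|exact: ncM].
Qed.

Lemma ReD z w : cRe (z + w) = cRe z + cRe w. Proof. by case: z; case: w. Qed.
Lemma ImD z w : cIm (z + w) = cIm z + cIm w. Proof. by case: z; case: w. Qed.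
Lemma ReN z : cRe (- z) = - cRe z. Proof. by case: z. Qed.
Lemma ImN z : cIm (- z) = - cIm z. Proof. by case: z. Qed.
Lemma ReM z w : cRe (z * w) = cRe z * cRe w - cIm z * cIm w.
Proof. by case: z; case: w. Qed.
Lemma ImM z w : cIm (z * w) = cRe z * cIm w + cIm z * cRe w.
Proof. by case: z; case: w. Qed.
Lemma Re_sum (I : Type) (r : seq I) (P : pred I) (F : I -> R[i]) :
  cRe (\sum_(i <- r | P i) F i) = \sum_(i <- r | P i) cRe (F i).
Proof. by elim/big_rec2: _ => [//|i y1 y2 _ <-]; exact: ReD. Qed.

Lemma eq_ReIm z w : cRe z = cRe w -> cIm z = cIm w -> z = w.
Proof. by case: z; case: w => a b c d /= -> ->. Qed.

Lemma cexpD z w : cexp (z + w) = cexp z * cexp w.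
Proof.
rewrite /cexp ReD ImD expRD cosD sinD.
apply: eq_ReIm; rewrite !(ReM, ImM) /=; ring.
Qed.

Lemma cexp0 : cexp 0 = 1 :> R[i].
Proof. by rewrite /cexp /= expR0 cos0 sin0 mul1r. Qed.

Lemma nc_cexp z : nc (cexp z) = expR (cRe z).
Proof.
rewrite /cexp ncM nc_real ger0_norm ?expR_ge0//=.
by rewrite cos2Dsin2 sqrtr1 mulr1.
Qed.

Lemma cexp_neq0 z : cexp z != 0.
Proof. by rewrite -nc_gt0 nc_cexp expR_gt0. Qed.

Lemma cexpN z : cexp (- z) = (cexp z)^-1.
Proof.
apply: (mulfI (cexp_neq0 z)); rewrite -cexpD subrr cexp0 divff//.
exact: cexp_neq0.
Qed.

Lemma cexp_real x : cexp x%:C = (expR x)%:C.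
Proof. by rewrite /cexp /= cos0 sin0 mulr1. Qed.

Lemma cexp_sum (I : Type) (r : seq I) (P : pred I) (F : I -> R[i]) :
  cexp (\sum_(i <- r | P i) F i) = \prod_(i <- r | P i) cexp (F i).
Proof. by elim/big_rec2: _ => [|i y1 y2 _ <-]; [exact: cexp0|exact: cexpD]. Qed.

(** A relation with the derivative as an argument: the rules below build the value, and [cder_val]
    then leaves one algebraic identity to check. *)
Definition cder (f : R -> R[i]) (t : R) (l : R[i]) : Prop :=
  is_derive t (1 : R) (fun s => cRe (f s)) (cRe l) /\
  is_derive t (1 : R) (fun s => cIm (f s)) (cIm l).

Lemma is_derive_ext (f g : R -> R) t l :
  f =1 g -> is_derive t (1 : R) f l -> is_derive t (1 : R) g l.
Proof. by move=> /funext ->. Qed.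

Lemma is_derive_val (f : R -> R) t l l' :
  is_derive t (1 : R) f l -> l = l' -> is_derive t (1 : R) f l'.
Proof. by move=> ? <-. Qed.

Lemma is_derive_mul (f g : R -> R) t l m :
  is_derive t (1 : R) f l -> is_derive t (1 : R) g m ->
  is_derive t (1 : R) (fun s => f s * g s) (f t * m + l * g t).
Proof.
move=> fl gm; apply: is_derive_val (is_deriveM fl gm) _.
by rewrite /GRing.scale /=; congr (_ + _); rewrite mulrC.
Qed.

Lemma is_derive_add (f g : R -> R) t l m :
  is_derive t (1 : R) f l -> is_derive t (1 : R) g m ->
  is_derive t (1 : R) (fun s => f s + g s) (l + m).
Proof. by move=> fl gm; exact: (is_deriveD fl gm). Qed.

Lemma is_derive_sub (f g : R -> R) t l m :
  is_derive t (1 : R) f l -> is_derive t (1 : R) g m ->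
  is_derive t (1 : R) (fun s => f s - g s) (l - m).
Proof. by move=> fl gm; exact: (is_deriveB fl gm). Qed.

Lemma is_derive_opp (f : R -> R) t l :
  is_derive t (1 : R) f l -> is_derive t (1 : R) (fun s => - f s) (- l).
Proof. by move=> fl; exact: (is_deriveN fl). Qed.

Lemma cder_ext (f g : R -> R[i]) t l : f =1 g -> cder f t l -> cder g t l.
Proof. by move=> /funext ->. Qed.

Lemma cder_val (f : R -> R[i]) t l l' : cder f t l -> l = l' -> cder f t l'.
Proof. by move=> ? <-. Qed.

Lemma cder_cst (c : R[i]) t : cder (fun=> c) t 0.
Proof. by split; exact: is_derive_cst. Qed.

Lemma cderD (f g : R -> R[i]) t l m :
  cder f t l -> cder g t m -> cder (fun s => f s + g s) t (l + m).
Proof.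
move=> [f1 f2] [g1 g2]; split.
  apply: (@is_derive_ext (fun s => cRe (f s) + cRe (g s))) => [s|].
    by rewrite ReD.
  by rewrite ReD; exact: is_derive_add.
apply: (@is_derive_ext (fun s => cIm (f s) + cIm (g s))) => [s|].
  by rewrite ImD.
by rewrite ImD; exact: is_derive_add.
Qed.

Lemma cderN (f : R -> R[i]) t l : cder f t l -> cder (fun s => - f s) t (- l).
Proof.
move=> [f1 f2]; split.
  apply: (@is_derive_ext (fun s => - cRe (f s))) => [s|].
    by rewrite ReN.
  by rewrite ReN; exact: is_derive_opp.
apply: (@is_derive_ext (fun s => - cIm (f s))) => [s|].
  by rewrite ImN.
by rewrite ImN; exact: is_derive_opp.
Qed.

Lemma cderB (f g : R -> R[i]) t l m :
  cder f t l -> cder g t m -> cder (fun s => f s - g s) t (l - m).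
Proof. by move=> fl gm; apply: cderD => //; exact: cderN. Qed.

Lemma cderM (f g : R -> R[i]) t l m :
  cder f t l -> cder g t m ->
  cder (fun s => f s * g s) t (f t * m + l * g t).
Proof.
move=> [f1 f2] [g1 g2]; split.
  apply: (@is_derive_ext (fun s => cRe (f s) * cRe (g s) - cIm (f s) * cIm (g s))) => [s|].
    by rewrite ReM.
  apply: is_derive_val (is_derive_sub (is_derive_mul f1 g1) (is_derive_mul f2 g2)) _.
  by rewrite ReD !ReM; ring.
apply: (@is_derive_ext (fun s => cRe (f s) * cIm (g s) + cIm (f s) * cRe (g s))) => [s|].
  by rewrite ImM.
apply: is_derive_val (is_derive_add (is_derive_mul f1 g2) (is_derive_mul f2 g1)) _.
by rewrite ImD !ImM; ring.
Qed.

Lemma cderZ (c : R[i]) (f : R -> R[i]) t l :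
  cder f t l -> cder (fun s => c * f s) t (c * l).
Proof.
move=> fl; apply: cder_val (cderM (cder_cst c t) fl) _.
by rewrite mul0r addr0.
Qed.

Lemma cder_real (f : R -> R) t l :
  is_derive t (1 : R) f l -> cder (fun s => (f s)%:C) t l%:C.
Proof. by move=> fl; split => //=; exact: is_derive_cst. Qed.

Lemma cder_sum (I : Type) (r : seq I) (P : pred I) (F : I -> R -> R[i])
   (L : I -> R[i]) t :
  (forall i, cder (F i) t (L i)) ->
  cder (fun s => \sum_(i <- r | P i) F i s) t (\sum_(i <- r | P i) L i).
Proof.
move=> FL; elim: r => [|i r IH].
  apply: (@cder_ext (fun=> 0)) => [s|]; first by rewrite big_nil.
  by rewrite big_nil; exact: cder_cst.
apply: (@cder_ext (fun s => (if P i then F i s else 0) + \sum_(j <- r | P j) F j s)) => [s|].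
  by rewrite big_cons; case: ifP; rewrite ?add0r.
rewrite big_cons; case: ifP => Pi; first exact: cderD.
by apply: cder_ext IH => s; rewrite add0r.
Qed.

Lemma is_derive_comp (f g : R -> R) t l m :
  is_derive (g t) (1 : R) f l -> is_derive t (1 : R) g m ->
  is_derive t (1 : R) (fun s => f (g s)) (m * l).
Proof.
by move=> fl gm; apply: is_derive_val (is_derive1_comp fl gm) _; rewrite mulrC.
Qed.

Lemma cder_comp (f : R -> R[i]) (g : R -> R) t l m :
  cder f (g t) l -> is_derive t (1 : R) g m ->
  cder (fun s => f (g s)) t (m%:C * l).
Proof.
move=> [f1 f2] gm; split; rewrite ?ReM ?ImM /= ?mul0r ?subr0 ?addr0.
  exact: (is_derive_comp f1 gm).
exact: (is_derive_comp f2 gm).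
Qed.

Lemma cder_cexp (f : R -> R[i]) t l :
  cder f t l -> cder (fun s => cexp (f s)) t (l * cexp (f t)).
Proof.
move=> [f1 f2].
have e1 := is_derive_comp (is_derive_expR (cRe (f t))) f1.
have e2 := is_derive_comp (is_derive_cos (cIm (f t))) f2.
have e3 := is_derive_comp (is_derive_sin (cIm (f t))) f2.
split.
  apply: (@is_derive_ext (fun s => expR (cRe (f s)) * cos (cIm (f s)))) => [s|].
    by rewrite /cexp ReM /=; ring.
  by apply: is_derive_val (is_derive_mul e1 e2) _; rewrite /cexp !(ReM, ImM) /=; ring.
apply: (@is_derive_ext (fun s => expR (cRe (f s)) * sin (cIm (f s)))) => [s|].
  by rewrite /cexp ImM /=; ring.
by apply: is_derive_val (is_derive_mul e1 e3) _; rewrite /cexp !(ReM, ImM) /=; ring.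
Qed.

Lemma is_derive_cont (f : R -> R) t l :
  is_derive t (1 : R) f l -> {for t, continuous f}.
Proof.
by move=> fl; apply: differentiable_continuous; apply/derivable1_diffP; apply: ex_derive.
Qed.

Lemma cder_continuous (f : R -> R[i]) (f' : R -> R[i]) :
  (forall t, cder f t (f' t)) -> ccontinuous f.
Proof.
move=> fl; split => t; have [h1 h2] := fl t.
  exact: (is_derive_cont h1).
exact: (is_derive_cont h2).
Qed.

End ComplexBasics.

(** * Integration *)

Section WeightedIntegral.
Context {R : realType}.
Local Notation mu := (@lebesgue_measure R).
Local Open Scope classical_set_scope.
Implicit Types (g h : R -> R) (C : R).

(* Integrals are taken against dy / (1 + y^2), so that all bounded continuous
   functions are integrable and an integral over R^n can be defined by iteration
   over the coordinates, with no appeal to Fubini. *)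
Definition wR g : R := \int[mu]_(y in setT) (g y * (oneDsqr y)^-1).

Lemma w_gt0 (y : R) : 0 < oneDsqr y.
Proof. exact: lt_le_trans ltr01 (oneDsqr_ge1 y). Qed.

Lemma cont_w : continuous (fun y : R => (oneDsqr y)^-1).
Proof. exact: continuous_oneDsqrV. Qed.

Lemma w_integrable : mu.-integrable setT (EFin \o (fun y : R => (oneDsqr y)^-1)).
Proof.
have mw : measurable_fun setT (fun y : R => (oneDsqr y)^-1).
  by apply: continuous_measurable_fun; exact: cont_w.
apply/integrableP; split; first exact/measurable_EFinP.
under eq_integral do rewrite /= ger0_norm ?invr_ge0 ?(ltW (w_gt0 _))//.
rewrite ge0_symfun_integralT.
- have -> : [set x : R | 0 <= x] = `[0, +oo[ by apply/seteqP; split => x /=; rewrite in_itv/= andbT.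
  by rewrite integral0y_oneDsqr -EFinM ltry.
- by move=> x; rewrite invr_ge0 ltW ?w_gt0.
- exact: cont_w.
- by move=> x /=; rewrite /oneDsqr sqrrN.
Qed.

Lemma cw_integrable (C : R) :
  mu.-integrable setT (EFin \o (fun y : R => C * (oneDsqr y)^-1)).
Proof.
have -> : EFin \o (fun y : R => C * (oneDsqr y)^-1) =
    (fun y => (C%:E * ((oneDsqr y)^-1)%:E)%E).
  by apply/funext => y /=; rewrite EFinM.
exact: (integrableZl measurableT C w_integrable).
Qed.

Lemma wR_integrable g C : continuous g -> (forall y, `|g y| <= C) ->
  mu.-integrable setT (EFin \o (fun y => g y * (oneDsqr y)^-1)).
Proof.
move=> cg gC.
have hi : mu.-integrable setT (EFin \o (fun y : R => C * (oneDsqr y)^-1)).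
  exact: cw_integrable.
apply: le_integrable hi => //.
  apply/measurable_EFinP; apply: continuous_measurable_fun => y.
  by apply: cvgM; [exact: cg|exact: cont_w].
move=> y _ /=; rewrite lee_fin.
have w0 : 0 <= (oneDsqr y)^-1 by rewrite invr_ge0 ltW// w_gt0.
have C0 : 0 <= C by exact: le_trans (gC y).
by rewrite !normrM !(ger0_norm w0) (ger0_norm C0) ler_wpM2r.
Qed.

Lemma wRD g h C D : continuous g -> (forall y, `|g y| <= C) ->
  continuous h -> (forall y, `|h y| <= D) ->
  wR (fun y => g y + h y) = wR g + wR h.
Proof.
move=> cg gC ch hC; rewrite /wR -RintegralD//.
- by apply: eq_Rintegral => y _; rewrite mulrDl.
- exact: wR_integrable cg gC.
- exact: wR_integrable ch hC.
Qed.

Lemma wRZ (a : R) g C : continuous g -> (forall y, `|g y| <= C) ->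
  wR (fun y => a * g y) = a * wR g.
Proof.
move=> cg gC; rewrite /wR -RintegralZl//.
- by apply: eq_Rintegral => y _; rewrite mulrA.
- exact: wR_integrable cg gC.
Qed.

Definition wmass : R := wR (fun=> 1).

Lemma wmass_ge0 : 0 <= wmass.
Proof.
by apply: Rintegral_ge0 => y _; rewrite mul1r invr_ge0 ltW// w_gt0.
Qed.

Lemma wR_le g h C D : continuous g -> (forall y, `|g y| <= C) ->
  continuous h -> (forall y, `|h y| <= D) -> (forall y, g y <= h y) ->
  wR g <= wR h.
Proof.
move=> cg gC ch hC gh; rewrite /wR; apply: le_Rintegral => //.
- exact: wR_integrable cg gC.
- exact: wR_integrable ch hC.
- by move=> y _; rewrite ler_wpM2r// invr_ge0 ltW// w_gt0.
Qed.

Lemma wR_bound g C : continuous g -> (forall y, `|g y| <= C) -> `|wR g| <= wmass * C.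
Proof.
move=> cg gC.
have C0 : 0 <= C by exact: le_trans (gC 0).
have cc : continuous (fun _ : R => C : R) by move=> y; exact: cvg_cst.
have cN : continuous (fun _ : R => - C : R) by move=> y; exact: cvg_cst.
have c1 : continuous (fun _ : R => 1 : R) by move=> y; exact: cvg_cst.
have bC (y : R) : `|C| <= C by rewrite ger0_norm.
have bN (y : R) : `|- C| <= C by rewrite normrN ger0_norm.
have b1 (y : R) : `|1 : R| <= 1 by rewrite normr1.
have e1 : wR (fun=> C) = wmass * C.
  rewrite mulrC -(wRZ C c1 b1) /wR; apply: eq_Rintegral => y _.
  by rewrite mulr1.
have e2 : wR (fun=> - C) = - (wmass * C).
  rewrite mulrC -mulNr -(wRZ (- C) c1 b1) /wR; apply: eq_Rintegral => y _.
  by rewrite mulr1.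
rewrite ler_norml -e2 -e1; apply/andP; split.
  apply: (wR_le cN bN cg gC) => y.
  by have := gC y; rewrite ler_norml => /andP[].
apply: (wR_le cg gC cc bC) => y.
by have := gC y; rewrite ler_norml => /andP[].
Qed.

Lemma wR_cvg (g_ : nat -> R -> R) g C :
  (forall i, continuous (g_ i)) -> continuous g ->
  (forall i y, `|g_ i y| <= C) ->
  (forall y, g_ i y @[i --> \oo] --> g y) ->
  wR (g_ i) @[i --> \oo] --> wR g.
Proof.
move=> cgi cg bgi gg.
have mf i : measurable_fun setT (EFin \o (fun y => g_ i y * (oneDsqr y)^-1)).
  apply/measurable_EFinP; apply: continuous_measurable_fun => y.
  by apply: cvgM; [exact: cgi|exact: cont_w].
have mg : measurable_fun setT (EFin \o (fun y => g y * (oneDsqr y)^-1)).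
  apply/measurable_EFinP; apply: continuous_measurable_fun => y.
  by apply: cvgM; [exact: cg|exact: cont_w].
have hi : mu.-integrable setT (EFin \o (fun y : R => C * (oneDsqr y)^-1)).
  exact: cw_integrable.
have [] := @dominated_convergence _ _ _ mu setT measurableT _ _ _ mf mg _ hi.
- apply: aeW => y _ /=; apply: cvg_EFin; first exact: nearW.
  have gw : g_ i y * (oneDsqr y)^-1 @[i --> \oo] --> g y * (oneDsqr y)^-1.
    by apply: cvgM; [exact: gg|exact: cvg_cst].
  exact: gw.
- apply: aeW => y /= i _; rewrite lee_fin.
  have w0 : 0 <= (oneDsqr y)^-1 by rewrite invr_ge0 ltW// w_gt0.
  by rewrite normrM (ger0_norm w0) ler_wpM2r.
move=> ig _ cv.
have fing := integrable_fin_num measurableT ig.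
by move: cv; rewrite -(fineK fing) => /fine_cvg.
Qed.

Lemma wR_diff (G G' : R -> R -> R) (C lo hi t : R) :
  lo < t < hi ->
  (forall s y : R, lo < s < hi -> is_derive s (1 : R) (G ^~ y) (G' s y)) ->
  (forall s y : R, lo < s < hi -> `|G' s y| <= C) ->
  (forall s : R, lo < s < hi -> continuous (G s)) ->
  (forall s : R, lo < s < hi -> exists D, forall y, `|G s y| <= D) ->
  is_derive t (1 : R) (fun s => wR (G s)) (wR (G' t)).
Proof.
move=> tI dG bG' cG bG.
have tI' : `]lo, hi[%classic t by rewrite /= in_itv.
pose f s y := G s y * (oneDsqr y)^-1.
have df s y : lo < s < hi -> is_derive s (1 : R) (f ^~ y) (G' s y * (oneDsqr y)^-1).
  move=> sI; have h := dG s y sI.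
  apply: is_derive_val (is_derive_mul h (is_derive_cst ((oneDsqr y)^-1) s (1 : R))) _.
  by rewrite mulr0 add0r.
have C0 : 0 <= C by exact: le_trans (bG' t 0 tI).
have intf s : `]lo, hi[%classic s -> mu.-integrable setT (EFin \o f s).
  rewrite /= in_itv/= => sI; have [D bD] := bG s sI.
  exact: wR_integrable (cG s sI) bD.
have derf s y : `]lo, hi[%classic s -> setT y -> derivable (f ^~ y) s 1.
  rewrite /= in_itv/= => sI _; have h := df s y sI; exact: ex_derive.
have w0 (y : R) : 0 <= (oneDsqr y)^-1 by rewrite invr_ge0 ltW// w_gt0.
have G0 (y : R) : 0 <= C * (oneDsqr y)^-1 by rewrite mulr_ge0.
have Gub s y : `]lo, hi[%classic s -> setT y ->
    `|partial1of2 f s y| <= C * (oneDsqr y)^-1.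
  rewrite /= in_itv/= => sI _; rewrite partial1of2E.
  have h := df s y sI; rewrite derive_val normrM (ger0_norm (w0 y)).
  by rewrite ler_wpM2r// bG'.
have d1 := derivable_under_integral measurableT tI' intf derf G0 (cw_integrable C) Gub.
have d2 := differentiation_under_integral measurableT tI' intf derf G0 (cw_integrable C) Gub.
apply: DeriveDef; first exact: d1.
rewrite -derive1E; apply: etrans; first exact: d2.
apply: eq_Rintegral => y _ /=; rewrite partial1of2E.
by have h := df t y tI; rewrite derive_val.
Qed.

(** The factor [oneDsqr] cancels the weight, so this is the plain integral of [F']. It is the limit
    of F(n) - F(-n), which tends to 0 because F is O(1 / (1 + y^2)). *)
Lemma wR_FTC (F F' : R -> R) C :
  (forall y, is_derive y (1 : R) F (F' y)) -> continuous F' ->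
  (forall y, `|oneDsqr y * F y| <= C) -> (forall y, `|oneDsqr y * F' y| <= C) ->
  wR (fun y => oneDsqr y * F' y) = 0.
Proof.
move=> dF cF' bF bF'.
have w0 (y : R) : 0 <= (oneDsqr y)^-1 by rewrite invr_ge0 ltW// w_gt0.
have bound (g : R -> R) (y : R) : `|oneDsqr y * g y| <= C ->
    `|g y| <= C * (oneDsqr y)^-1.
  by rewrite normrM (ger0_norm (ltW (w_gt0 y))) ler_pdivlMr ?w_gt0// mulrC.
have cF : continuous F by move=> y; apply: is_derive_cont (dF y).
have mF' : measurable_fun setT (EFin \o F').
  by apply/measurable_EFinP; apply: continuous_measurable_fun.
have -> : wR (fun y => oneDsqr y * F' y) = \int[mu]_(y in setT) F' y.
  apply: eq_Rintegral => y _; have w1 : oneDsqr y != 0 by apply: lt0r_neq0; exact: w_gt0.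
  by rewrite mulrAC divff ?mul1r.
pose f_ n := (EFin \o F') \_ `[- n%:R : R, n%:R : R].
have mf n : measurable_fun setT (f_ n).
  apply/(measurable_restrictT _ _).1 => //.
  exact: measurable_funTS.
have [] := @dominated_convergence _ _ _ mu setT measurableT f_ (EFin \o F') _ mf mF' _ (cw_integrable C).
- apply: aeW => y _ /=.
  have -> : EFin (F' y) = (EFin \o F') y by [].
  apply: cvg_near_cst; near=> n.
  rewrite /f_ patchE mem_set//= in_itv/= -ler_norml.
  by near: n; exact: nbhs_infty_ger.
- apply: aeW => y /= n _; rewrite /f_ patchE; case: ifPn => _.
    by rewrite /= lee_fin; apply: bound.
  by rewrite abse0 lee_fin; apply: le_trans (bound _ _ (bF' y)).
move=> iF' _ cv.
have fing := integrable_fin_num measurableT iF'.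
have e n : (\int[mu]_(x in setT) f_ n x)%E = (F n%:R - F (- n%:R))%:E.
  (* For n = 0 the interval is a point; the fundamental theorem is applied to proper intervals
     only. *)
  rewrite -integral_mkcond; case: n => [|n].
    rewrite oppr0 subrr set_itv1 integral_set1//.
  have nn : (- n.+1%:R : R) < n.+1%:R by rewrite gtrN// ltr0n.
  rewrite (continuous_FTC2 nn (F:=F)) ?EFinB//.
  - exact: continuous_subspaceT.
  - split.
    + by move=> y _; have h := dF y; exact: ex_derive.
    + by apply: cvg_at_right_filter; exact: cF.
    + by apply: cvg_at_left_filter; exact: cF.
  - by move=> y _; have h := dF y; rewrite derive1E derive_val.
have cv2 : (F n%:R - F (- n%:R)) @[n --> \oo] --> \int[mu]_(y in setT) F' y.
  move: cv; rewrite -(fineK fing) => /fine_cvg.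
  by under [X in X @ _ --> _ -> _]eq_fun do rewrite /= e.
have cv0 : (F n%:R - F (- n%:R)) @[n --> \oo] --> (0 : R).
  have C0 : 0 <= C by exact: le_trans (bF 0).
  have z (n : nat) : `|F n%:R - F (- n%:R)| <= 2 * C * n.+1%:R^-1.
    have le1 (y : R) : y ^+ 2 = n%:R ^+ 2 -> `|F y| <= C * n.+1%:R^-1.
      move=> e1; apply: le_trans (bound _ _ (bF y)) _; apply: ler_wpM2l => //.
      rewrite lef_pV2 ?posrE ?w_gt0 ?ltr0n// /oneDsqr e1 -natrX -natr1 addrC.
      by rewrite lerD2l ler_nat; case: (n) => [//|k]; rewrite expnS leq_pmulr.
    apply: le_trans (ler_normB _ _) _; rewrite -mulrA mulr_natl mulr2n.
    by apply: lerD; apply: le1; rewrite ?sqrrN.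
  apply: norm_cvg0; apply: (@squeeze_cvgr _ _ _ _ (cst 0) (fun n => 2 * C * n.+1%:R^-1)).
  - by apply: nearW => n; rewrite normr_ge0 z.
  - exact: cvg_cst.
  - rewrite -(mulr0 (2 * C)); apply: cvgM; first exact: cvg_cst.
    exact: cvg_harmonic.
by apply: (cvg_unique _ cv2 cv0).
Unshelve. all: end_near. Qed.

(** This keeps the class of functions O(1 / (1 + y^2)) stable under affine substitution. After z =
    (y - x0) / s it reduces to (y - x0)^2 <= (2 + 2 x0^2)(1 + y^2). *)
Lemma affine_weight (x0 s z : R) : 0 < s ->
  oneDsqr z <= (1 + (2 + 2 * x0 ^+ 2) / s ^+ 2) * oneDsqr (x0 + s * z).
Proof.
move=> s0; set y := x0 + s * z.
have -> : z = (y - x0) / s by rewrite /y; field; exact: lt0r_neq0.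
have : 0 < s^-1 by rewrite invr_gt0.
rewrite /oneDsqr -exprVn exprMn; set r := s^-1 ^+ 2 => _.
have r0 : 0 <= r by exact: sqr_ge0.
have h1 : (y - x0) ^+ 2 <= (2 + 2 * x0 ^+ 2) * (1 + y ^+ 2).
  have := sqr_ge0 (y + x0); have := sqr_ge0 (x0 * y); have := sqr_ge0 x0.
  by rewrite exprMn; nra.
have := ler_wpM2r r0 h1; have := sqr_ge0 y; lra.
Qed.

(** The substitution rule is applied to the nonnegative functions |g| and [gp] = (|g| + g) / 2, and
    g = 2 gp - |g| gives the general case by linearity. *)
Lemma wR_affine (g : R -> R) (C x0 s : R) : 0 < s ->
  continuous g -> (forall y, `|oneDsqr y * g y| <= C) ->
  wR (fun y => oneDsqr y * g y) = s * wR (fun z => oneDsqr z * g (x0 + s * z)).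
Proof.
move=> s0 cg bg.
pose A z : R := x0 + s * z.
have dA z : is_derive z (1 : R) A s.
  apply: is_derive_val (is_derive_add (is_derive_cst x0 z 1) (is_derive_mul (is_derive_cst s z 1) (is_derive_id z 1))) _.
  by rewrite mul0r addr0 mulr1 add0r.
have A' : A^`()%classic = fun=> s.
  by apply/funext => z; rewrite derive1E; have h := dA z; rewrite derive_val.
have cA : continuous A by move=> z; exact: is_derive_cont (dA z).
pose K := 1 + (2 + 2 * x0 ^+ 2) / s ^+ 2.
have C0 : 0 <= C by exact: le_trans (bg 0).
have cw1 : continuous (fun y : R => oneDsqr y) by exact: continuous_oneDsqr.
have wn (y : R) : oneDsqr y != 0 by rewrite lt0r_neq0 ?w_gt0.
have sub (h : R -> R) : continuous h -> (forall y, `|oneDsqr y * h y| <= C) ->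
    (forall y, 0 <= h y) ->
    wR (fun y => oneDsqr y * h y) = s * wR (fun z => oneDsqr z * h (A z)).
  move=> ch bh h0.
  have chA : continuous (h \o A).
    by move=> z; apply: continuous_comp; [exact: cA|exact: ch].
  have bhA y : `|oneDsqr y * h (A y)| <= K * C.
    rewrite normrM ger0_norm ?(ltW (w_gt0 _))//.
    apply: (@le_trans _ _ (K * oneDsqr (A y) * `|h (A y)|)).
      by rewrite ler_wpM2r// affine_weight.
    rewrite -mulrA ler_wpM2l//.
      by rewrite /K addr_ge0// divr_ge0 ?sqr_ge0// addr_ge0// mulr_ge0// sqr_ge0.
    by have := bh (A y); rewrite normrM (ger0_norm (ltW (w_gt0 (A y)))).
  have c2 : continuous (fun y => oneDsqr y * h (A y)).
    by move=> y; apply: cvgM; [exact: cw1|exact: chA].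
  rewrite -(wRZ s c2 bhA) /wR /Rintegral; congr fine.
  transitivity (\int[mu]_(y in setT) (h y)%:E)%E.
    by apply: eq_integral => y _; rewrite mulrAC divff ?mul1r ?wn.
  have k1 : {homo A : x y / (x < y)%R} by move=> a b ab; rewrite ltrD2l ltr_pM2l.
  have k2 : continuous A^`()%classic by rewrite A'; move=> z; exact: cvg_cst.
  have k3 : cvg (A^`()%classic x @[x --> -oo%R]) by rewrite A'; exact: is_cvg_cst.
  have k4 : cvg (A^`()%classic x @[x --> +oo%R]) by rewrite A'; exact: is_cvg_cst.
  have k5 (z : R) : derivable A z 1 by have h' := dA z; exact: ex_derive.
  have k6 : A x @[x --> -oo%R] --> -oo%R.
    apply/cvgrNyPle => M.
    apply: filterS (nbhs_ninfty_le (num_real ((M - x0) / s))) => z.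
    by rewrite ler_pdivlMr// mulrC lerBrDl.
  have k7 : A x @[x --> +oo%R] --> +oo%R.
    apply/cvgryPge => M.
    apply: filterS (nbhs_pinfty_ge (num_real ((M - x0) / s))) => z.
    by rewrite ler_pdivrMr// mulrC lerBlDl.
  rewrite (increasing_ge0_integration_by_substitutionT k1 k2 k3 k4 k5 k6 k7 ch h0).
  apply: eq_integral => y _; congr EFin.
  rewrite A' /=; change ((h \o A) y * s = s * (oneDsqr y * h (A y)) / oneDsqr y).
  by rewrite /=; field; exact: wn.
have cgA : continuous (g \o A).
  by move=> z; apply: continuous_comp; [exact: cA|exact: cg].
have cnorm : continuous (fun y : R => `|g y|).
  by move=> y; apply: continuous_comp; [exact: cg|exact: norm_continuous].
have bn y : `|oneDsqr y * `|g y| | <= C.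
  by rewrite normrM normr_id -normrM.
have s1 := sub (fun y => `|g y|) cnorm bn (fun y => normr_ge0 _).
pose gp y := (`|g y| + g y) / 2.
have cgp : continuous gp.
  move=> y; apply: cvgM; last exact: cvg_cst.
  by apply: cvgD; [exact: cnorm|exact: cg].
have bgp y : `|oneDsqr y * gp y| <= C.
  apply: le_trans (bg y); rewrite [X in X <= _]normrM [X in _ <= X]normrM.
  apply: ler_wpM2l => //.
  have -> : `|gp y| = `| `|g y| + g y| / 2.
    by rewrite /gp normrM (@ger0_norm _ 2^-1) ?invr_ge0.
  rewrite ler_pdivrMr//.
  by apply: le_trans (ler_normD _ _) _; rewrite normr_id mulr_natr mulr2n.
have gp0 y : 0 <= gp y.
  by rewrite /gp divr_ge0//; have := lerNnormlW (lexx `|g y|); lra.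
have s2 := sub gp cgp bgp gp0.
have bK (h : R -> R) : (forall y, `|oneDsqr y * h y| <= C) -> forall y, `|oneDsqr y * h (A y)| <= K * C.
  move=> bh y; rewrite normrM ger0_norm ?(ltW (w_gt0 _))//.
  apply: (@le_trans _ _ (K * oneDsqr (A y) * `|h (A y)|)).
    by rewrite ler_wpM2r// affine_weight.
  rewrite -mulrA ler_wpM2l//.
    by rewrite /K addr_ge0// divr_ge0 ?sqr_ge0// addr_ge0// mulr_ge0// sqr_ge0.
  by have := bh (A y); rewrite normrM (ger0_norm (ltW (w_gt0 (A y)))).
have cm (h : R -> R) : continuous h -> continuous (fun y => oneDsqr y * h y).
  by move=> ch y; apply: cvgM; [exact: cw1|exact: ch].
have cmA (h : R -> R) : continuous h -> continuous (fun y => oneDsqr y * h (A y)).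
  move=> ch y; apply: cvgM; [exact: cw1|].
  by apply: continuous_comp; [exact: cA|exact: ch].
have dec (h1 h2 h3 : R -> R) D : continuous h1 -> continuous h2 ->
   (forall y, `|h1 y| <= D) -> (forall y, `|h2 y| <= D) ->
   (forall y, h3 y = 2 * h1 y + (-1) * h2 y) ->
   wR h3 = 2 * wR h1 + (-1) * wR h2.
  move=> c1 c2 b1 b2 e3; rewrite (_ : h3 = fun y => 2 * h1 y + (-1) * h2 y); last exact/funext.
  have D0 : 0 <= D by exact: le_trans (b1 0).
  rewrite (@wRD _ _ (2 * D) D).
  - by rewrite (wRZ 2 c1 b1) (wRZ (-1) c2 b2).
  - by move=> y; apply: cvgM; [exact: cvg_cst|exact: c1].
  - by move=> y; rewrite normrM ger0_norm// ler_wpM2l.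
  - by move=> y; apply: cvgM; [exact: cvg_cst|exact: c2].
  - by move=> y; rewrite mulN1r normrN.
rewrite (dec _ _ _ _ (cm _ cgp) (cm _ cnorm) bgp bn); last first.
  by move=> y; rewrite /gp; field.
rewrite (dec _ _ (fun z => oneDsqr z * g (x0 + s * z)) _ (cmA _ cgp) (cmA _ cnorm) (bK _ bgp) (bK _ bn)); last first.
  by move=> y; rewrite /gp /A; field.
by rewrite s1 s2; ring.
Qed.

End WeightedIntegral.

(** * Sequential limits in R[i] and complex weighted integrals *)

Section ComplexWeightedIntegral.
Context {R : realType}.
Local Open Scope classical_set_scope.
Implicit Types (G H : R -> R[i]) (C : R).

Definition ccvg (z : nat -> R[i]) (l : R[i]) : Prop := nc (z i - l) @[i --> \oo] --> (0 : R).

Lemma ccvgP (z : nat -> R[i]) l :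
  ccvg z l <-> (cRe (z i) @[i --> \oo] --> cRe l /\ cIm (z i) @[i --> \oo] --> cIm l).
Proof.
split=> [zl|[z1 z2]].
  have sq (p : R[i] -> R) : (forall a b, p (a - b) = p a - p b) ->
     (forall a, `|p a| <= nc a) -> p (z i) @[i --> \oo] --> p l.
    move=> pB pn; apply/subr_cvg0; apply: norm_cvg0.
    apply: (@squeeze_cvgr _ _ _ _ (cst 0) (fun i => nc (z i - l))) zl => //.
      by apply: nearW => i; rewrite normr_ge0 -pB pn.
    exact: cvg_cst.
  split; apply: sq.
  - by move=> a b; rewrite ReD ReN.
  - exact: nc_Re.
  - by move=> a b; rewrite ImD ImN.
  - exact: nc_Im.
apply: (@squeeze_cvgr _ _ _ _ (cst 0) (fun i => `|cRe (z i) - cRe l| + `|cIm (z i) - cIm l|)).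
- apply: nearW => i; rewrite nc_ge0 -!(ReN, ImN) -ReD -ImD; exact: nc_le_ReIm.
- exact: cvg_cst.
- rewrite -(addr0 (0 : R)); apply: cvgD.
    by rewrite -(normr0 R); apply: cvg_norm; apply/subr_cvg0.
  by rewrite -(normr0 R); apply: cvg_norm; apply/subr_cvg0.
Qed.

Lemma ccvg_cst (l : R[i]) : ccvg (fun=> l) l.
Proof. by apply/ccvgP; split; exact: cvg_cst. Qed.

Lemma ccvgD (y z : nat -> R[i]) l m : ccvg y l -> ccvg z m -> ccvg (fun i => y i + z i) (l + m).
Proof.
move=> /ccvgP[y1 y2] /ccvgP[z1 z2]; apply/ccvgP; rewrite ReD ImD; split.
  by under eq_fun do rewrite ReD; exact: cvgD.
by under eq_fun do rewrite ImD; exact: cvgD.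
Qed.

Lemma ccvgM (y z : nat -> R[i]) l m : ccvg y l -> ccvg z m -> ccvg (fun i => y i * z i) (l * m).
Proof.
move=> /ccvgP[y1 y2] /ccvgP[z1 z2]; apply/ccvgP; rewrite ReM ImM; split.
  by under eq_fun do rewrite ReM; apply: cvgB; exact: cvgM.
by under eq_fun do rewrite ImM; apply: cvgD; exact: cvgM.
Qed.

Lemma ccvg_nc (z : nat -> R[i]) l : ccvg z l -> nc (z i) @[i --> \oo] --> nc l.
Proof.
move=> zl; apply/subr_cvg0; apply: norm_cvg0.
apply: (@squeeze_cvgr _ _ _ _ (cst 0) (fun i => nc (z i - l))) zl => //; last exact: cvg_cst.
apply: nearW => i; rewrite normr_ge0 ler_norml lerBrDr lerBlDr /=.
have h1 := ncD (z i - l) l; have h2 := ncD (l - z i) (z i).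
rewrite !subrK in h1 h2; rewrite h1 andbT nc_distC; lra.
Qed.

Lemma ccvg_unique (z : nat -> R[i]) l m : ccvg z l -> ccvg z m -> l = m.
Proof.
move=> /ccvgP[y1 y2] /ccvgP[z1 z2]; apply: eq_ReIm.
  exact: (cvg_unique _ y1 z1).
exact: (cvg_unique _ y2 z2).
Qed.

Lemma ccvg_le (z : nat -> R[i]) l C : (forall i, nc (z i) <= C) -> ccvg z l -> nc l <= C.
Proof.
move=> zC /ccvg_nc h; apply: (closed_cvg (fun x => x <= C)) h.
- exact: closed_le.
- exact: nearW.
Qed.

(** Testing continuity on sequences lets dominated convergence, in the form [wR_cvg], yield
    continuity of integrals in a parameter. *)
Lemma seq_continuous (f : R -> R) p :
  (forall u : nat -> R, u i @[i --> \oo] --> p -> f (u i) @[i --> \oo] --> f p) ->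
  {for p, continuous f}.
Proof.
move=> h; apply/continuous_withinNx; apply/cvgr_dnbhsP => u [_ up].
exact: h.
Qed.

Lemma ccont_seq (G : R -> R[i]) (u : nat -> R) p : ccontinuous G ->
  u i @[i --> \oo] --> p -> ccvg (fun i => G (u i)) (G p).
Proof.
move=> [g1 g2] up; apply/ccvgP; split.
  exact: (cvg_comp u (fun x => cRe (G x)) up (g1 p)).
exact: (cvg_comp u (fun x => cIm (G x)) up (g2 p)).
Qed.

Lemma seq_ccont (G : R -> R[i]) :
  (forall (u : nat -> R) p, u i @[i --> \oo] --> p -> ccvg (fun i => G (u i)) (G p)) ->
  ccontinuous G.
Proof.
by move=> h; split => p; apply: seq_continuous => u /h /ccvgP[].
Qed.

Lemma ccontD (G H : R -> R[i]) : ccontinuous G -> ccontinuous H -> ccontinuous (fun y => G y + H y).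
Proof. by move=> g h; apply: seq_ccont => u p up; apply: ccvgD; exact: ccont_seq. Qed.

Lemma ccontM (G H : R -> R[i]) : ccontinuous G -> ccontinuous H -> ccontinuous (fun y => G y * H y).
Proof. by move=> g h; apply: seq_ccont => u p up; apply: ccvgM; exact: ccont_seq. Qed.

Lemma ccont_cst (c : R[i]) : ccontinuous (fun _ : R => c).
Proof. by split => y; exact: cvg_cst. Qed.

Lemma ccont_real (f : R -> R) : continuous f -> ccontinuous (fun y => (f y)%:C).
Proof. by move=> cf; split => y /=; [exact: cf|exact: cvg_cst]. Qed.

Lemma ccont_comp (G : R -> R[i]) (f : R -> R) : ccontinuous G -> continuous f ->
  ccontinuous (fun y => G (f y)).
Proof.
move=> [g1 g2] cf; split => y.
  by apply: (@continuous_comp _ _ _ f (fun x => cRe (G x))); [exact: cf|exact: g1].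
by apply: (@continuous_comp _ _ _ f (fun x => cIm (G x))); [exact: cf|exact: g2].
Qed.

Lemma ccont_sum (I : Type) (r : seq I) (P : pred I) (F : I -> R -> R[i]) :
  (forall i, ccontinuous (F i)) -> ccontinuous (fun y => \sum_(i <- r | P i) F i y).
Proof.
move=> cF; elim: r => [|i r IH].
  rewrite (_ : (fun y => _) = fun=> 0); last by apply/funext => y; rewrite big_nil.
  exact: ccont_cst.
case: (boolP (P i)) => Pi; last first.
  rewrite (_ : (fun y => _) = fun y => \sum_(j <- r | P j) F j y)//.
  by apply/funext => y; rewrite big_cons (negbTE Pi).
rewrite (_ : (fun y => _) = fun y => F i y + \sum_(j <- r | P j) F j y); first exact: ccontD.
by apply/funext => y; rewrite big_cons Pi.
Qed.

Lemma ccont_prod (I : Type) (r : seq I) (P : pred I) (F : I -> R -> R[i]) :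
  (forall i, ccontinuous (F i)) -> ccontinuous (fun y => \prod_(i <- r | P i) F i y).
Proof.
move=> cF; elim: r => [|i r IH].
  rewrite (_ : (fun y => _) = fun=> 1); last by apply/funext => y; rewrite big_nil.
  exact: ccont_cst.
case: (boolP (P i)) => Pi; last first.
  rewrite (_ : (fun y => _) = fun y => \prod_(j <- r | P j) F j y)//.
  by apply/funext => y; rewrite big_cons (negbTE Pi).
rewrite (_ : (fun y => _) = fun y => F i y * \prod_(j <- r | P j) F j y); first exact: ccontM.
by apply/funext => y; rewrite big_cons Pi.
Qed.

Definition wint G : R[i] := wR (fun y => cRe (G y)) +i* wR (fun y => cIm (G y)).
(** The constant of [wint_bound]; the factor 2 comes from bounding real and imaginary parts
    separately. *)
Definition kap : R := 2 * wmass.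

Lemma kap_ge0 : 0 <= kap. Proof. by rewrite mulr_ge0// wmass_ge0. Qed.

Lemma bRe G C : (forall y, nc (G y) <= C) -> forall y, `|cRe (G y)| <= C.
Proof. by move=> b y; exact: le_trans (nc_Re _) (b y). Qed.
Lemma bIm G C : (forall y, nc (G y) <= C) -> forall y, `|cIm (G y)| <= C.
Proof. by move=> b y; exact: le_trans (nc_Im _) (b y). Qed.

Lemma wint_ext G H : G =1 H -> wint G = wint H.
Proof. by move=> /funext ->. Qed.

Lemma wintD G H C D : ccontinuous G -> (forall y, nc (G y) <= C) ->
  ccontinuous H -> (forall y, nc (H y) <= D) ->
  wint (fun y => G y + H y) = wint G + wint H.
Proof.
move=> [g1 g2] gC [h1 h2] hD; apply: eq_ReIm; rewrite ?ReD ?ImD /=.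
  rewrite -(wRD g1 (bRe gC) h1 (bRe hD)); congr wR.
  by apply/funext => y; rewrite ReD.
rewrite -(wRD g2 (bIm gC) h2 (bIm hD)); congr wR.
by apply/funext => y; rewrite ImD.
Qed.

Lemma wintZ (c : R[i]) G C : ccontinuous G -> (forall y, nc (G y) <= C) ->
  wint (fun y => c * G y) = c * wint G.
Proof.
move=> [g1 g2] gC; have [b1 b2] := (bRe gC, bIm gC).
have cz (a : R) (f : R -> R) : continuous f -> continuous (fun y => a * f y).
  by move=> cf y; apply: cvgM; [exact: cvg_cst|exact: cf].
have bz (a : R) (f : R -> R) : (forall y, `|f y| <= C) -> forall y, `|a * f y| <= `|a| * C.
  by move=> bf y; rewrite normrM ler_wpM2l.
apply: eq_ReIm; rewrite ?ReM ?ImM /=.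
  rewrite -mulNr -(wRZ _ g1 b1) -(wRZ _ g2 b2).
  rewrite -(wRD (cz _ _ g1) (bz _ _ b1) (cz _ _ g2) (bz _ _ b2)); congr wR.
  by apply/funext => y; rewrite ReM mulNr.
rewrite -(wRZ _ g1 b1) -(wRZ _ g2 b2).
rewrite -(wRD (cz _ _ g2) (bz _ _ b2) (cz _ _ g1) (bz _ _ b1)); congr wR.
by apply/funext => y; rewrite ImM.
Qed.

Lemma wint_bound G C : ccontinuous G -> (forall y, nc (G y) <= C) ->
  nc (wint G) <= kap * C.
Proof.
move=> [g1 g2] gC; apply: le_trans (nc_le_ReIm _) _ => /=.
rewrite /kap -mulrA mulr_natl mulr2n.
by apply: lerD; apply: wR_bound => //; [exact: bRe|exact: bIm].
Qed.

Lemma wint_cvg (G_ : nat -> R -> R[i]) G C :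
  (forall i, ccontinuous (G_ i)) -> ccontinuous G ->
  (forall i y, nc (G_ i y) <= C) -> (forall y, ccvg (G_ ^~ y) (G y)) ->
  ccvg (fun i => wint (G_ i)) (wint G).
Proof.
move=> cGi [g1 g2] bG GG; apply/ccvgP; split => /=.
  apply: (@wR_cvg _ _ _ C) => // [i|i y|y]; first by case: (cGi i).
  - by apply: bRe.
  - by have /ccvgP[] := GG y.
apply: (@wR_cvg _ _ _ C) => // [i|i y|y]; first by case: (cGi i).
- by apply: bIm.
- by have /ccvgP[] := GG y.
Qed.

Lemma wint_diff (G G' : R -> R -> R[i]) (C lo hi t : R) :
  lo < t < hi ->
  (forall s y : R, lo < s < hi -> cder (G ^~ y) s (G' s y)) ->
  (forall s y : R, lo < s < hi -> nc (G' s y) <= C) ->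
  (forall s : R, lo < s < hi -> ccontinuous (G s)) ->
  (forall s : R, lo < s < hi -> exists D, forall y, nc (G s y) <= D) ->
  cder (fun s => wint (G s)) t (wint (G' t)).
Proof.
move=> tI dG bG' cG bG; split => /=.
  apply: (@wR_diff _ _ (fun s y => cRe (G' s y)) C lo hi) => // s.
  - by move=> y /dG-/(_ y)[].
  - by move=> y sI; apply: (bRe (G:=G' s)) => z; apply: bG'.
  - by move=> /cG[].
  - by move=> /bG[D bD]; exists D; exact: bRe.
apply: (@wR_diff _ _ (fun s y => cIm (G' s y)) C lo hi) => // s.
- by move=> y /dG-/(_ y)[].
- by move=> y sI; apply: (bIm (G:=G' s)) => z; apply: bG'.
- by move=> /cG[].
- by move=> /bG[D bD]; exists D; exact: bIm.
Qed.

Lemma Re_wM (a : R) (z : R[i]) : cRe (a%:C * z) = a * cRe z.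
Proof. by rewrite ReM /= mul0r subr0. Qed.
Lemma Im_wM (a : R) (z : R[i]) : cIm (a%:C * z) = a * cIm z.
Proof. by rewrite ImM /= mul0r addr0. Qed.

Lemma wint_FTC (F F' : R -> R[i]) C :
  (forall y, cder F y (F' y)) -> ccontinuous F' ->
  (forall y, nc ((oneDsqr y)%:C * F y) <= C) ->
  (forall y, nc ((oneDsqr y)%:C * F' y) <= C) ->
  wint (fun y => (oneDsqr y)%:C * F' y) = 0.
Proof.
move=> dF [c1 c2] bF bF'; apply: eq_ReIm => /=.
  under eq_fun do rewrite Re_wM.
  apply: (@wR_FTC _ (fun y => cRe (F y)) _ C) => // y.
  - by case: (dF y).
  - by rewrite -Re_wM; apply: (bRe bF).
  - by rewrite -Re_wM; apply: (bRe bF').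
under eq_fun do rewrite Im_wM.
apply: (@wR_FTC _ (fun y => cIm (F y)) _ C) => // y.
- by case: (dF y).
- by rewrite -Im_wM; apply: (bIm bF).
- by rewrite -Im_wM; apply: (bIm bF').
Qed.

Lemma wint_affine G (C x0 s : R) : 0 < s -> ccontinuous G ->
  (forall y, nc ((oneDsqr y)%:C * G y) <= C) ->
  wint (fun y => (oneDsqr y)%:C * G y) =
  s%:C * wint (fun z => (oneDsqr z)%:C * G (x0 + s * z)).
Proof.
move=> s0 [c1 c2] bG; apply: eq_ReIm; rewrite ?Re_wM ?Im_wM /=.
  under eq_fun do rewrite Re_wM; rewrite (@wR_affine _ (fun y => cRe (G y)) C x0 s)//.
    by under [in RHS]eq_fun do rewrite Re_wM.
  by move=> y; rewrite -Re_wM; apply: (bRe bG).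
under eq_fun do rewrite Im_wM; rewrite (@wR_affine _ (fun y => cIm (G y)) C x0 s)//.
  by under [in RHS]eq_fun do rewrite Im_wM.
by move=> y; rewrite -Im_wM; apply: (bIm bG).
Qed.

End ComplexWeightedIntegral.

Arguments Normc.normc : simpl never.

(** * Iterated integration over coordinates *)

Section IteratedIntegral.
Context {R : realType} {n : nat}.
Local Open Scope classical_set_scope.
Implicit Types (g h : 'rV[R]_n -> R[i]) (x : 'rV[R]_n) (C : R) (j k : 'I_n).

Definition upd x j (y : R) : 'rV[R]_n := \row_k (if k == j then y else x 0 k).

Lemma updE x j y k : upd x j y 0 k = if k == j then y else x 0 k.
Proof. by rewrite mxE. Qed.

Lemma upd_same x j y : upd x j y 0 j = y.
Proof. by rewrite updE eqxx. Qed.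

Lemma upd_id x j : upd x j (x 0 j) = x.
Proof. by apply/rowP => k; rewrite updE; case: eqP => [->|]. Qed.

Lemma upd_upd x j y z : upd (upd x j y) j z = upd x j z.
Proof. by apply/rowP => k; rewrite !updE; case: eqP. Qed.

Lemma upd_comm x j k y z : j != k -> upd (upd x j y) k z = upd (upd x k z) j y.
Proof.
move=> jk; apply/rowP => i; rewrite !updE.
by case: eqP => [->|//]; case: eqP => // kj; rewrite kj eqxx in jk.
Qed.

(* Separate continuity is what iterated integration needs and, unlike joint
   continuity, it passes to partial integrals. *)
Definition sepc g := forall x j, ccontinuous (fun y : R => g (upd x j y)).
Definition bdd C g := forall x, nc (g x) <= C.

(** The partial integral remains a function of the full vector, constant in the coordinate
    integrated out, so that iteration is a plain [foldr]. *)
Definition Ek k g x : R[i] := wint (fun y => g (upd x k y)).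
Definition Es (s : seq 'I_n) g : 'rV[R]_n -> R[i] := foldr Ek g s.

Lemma Ek_bound_at k g x C : sepc g -> (forall y, nc (g (upd x k y)) <= C) ->
  nc (Ek k g x) <= kap * C.
Proof. by move=> cg gC; apply: wint_bound. Qed.

Lemma Ek_cvg k (g_ : nat -> 'rV[R]_n -> R[i]) g C x :
  (forall i, sepc (g_ i)) -> sepc g -> (forall i, bdd C (g_ i)) ->
  (forall z, ccvg (g_ ^~ z) (g z)) -> ccvg (fun i => Ek k (g_ i) x) (Ek k g x).
Proof.
move=> cgi cg bg gg; apply: (@wint_cvg _ _ _ C) => //.
- by move=> i; exact: cgi.
- by move=> i y; exact: bg.
Qed.

Lemma Ek_sepc k g C : sepc g -> bdd C g -> sepc (Ek k g).
Proof.
move=> cg bg x j; apply: seq_ccont => u p up; rewrite /Ek.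
have [->|jk] := eqVneq j k.
  have e z : wint (fun y => g (upd (upd x k z) k y)) = wint (fun y => g (upd x k y)).
    by apply: wint_ext => y; rewrite upd_upd.
  by rewrite e; under eq_fun do rewrite e; exact: ccvg_cst.
apply: (@wint_cvg _ _ _ C).
- by move=> i; exact: cg.
- exact: cg.
- by move=> i y; exact: bg.
- move=> y; rewrite upd_comm//; under eq_fun do rewrite upd_comm//.
  exact: ccont_seq (cg _ _) up.
Qed.

Lemma Ek_bdd k g C : sepc g -> bdd C g -> bdd (kap * C) (Ek k g).
Proof. by move=> cg bg x; apply: Ek_bound_at => // y; exact: bg. Qed.

Lemma Es_adm s g C : sepc g -> bdd C g ->
  sepc (Es s g) /\ bdd (kap ^+ size s * C) (Es s g).
Proof.
move=> cg bg; elim: s => [|k s [IH1 IH2]] /=; first by rewrite mul1r.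
split; first exact: Ek_sepc IH1 IH2.
by rewrite exprS -mulrA; exact: Ek_bdd.
Qed.

(** The bound [b] may depend on the coordinates outside [s]. It is used with C / [wj k], to keep the
    decay in a coordinate that is integrated afterwards. *)
Lemma Es_bound s g (b : 'rV[R]_n -> R) C : sepc g -> bdd C g ->
  (forall k x y, k \in s -> b (upd x k y) = b x) ->
  (forall x, nc (g x) <= b x) ->
  forall x, nc (Es s g x) <= kap ^+ size s * b x.
Proof.
move=> cg bg; elim: s => [|k s IH] bs gb x /=; first by rewrite mul1r.
rewrite exprS -mulrA; apply: Ek_bound_at.
  by case: (Es_adm s cg bg).
move=> y; rewrite -(bs k x y) ?mem_head//; apply: IH => // k' x' y' k's.
by apply: bs; rewrite inE k's orbT.
Qed.

Lemma EsD s g h C D : sepc g -> bdd C g -> sepc h -> bdd D h ->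
  forall x, Es s (fun z => g z + h z) x = Es s g x + Es s h x.
Proof.
move=> cg bg ch bh; elim: s => [//|k s IH] x /=.
have [g1 g2] := Es_adm s cg bg; have [h1 h2] := Es_adm s ch bh.
rewrite -/(Es s _) (_ : Es s _ = fun z => Es s g z + Es s h z); last exact/funext.
by apply: wintD; [exact: g1|move=> y; exact: g2|exact: h1|move=> y; exact: h2].
Qed.

Lemma EsM s (c : 'rV[R]_n -> R[i]) g C : sepc g -> bdd C g ->
  (forall k x y, k \in s -> c (upd x k y) = c x) ->
  forall x, Es s (fun z => c z * g z) x = c x * Es s g x.
Proof.
move=> cg bg; elim: s => [//|k s IH] cs x /=.
have [g1 g2] := Es_adm s cg bg.
rewrite -/(Es s _) (_ : Es s _ = fun z => c z * Es s g z); last first.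
  by apply/funext => z; apply: IH => k' x' y' k's; apply: cs; rewrite inE k's orbT.
rewrite /Ek; under eq_fun do rewrite cs ?mem_head//.
by apply: wintZ; [exact: g1|move=> y; exact: g2].
Qed.

Lemma EsZ s (c : R[i]) g C : sepc g -> bdd C g ->
  forall x, Es s (fun z => c * g z) x = c * Es s g x.
Proof. by move=> cg bg x; apply: (@EsM s (fun=> c) g C). Qed.

Lemma Es0 s x : Es s (fun=> 0) x = 0.
Proof.
have c0 : sepc (fun=> 0) by move=> y k; exact: ccont_cst.
have b0 : bdd 0 (fun=> 0) by move=> y; rewrite Normc.normc0.
by rewrite -[RHS](mul0r (Es s (fun=> 0) x)) -(EsZ s 0 c0 b0); congr Es; apply/funext => z; rewrite mul0r.
Qed.

Lemma Es_cvg s (g_ : nat -> 'rV[R]_n -> R[i]) g C x :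
  (forall i, sepc (g_ i)) -> sepc g -> (forall i, bdd C (g_ i)) ->
  (forall z, ccvg (g_ ^~ z) (g z)) -> ccvg (fun i => Es s (g_ i) x) (Es s g x).
Proof.
move=> cgi cg bgi gg.
have bg : bdd C g by move=> z; exact: ccvg_le (fun i => bgi i z) (gg z).
elim: s x => [//|k s IH] x /=; apply: (@Ek_cvg _ _ _ (kap ^+ size s * C)) => //.
- by move=> i; case: (Es_adm s (cgi i) (bgi i)).
- by case: (Es_adm s cg bg).
- by move=> i; case: (Es_adm s (cgi i) (bgi i)).
Qed.

Lemma Es_diff s (g g' : R -> 'rV[R]_n -> R[i]) (C lo hi : R) :
  (forall t x, lo < t < hi -> cder (g ^~ x) t (g' t x)) ->
  (forall t, lo < t < hi -> bdd C (g' t)) ->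
  (forall t, lo < t < hi -> sepc (g t)) -> (forall t, lo < t < hi -> sepc (g' t)) ->
  (forall t, lo < t < hi -> exists D, bdd D (g t)) ->
  forall t x, lo < t < hi -> cder (fun r => Es s (g r) x) t (Es s (g' t) x).
Proof.
move=> dg bg' cg cg' bg; elim: s => [|k s IH] t x tI /=; first exact: dg.
apply: (@wint_diff _ (fun r y => Es s (g r) (upd x k y)) (fun r y => Es s (g' r) (upd x k y))
  (kap ^+ size s * C) lo hi) => //.
- by move=> r y rI; exact: IH.
- by move=> r y rI; case: (Es_adm s (cg' r rI) (bg' r rI)) => _; apply.
- move=> r rI; have [D bD] := bg r rI.
  by case: (Es_adm s (cg r rI) bD) => + _; apply.
- move=> r rI; have [D bD] := bg r rI; exists (kap ^+ size s * D) => y.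
  by case: (Es_adm s (cg r rI) bD) => _; apply.
Qed.

Definition pder j g x (l : R[i]) := cder (fun y => g (upd x j y)) (x 0 j) l.

Lemma pder_line j g g' : (forall x, pder j g x (g' x)) ->
  forall x y, cder (fun z => g (upd x j z)) y (g' (upd x j y)).
Proof.
move=> dg x y; have := dg (upd x j y); rewrite /pder upd_same.
by apply: cder_ext => z; rewrite upd_upd.
Qed.

Lemma pder_sepc g (g' : 'I_n -> 'rV[R]_n -> R[i]) :
  (forall j x, pder j g x (g' j x)) -> sepc g.
Proof. by move=> dg x j; apply: cder_continuous; exact: pder_line (dg j) x. Qed.

Lemma Es_upd s j g (r : R) z : j \notin s ->
  Es s g (upd z j r) = Es s (fun w => g (upd w j r)) z.
Proof.
elim: s z => [//|k s IH] z; rewrite inE negb_or => /andP[jk js].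
by apply: wint_ext => y; rewrite upd_comm//; exact: IH.
Qed.

Lemma Es_pder s j g g' C : j \notin s ->
  (forall x, pder j g x (g' x)) -> sepc g -> bdd C g -> sepc g' -> bdd C g' ->
  forall x, pder j (Es s g) x (Es s g' x).
Proof.
move=> js dg cg bg cg' bg' x; rewrite /pder.
have cu (f : 'rV[R]_n -> R[i]) r : sepc f -> sepc (fun w => f (upd w j r)).
  move=> cf w k; have [->|kj] := eqVneq k j.
    by under eq_fun do rewrite upd_upd; exact: ccont_cst.
  by under eq_fun do rewrite upd_comm//; exact: cf.
have -> : (fun y => Es s g (upd x j y)) = (fun y => Es s (fun w => g (upd w j y)) x).
  by apply/funext => y; exact: Es_upd.
have -> : Es s g' x = Es s (fun w => g' (upd w j (x 0 j))) x by rewrite -Es_upd// upd_id.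
apply: (@Es_diff s (fun y w => g (upd w j y)) (fun y w => g' (upd w j y)) C (x 0 j - 1) (x 0 j + 1)).
- by move=> t w _; exact: pder_line.
- by move=> t _ w; exact: bg'.
- by move=> t _; exact: cu.
- by move=> t _; exact: cu.
- by move=> t _; exists C => w; exact: bg.
- by rewrite ltrBlDr !ltrDl ltr01.
Qed.

Definition wj j x : R := oneDsqr (x 0 j).

Lemma wj_gt0 j x : 0 < wj j x. Proof. exact: w_gt0. Qed.

(** If the outermost coordinate is not [j], the inner integral is already 0 by induction. If it is
    [j], the weight [wj j] is constant for the inner integrals and leaves them, the derivative
    enters them by [Es_pder], and [wint_FTC] concludes. *)
Lemma Es_IBP s j g g' C x : j \in s -> uniq s ->
  (forall x, pder j g x (g' x)) -> sepc g -> sepc g' ->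
  bdd C (fun x => (wj j x)%:C * g x) -> bdd C (fun x => (wj j x)%:C * g' x) ->
  Es s (fun x => (wj j x)%:C * g' x) x = 0.
Proof.
move=> + + dg cg cg' bg bg'.
have C0 : 0 <= C by exact: le_trans (nc_ge0 _) (bg 0).
have bw (f : 'rV[R]_n -> R[i]) : bdd C (fun x => (wj j x)%:C * f x) -> forall x, nc (f x) <= C / wj j x.
  move=> bf z; rewrite ler_pdivlMr ?wj_gt0// mulrC.
  by have := bf z; rewrite ncM nc_real (ger0_norm (ltW (wj_gt0 _ _))).
have bb (f : 'rV[R]_n -> R[i]) : bdd C (fun x => (wj j x)%:C * f x) -> bdd C f.
  move=> bf z; apply: le_trans (bw f bf z) _; rewrite ler_pdivrMr ?wj_gt0//.
  by rewrite ler_peMr//; exact: oneDsqr_ge1.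
elim: s x => [//|k s IH] x; rewrite inE => jks /= /andP[ks us].
move: jks; have [jk _|jk /= js] := eqVneq j k; last first.
  rewrite (_ : Es s _ = fun=> 0); last by apply/funext => z; exact: IH.
  exact: (Es0 [:: k]).
rewrite -jk in ks *.
have winv k' z y : k' \in s -> wj j (upd z k' y) = wj j z.
  move=> k's; rewrite /wj updE; case: eqP => // e.
  by rewrite e k's in ks.
have e1 : Es s (fun x => (wj j x)%:C * g' x) = fun z => (wj j z)%:C * Es s g' z.
  apply/funext => z; apply: (@EsM s (fun z => (wj j z)%:C) g' C cg' (bb _ bg')).
  by move=> k' x' y' /winv ->.
rewrite e1 /Ek; under eq_fun do rewrite /wj upd_same.
have dE := Es_pder ks dg cg (bb _ bg) cg' (bb _ bg').
have bE (f : 'rV[R]_n -> R[i]) : sepc f -> bdd C (fun x => (wj j x)%:C * f x) ->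
    forall y, nc ((oneDsqr y)%:C * Es s f (upd x j y)) <= kap ^+ size s * C.
  move=> cf bf y.
  have := @Es_bound s f (fun z => C / wj j z) C cf (bb _ bf) _ (bw _ bf) (upd x j y).
  rewrite ncM nc_real (ger0_norm (ltW (w_gt0 _))) {3}/wj upd_same => h.
  rewrite mulrC -ler_pdivlMr ?w_gt0// -mulrA; apply: h.
  by move=> k' z y' /winv ->.
apply: (@wint_FTC _ (fun y => Es s g (upd x j y)) _ (kap ^+ size s * C)).
- by move=> y; exact: pder_line dE x y.
- by case: (Es_adm s cg' (bb _ bg')) => + _; apply.
- exact: bE.
- exact: bE.
Qed.

(** Only the coordinates in [s] are moved, so that the change of variables can be proved by
    induction on [s]. *)
Definition affs (s : seq 'I_n) (x0 : 'rV[R]_n) (r : R) x : 'rV[R]_n :=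
  \row_k (if k \in s then x0 0 k + r * x 0 k else x 0 k).

Definition Wsub (s : seq 'I_n) x : R := \prod_(k <- s) wj k x.

Lemma Wsub_upd s k x y : k \notin s -> Wsub s (upd x k y) = Wsub s x.
Proof.
move=> ks; rewrite /Wsub; apply: eq_big_seq => k' k's.
by rewrite /wj updE; case: eqP => // e; rewrite -e k's in ks.
Qed.

Lemma Wsub_ge1 s x : 1 <= Wsub s x.
Proof.
rewrite /Wsub; elim: s => [|k s IH]; first by rewrite big_nil.
rewrite big_cons; apply: le_trans IH _; rewrite ler_peMl//.
  by apply: prodr_ge0 => i _; exact: ltW (wj_gt0 _ _).
exact: oneDsqr_ge1.
Qed.

Lemma Wsub_gt0 s x : 0 < Wsub s x.
Proof. exact: lt_le_trans ltr01 (Wsub_ge1 s x). Qed.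

Lemma sepc_Wsub s : sepc (fun x => (Wsub s x)%:C).
Proof.
move=> x j; apply: ccont_real; rewrite /Wsub; elim: s => [|k s IH].
  by under eq_fun do rewrite big_nil; move=> y; exact: cvg_cst.
under eq_fun do rewrite big_cons; move=> y; apply: cvgM; last exact: IH.
rewrite /wj; have [->|kj] := eqVneq k j.
  by under eq_fun do rewrite upd_same; rewrite upd_same; exact: continuous_oneDsqr.
by under eq_fun do rewrite updE (negbTE kj); rewrite updE (negbTE kj); exact: cvg_cst.
Qed.

Lemma sepcM g h : sepc g -> sepc h -> sepc (fun x => g x * h x).
Proof. by move=> cg ch x j; exact: ccontM. Qed.

Lemma sepcD g h : sepc g -> sepc h -> sepc (fun x => g x + h x).
Proof. by move=> cg ch x j; exact: ccontD. Qed.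

Lemma sepc_cst (c : R[i]) : sepc (fun=> c).
Proof. by move=> x j; exact: ccont_cst. Qed.

Lemma affs_upd s x0 r x j y : affs s x0 r (upd x j y) =
  upd (affs s x0 r x) j (if j \in s then x0 0 j + r * y else y).
Proof.
apply/rowP => k; rewrite !(updE, mxE); case: (eqVneq k j) => [->|kj] //.
Qed.

Lemma sepc_affs s x0 r g : sepc g -> sepc (fun x => g (affs s x0 r x)).
Proof.
move=> cg x j; under eq_fun do rewrite affs_upd.
case: (j \in s); last exact: cg.
apply: (@ccont_comp _ (fun y => g (upd (affs s x0 r x) j y)) (fun y => x0 0 j + r * y)).
  exact: cg.
move=> y; apply: cvgD; first exact: cvg_cst.
by apply: cvgM; [exact: cvg_cst|exact: cvg_id].
Qed.

Definition affK (x0 : 'rV[R]_n) (r : R) k : R := 1 + (2 + 2 * x0 0 k ^+ 2) / r ^+ 2.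

Lemma affK_ge1 x0 r k : 1 <= affK x0 r k.
Proof.
by rewrite lerDl divr_ge0 ?sqr_ge0// addr_ge0// mulr_ge0// sqr_ge0.
Qed.

Lemma Wsub_affs s t x0 r x : 0 < r ->
  Wsub t x <= (\prod_(k <- t) affK x0 r k) * Wsub t (affs s x0 r x).
Proof.
move=> r0; rewrite /Wsub -big_split /=.
elim: t => [|k t IH]; first by rewrite !big_nil.
rewrite !big_cons; apply: ler_pM => //.
- exact: ltW (wj_gt0 _ _).
- by apply: prodr_ge0 => i _; exact: ltW (wj_gt0 _ _).
rewrite /wj mxE; case: ifP => _; first exact: affine_weight.
by rewrite ler_peMl// ?affK_ge1//; exact: ltW (w_gt0 _).
Qed.

Lemma bdd_affs s t x0 r g C : 0 < r -> bdd C (fun x => (Wsub t x)%:C * g x) ->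
  bdd ((\prod_(k <- t) affK x0 r k) * C) (fun x => (Wsub t x)%:C * g (affs s x0 r x)).
Proof.
move=> r0 bg x; have := bg (affs s x0 r x).
rewrite !ncM !nc_real !(ger0_norm (ltW (Wsub_gt0 _ _))) => h.
apply: le_trans (ler_wpM2r (nc_ge0 _) (Wsub_affs s t x0 x r0)) _.
rewrite -mulrA ler_wpM2l//; apply: prodr_ge0 => k _.
exact: le_trans ler01 (affK_ge1 _ _ _).
Qed.

Lemma bdd_Wcons k s g C : bdd C (fun x => (Wsub (k :: s) x)%:C * g x) ->
  bdd C (fun x => (Wsub s x)%:C * g x).
Proof.
move=> bg x; apply: le_trans (bg x); rewrite !ncM ler_wpM2r ?nc_ge0//.
rewrite !nc_real !ger0_norm ?(ltW (Wsub_gt0 _ _))// {2}/Wsub big_cons.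
by rewrite ler_peMl ?(ltW (Wsub_gt0 _ _))//; exact: oneDsqr_ge1.
Qed.

(** The inner coordinates are substituted by induction and the outer one by [wint_affine]. The
    latter asks the inner integral to decay in the outer variable; this is the weight of [k] in the
    hypothesis on [g], carried through by [Es_bound]. *)
Lemma Es_affine s g C x0 r x : uniq s -> 0 < r -> sepc g ->
  bdd C (fun x => (Wsub s x)%:C * g x) ->
  Es s (fun x => (Wsub s x)%:C * g x) x =
  (r ^+ size s)%:C * Es s (fun x => (Wsub s x)%:C * g (affs s x0 r x)) x.
Proof.
move=> + r0; elim: s g C x => [|k s IH] g C x /=.
  move=> _ _ _; rewrite mul1r; congr (_ * g _).
  by apply/rowP => k; rewrite mxE.
move=> /andP[ks us] cg bg.
have bs := bdd_Wcons bg.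
have bsa := @bdd_affs s s x0 r g C r0 bs.
have ca := @sepc_affs s x0 r g cg.
have fac (h : 'rV[R]_n -> R[i]) D z : sepc h -> bdd D (fun x => (Wsub s x)%:C * h x) ->
    Es s (fun x => (Wsub (k :: s) x)%:C * h x) z =
    (wj k z)%:C * Es s (fun x => (Wsub s x)%:C * h x) z.
  move=> ch bh; rewrite -(@EsM s (fun z => (wj k z)%:C) _ D (sepcM (@sepc_Wsub s) ch) bh).
    by congr Es; apply/funext => w; rewrite /Wsub big_cons rmorphM mulrA.
  move=> k' w y k's; rewrite /wj updE; case: eqP => // e.
  by rewrite -e (negbTE ks) in k's.
have cW := sepcM (@sepc_Wsub s) ca.
rewrite /Ek; under eq_fun do rewrite -/(Es s _) (fac _ C _ cg bs) /wj upd_same (IH _ _ _ us cg bs) mulrCA.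
set G := fun y => Es s (fun x => (Wsub s x)%:C * g (affs s x0 r x)) (upd x k y).
have cG : ccontinuous G by case: (Es_adm s cW bsa) => + _; apply.
have P0 : 0 <= \prod_(k <- k :: s) affK x0 r k.
  by apply: prodr_ge0 => i _; exact: le_trans ler01 (affK_ge1 _ _ _).
pose D := (\prod_(k <- k :: s) affK x0 r k) * C.
have bG y : nc ((oneDsqr y)%:C * G y) <= kap ^+ size s * D.
  have hb := @bdd_affs s (k :: s) x0 r g C r0 bg.
  have := @Es_bound s _ (fun z => D / wj k z) _ cW bsa _ _ (upd x k y).
  rewrite -/(G y) ncM nc_real (ger0_norm (ltW (w_gt0 _))) /wj upd_same => h.
  rewrite mulrC -ler_pdivlMr ?w_gt0// -mulrA; apply: h.
    move=> k' z y' k's; rewrite updE; case: eqP => // e.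
    by rewrite -e (negbTE ks) in k's.
  move=> z; rewrite ler_pdivlMr ?w_gt0//; apply: le_trans (hb z).
  rewrite !ncM !nc_real {2}/Wsub big_cons normrM /wj.
  by rewrite (ger0_norm (ltW (w_gt0 (z 0 k)))) mulrC mulrA.
rewrite (@wintZ _ _ (fun y => (oneDsqr y)%:C * G y) _ _ bG); last first.
  by apply: ccontM => //; apply: ccont_real; exact: continuous_oneDsqr.
rewrite (@wint_affine _ G _ (x0 0 k) r r0 cG bG) mulrA -rmorphM -exprSr; congr (_ * wint _).
apply/funext => z.
have ca2 := @sepc_affs (k :: s) x0 r g cg.
have b2 := bdd_Wcons (@bdd_affs (k :: s) (k :: s) x0 r g C r0 bg).
rewrite (fac _ _ _ ca2 b2) /wj upd_same /G; congr (_ * _).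
rewrite !Es_upd//; congr Es; apply/funext => w.
rewrite !Wsub_upd//; congr (_ * g _); apply/rowP => i.
rewrite !(mxE, inE); case: (eqVneq i k) => [->|ik] //=.
by rewrite (negbTE ks).
Qed.

Lemma Es_prod s (h : R -> R[i]) C x : uniq s -> ccontinuous h -> (forall y, nc (h y) <= C) ->
  Es s (fun x => \prod_(k <- s) h (x 0 k)) x = wint h ^+ size s.
Proof.
move=> + ch bh; elim: s x => [|k s IH] x; first by rewrite /= big_nil expr0.
move=> /= /andP[ks us]; rewrite exprS.
have chk j : sepc (fun z : 'rV[R]_n => h (z 0 j)).
  move=> z i; have [->|ji] := eqVneq j i.
    by under eq_fun do rewrite upd_same.
  by under eq_fun do rewrite updE (negbTE ji); exact: ccont_cst.
have cs t : sepc (fun z : 'rV[R]_n => \prod_(k <- t) h (z 0 k)).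
  by move=> w i; apply: (@ccont_prod _ _ t xpredT (fun k y => h (upd w i y 0 k))) => i0; exact: chk.
have C0 : 0 <= C by exact: le_trans (nc_ge0 _) (bh 0).
have bs t : bdd (C ^+ size t) (fun z : 'rV[R]_n => \prod_(k <- t) h (z 0 k)).
  move=> z; elim: t => [|j t IHt]; first by rewrite big_nil expr0 Normc.normc1.
  by rewrite big_cons exprS ncM; apply: ler_pM; rewrite ?nc_ge0.
rewrite -/(Es s _) (_ : Es s _ = fun z => wint h ^+ size s * h (z 0 k)); last first.
  apply/funext => z.
  rewrite (_ : (fun _ => _) = fun w : 'rV[R]_n => h (w 0 k) * \prod_(k <- s) h (w 0 k)); last first.
    by apply/funext => w; rewrite big_cons.
  have inv j w y : j \in s -> h (upd w j y 0 k) = h (w 0 k).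
    by move=> js; rewrite updE; case: eqP => // e; rewrite -e (negbTE ks) in js.
  transitivity (h (z 0 k) * Es s (fun w => \prod_(j <- s) h (w 0 j)) z).
    exact: (@EsM s (fun w => h (w 0 k)) _ _ (cs s) (bs s) inv z).
  by rewrite (IH z us) mulrC.
rewrite /Ek; under eq_fun do rewrite upd_same.
by rewrite (wintZ _ ch bh) mulrC.
Qed.

End IteratedIntegral.

(** * The integral over R^n and Gaussian approximate identities *)

Section FullIntegral.
Context {R : realType} {n : nat}.
Local Open Scope classical_set_scope.
Implicit Types (g h : 'rV[R]_n -> R[i]) (x z : 'rV[R]_n) (C : R) (j k : 'I_n).

(* The factor Wt cancels the weights 1 / (1 + y^2), so Ig is the Lebesgue integral over
   R^n, on the class of g for which Wt * g is bounded. *)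
Definition Wt x : R := Wsub (enum 'I_n) x.
Definition Ig g : R[i] := Es (enum 'I_n) (fun x => (Wt x)%:C * g x) 0.
Definition dom C g := bdd C (fun x => (Wt x)%:C * g x).

Lemma Wt_gt0 x : 0 < Wt x. Proof. exact: Wsub_gt0. Qed.
Lemma Wt_ge1 x : 1 <= Wt x. Proof. exact: Wsub_ge1. Qed.
Lemma sepc_Wt : sepc (fun x => (Wt x)%:C). Proof. exact: sepc_Wsub. Qed.

Lemma domE C g : dom C g <-> forall x, Wt x * nc (g x) <= C.
Proof.
have e x : nc ((Wt x)%:C * g x) = Wt x * nc (g x).
  by rewrite ncM nc_real ger0_norm// ltW// Wt_gt0.
by split=> h x; have := h x; rewrite e.
Qed.

Lemma Ig_bound C g : sepc g -> dom C g -> nc (Ig g) <= kap ^+ n * C.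
Proof.
move=> cg dg; have [_ /(_ 0)] := Es_adm (enum 'I_n) (sepcM sepc_Wt cg) dg.
by rewrite size_enum_ord.
Qed.

Lemma Ig_ext g h : g =1 h -> Ig g = Ig h.
Proof. by move=> /funext ->. Qed.

Lemma IgD g h C D : sepc g -> dom C g -> sepc h -> dom D h ->
  Ig (fun x => g x + h x) = Ig g + Ig h.
Proof.
move=> cg dg ch dh.
rewrite /Ig -(EsD _ (sepcM sepc_Wt cg) dg (sepcM sepc_Wt ch) dh).
by congr Es; apply/funext => x; rewrite mulrDr.
Qed.

Lemma IgZ (c : R[i]) g C : sepc g -> dom C g -> Ig (fun x => c * g x) = c * Ig g.
Proof.
move=> cg dg; rewrite /Ig -(EsZ _ c (sepcM sepc_Wt cg) dg).
by congr Es; apply/funext => x; rewrite mulrCA.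
Qed.

Lemma Ig0 : Ig (fun=> 0) = 0.
Proof. by rewrite /Ig; under eq_fun do rewrite mulr0; exact: Es0. Qed.

Lemma domZ (c : R[i]) g C : dom C g -> dom (nc c * C) (fun x => c * g x).
Proof.
by move=> dg x; rewrite mulrCA ncM ler_wpM2l ?nc_ge0//; exact: dg.
Qed.

Lemma domD g h C D : dom C g -> dom D h -> dom (C + D) (fun x => g x + h x).
Proof.
by move=> dg dh x; rewrite mulrDr; apply: le_trans (ncD _ _) (lerD (dg x) (dh x)).
Qed.

Lemma sepc_sum (I : Type) (r : seq I) (P : pred I) (F : I -> 'rV[R]_n -> R[i]) :
  (forall i, sepc (F i)) -> sepc (fun x => \sum_(i <- r | P i) F i x).
Proof.
move=> cF x j.
exact: (@ccont_sum R I r P (fun i (y : R) => F i (upd x j y)) (fun i => cF i x j)).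
Qed.

Lemma sepc_prod (I : Type) (r : seq I) (P : pred I) (F : I -> 'rV[R]_n -> R[i]) :
  (forall i, sepc (F i)) -> sepc (fun x => \prod_(i <- r | P i) F i x).
Proof.
move=> cF x j.
exact: (@ccont_prod R I r P (fun i (y : R) => F i (upd x j y)) (fun i => cF i x j)).
Qed.

Lemma sepc_coord (f : R -> R[i]) k : ccontinuous f -> sepc (fun x => f (x 0 k)).
Proof.
move=> cf x j; have [->|kj] := eqVneq k j.
  by under eq_fun do rewrite upd_same.
by under eq_fun do rewrite updE (negbTE kj); exact: ccont_cst.
Qed.

Lemma dom_sum (I : Type) (r : seq I) (F : I -> 'rV[R]_n -> R[i]) (C : I -> R) :
  (forall i, dom (C i) (F i)) -> dom (\sum_(i <- r) C i) (fun x => \sum_(i <- r) F i x).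
Proof.
move=> dF; elim: r => [|i r IH].
  by move=> x; rewrite !big_nil mulr0 Normc.normc0.
move=> x; rewrite !big_cons mulrDr; apply: le_trans (ncD _ _) _.
by apply: lerD; [exact: dF|exact: IH].
Qed.

Lemma Ig_sum (I : Type) (r : seq I) (F : I -> 'rV[R]_n -> R[i]) (C : I -> R) :
  (forall i, sepc (F i)) -> (forall i, dom (C i) (F i)) ->
  Ig (fun x => \sum_(i <- r) F i x) = \sum_(i <- r) Ig (F i).
Proof.
move=> cF dF; elim: r => [|i r IH].
  by rewrite big_nil (@Ig_ext _ (fun=> 0)) ?Ig0// => x; rewrite big_nil.
rewrite big_cons -IH -(IgD (cF i) (dF i) (sepc_sum r xpredT cF) (dom_sum r dF)).
by congr Ig; apply/funext => x; rewrite big_cons.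
Qed.

Lemma Ig_cvg (g_ : nat -> 'rV[R]_n -> R[i]) g C :
  (forall i, sepc (g_ i)) -> sepc g -> (forall i, dom C (g_ i)) ->
  (forall z, ccvg (g_ ^~ z) (g z)) -> ccvg (fun i => Ig (g_ i)) (Ig g).
Proof.
move=> cgi cg di gg; apply: (@Es_cvg _ _ _ _ _ C) => //.
- by move=> i; exact: sepcM sepc_Wt (cgi i).
- exact: sepcM sepc_Wt cg.
- by move=> z; apply: ccvgM; [exact: ccvg_cst|exact: gg].
Qed.

Lemma Ig_diff (g g' : R -> 'rV[R]_n -> R[i]) (C lo hi : R) :
  (forall t x, lo < t < hi -> cder (g ^~ x) t (g' t x)) ->
  (forall t, lo < t < hi -> dom C (g' t)) ->
  (forall t, lo < t < hi -> sepc (g t)) -> (forall t, lo < t < hi -> sepc (g' t)) ->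
  (forall t, lo < t < hi -> exists D, dom D (g t)) ->
  forall t, lo < t < hi -> cder (fun r => Ig (g r)) t (Ig (g' t)).
Proof.
move=> dg bg' cg cg' bg t tI.
apply: (@Es_diff _ _ _ (fun r x => (Wt x)%:C * g r x) (fun r x => (Wt x)%:C * g' r x) C lo hi) => //.
- by move=> r x rI; apply: cderZ; exact: dg.
- by move=> r rI; exact: sepcM sepc_Wt (cg r rI).
- by move=> r rI; exact: sepcM sepc_Wt (cg' r rI).
Qed.

Lemma Wt_split j x : Wt x = wj j x * Wsub (rem j (enum 'I_n)) x.
Proof.
rewrite /Wt /Wsub (perm_big _ (perm_to_rem (mem_enum _ j)))/=.
by rewrite big_cons.
Qed.

Lemma Ig_IBP j g g' C : (forall x, pder j g x (g' x)) -> sepc g -> sepc g' ->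
  dom C g -> dom C g' -> Ig g' = 0.
Proof.
move=> dg cg cg' bg bg'.
(* The weight of the other coordinates is constant along coordinate [j], so it can be absorbed into
   [g] before the one-coordinate result is used. *)
pose V := @Wsub R n (rem j (enum 'I_n)).
have jr : j \notin rem j (enum 'I_n) by rewrite mem_rem_uniqF ?enum_uniq.
have cV : sepc (fun x => (V x)%:C) by exact: sepc_Wsub.
rewrite /Ig (_ : (fun x => _) = fun x => (wj j x)%:C * ((V x)%:C * g' x)); last first.
  by apply/funext => x; rewrite (Wt_split j) rmorphM mulrA.
apply: (@Es_IBP _ _ _ j (fun x => (V x)%:C * g x) _ C); rewrite ?mem_enum ?enum_uniq//.
- move=> x; rewrite /pder.
  rewrite (_ : (fun y : R => _) = fun y : R => (V x)%:C * g (upd x j y)); first exact: cderZ (dg x).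
  by apply/funext => y; rewrite /V Wsub_upd.
- exact: sepcM.
- exact: sepcM.
- by move=> x; rewrite mulrA -rmorphM -Wt_split; exact: bg.
- by move=> x; rewrite mulrA -rmorphM -Wt_split; exact: bg'.
Qed.

Lemma affs_enum x0 r z : affs (enum 'I_n) x0 r z = x0 + r *: z.
Proof. by apply/rowP => k; rewrite !mxE mem_enum. Qed.

Lemma Ig_affine g C x0 r : 0 < r -> sepc g -> dom C g ->
  Ig g = (r ^+ n)%:C * Ig (fun z => g (x0 + r *: z)).
Proof.
move=> r0 cg dg; rewrite /Ig {1}/Wt (@Es_affine _ _ _ g C x0 r _ (enum_uniq _) r0 cg dg).
rewrite size_enum_ord; congr (_ * Es _ _ _).
by apply/funext => z; rewrite affs_enum.
Qed.

Lemma dom_affine g C x0 r : 0 < r -> dom C g ->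
  exists D, dom D (fun z => g (x0 + r *: z)).
Proof.
move=> r0 dg; exists ((\prod_(k <- enum 'I_n) affK x0 r k) * C).
have := @bdd_affs _ _ (enum 'I_n) (enum 'I_n) x0 r g C r0 dg.
by move=> h x; have := h x; rewrite affs_enum.
Qed.

Lemma line_cvg x0 z (u : nat -> R) (p : R) : u i @[i --> \oo] --> p ->
  x0 + u i *: z @[i --> \oo] --> x0 + p *: z.
Proof. by move=> up; apply: cvgD; [exact: cvg_cst|exact: cvgZr_tmp]. Qed.

Lemma ccont_seqV g (v : nat -> 'rV[R]_n) x : ccontinuous g ->
  v i @[i --> \oo] --> x -> ccvg (fun i => g (v i)) (g x).
Proof.
move=> [g1 g2] vx; apply/ccvgP; split.
  exact: (cvg_comp v (fun x => cRe (g x)) vx (g1 x)).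
exact: (cvg_comp v (fun x => cIm (g x)) vx (g2 x)).
Qed.

Definition gaus0 z : R := expR (- sqr_enorm z).

Lemma gaus0_prod z : gaus0 z = \prod_(k <- enum 'I_n) expR (- (z 0 k) ^+ 2).
Proof.
rewrite /gaus0 /sqr_enorm -sumrN big_enum /=.
by elim/big_rec2: _ => [|i y1 y2 _ <-]; rewrite ?expR0// expRD.
Qed.

Lemma dom_gaus0 : dom 1 (fun z => (gaus0 z)%:C).
Proof.
apply/domE => z; rewrite nc_real ger0_norm ?expR_ge0// gaus0_prod /Wt /Wsub -big_split /=.
elim: (enum 'I_n) => [|k s IH]; rewrite ?big_nil// big_cons.
have h0 (i : 'I_n) : 0 <= wj i z * expR (- z 0 i ^+ 2).
  by rewrite mulr_ge0 ?expR_ge0//; exact: ltW (wj_gt0 _ _).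
have h1 : wj k z * expR (- z 0 k ^+ 2) <= 1.
  by rewrite expRN ler_pdivrMr ?expR_gt0// mul1r; exact: expR_ge1Dx.
apply: mulr_ile1 => //.
by apply: prodr_ge0 => i _; exact: h0.
Qed.

Lemma cont_gauss1 : continuous (fun y : R => expR (- y ^+ 2)).
Proof.
move=> y; apply: (@continuous_comp _ _ _ (fun y : R => - y ^+ 2) expR).
  by apply: cvgN; exact: exprn_continuous.
exact: continuous_expR.
Qed.

Lemma sepc_gaus0 : sepc (fun z => (gaus0 z)%:C).
Proof.
have sk k : sepc (fun z => (expR (- z 0 k ^+ 2))%:C).
  have h := @sepc_coord (fun y : R => (expR (- y ^+ 2))%:C) k (ccont_real cont_gauss1).
  exact h.
have := sepc_prod (enum 'I_n) xpredT sk.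
by under eq_fun do rewrite -rmorph_prod -gaus0_prod.
Qed.

Definition gmass : R[i] := Ig (fun z => (gaus0 z)%:C).

(** By [Es_prod] this is the n-th power of a one-dimensional integral, whose real part is the Gauss
    integral sqrt(pi). *)
Lemma gmass_neq0 : gmass != 0.
Proof.
pose h (y : R) : R[i] := (oneDsqr y * expR (- y ^+ 2))%:C.
have ch : ccontinuous h.
  apply: ccont_real => y; apply: cvgM; [exact: continuous_oneDsqr|exact: cont_gauss1].
have bh y : nc (h y) <= 1.
  rewrite nc_real ger0_norm ?mulr_ge0 ?expR_ge0 ?(ltW (w_gt0 _))//.
  by rewrite expRN ler_pdivrMr ?expR_gt0// mul1r; exact: expR_ge1Dx.
have -> : gmass = wint h ^+ n.
  have := @Es_prod _ n (enum 'I_n) h 1 0 (enum_uniq _) ch bh.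
  rewrite size_enum_ord => <-.
  congr Es; apply/funext => z.
  by rewrite gaus0_prod /Wt /Wsub /h -rmorphM -big_split rmorph_prod.
rewrite expf_neq0//; apply/eqP => /(congr1 (@complex.Re R)).
rewrite /= /wR (_ : Rintegral _ _ _ = Num.sqrt pi).
  by apply/eqP; rewrite sqrtr_eq0 -ltNge pi_gt0.
rewrite /Rintegral; transitivity (fine (\int[@lebesgue_measure R]_(y in setT) (gauss_fun y)%:E)%E).
  congr fine; apply: eq_integral => y _; congr EFin.
  rewrite mulrAC divff ?mul1r//; apply: lt0r_neq0; exact: w_gt0.
rewrite ge0_symfun_integralT.
- have -> : [set x : R | 0 <= x] = `[0, +oo[ by apply/seteqP; split => w /=; rewrite in_itv/= andbT.
  by rewrite integral0y_gauss -EFinM /=; field.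
- exact: gauss_fun_ge0.
- exact: continuous_gauss_fun.
- by move=> y /=; rewrite /gauss_fun sqrrN.
Qed.

Definition gaus x0 r z : R := gaus0 (r^-1 *: (z - x0)).

Lemma gausE x0 r z : r != 0 -> gaus x0 r (x0 + r *: z) = gaus0 z.
Proof. by move=> r0; rewrite /gaus addrAC subrr add0r scalerA mulVf// scale1r. Qed.

Lemma gaus_affine x0 r z : gaus x0 r z = gaus0 (- (r^-1 *: x0) + r^-1 *: z).
Proof. by rewrite /gaus scalerBr addrC. Qed.

Lemma sepc_gaus x0 r : sepc (fun z => (gaus x0 r z)%:C).
Proof.
have := @sepc_affs _ _ (enum 'I_n) (- (r^-1 *: x0)) r^-1 _ sepc_gaus0.
by under eq_fun do rewrite affs_enum -gaus_affine.
Qed.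

Lemma dom_gaus x0 r : 0 < r -> exists C, dom C (fun z => (gaus x0 r z)%:C).
Proof.
move=> r0; have rV : 0 < r^-1 by rewrite invr_gt0.
have [C h] := dom_affine (- (r^-1 *: x0)) rV dom_gaus0.
by exists C => z; rewrite gaus_affine; exact: h.
Qed.

Lemma dom_bddM g h C D : dom C g -> bdd D h -> dom (C * D) (fun x => g x * h x).
Proof.
move=> dg bh x; rewrite mulrA ncM; apply: ler_pM => //; exact: nc_ge0.
Qed.

(** The substitution x0 + r z turns the normalized Gaussian of width r into [gaus0], which dominates
    the integrands. Pointwise convergence then involves [g] only along lines through [x0]. *)
Lemma approx_id g C x0 (r : nat -> R) : sepc g ->
  (forall z, ccontinuous (fun p : R => g (x0 + p *: z))) -> bdd C g ->
  (forall i, 0 < r i) -> r i @[i --> \oo] --> (0 : R) ->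
  ccvg (fun i => ((r i)^-1 ^+ n)%:C * Ig (fun z => (gaus x0 (r i) z)%:C * g z)) (gmass * g x0).
Proof.
move=> sg cg bg r0 rc.
pose G i z := (gaus0 z)%:C * g (x0 + r i *: z).
have e i : ((r i)^-1 ^+ n)%:C * Ig (fun z => (gaus x0 (r i) z)%:C * g z) = Ig (G i).
  have [D dD] := dom_gaus x0 (r0 i).
  rewrite (Ig_affine x0 (r0 i) (sepcM (sepc_gaus x0 (r i)) sg) (dom_bddM dD bg)).
  rewrite mulrA -rmorphM -exprMn mulVf ?expr1n ?mul1r ?gt_eqF//.
  by apply: Ig_ext => z; rewrite gausE// gt_eqF.
have -> : (fun i => ((r i)^-1 ^+ n)%:C * Ig (fun z => (gaus x0 (r i) z)%:C * g z)) = fun i => Ig (G i).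
  exact/funext.
have sG p : sepc (fun z => g (x0 + p *: z)).
  have := @sepc_affs _ _ (enum 'I_n) x0 p _ sg.
  by under eq_fun do rewrite affs_enum.
have -> : gmass * g x0 = Ig (fun z => (gaus0 z)%:C * g x0).
  rewrite mulrC /gmass -(IgZ _ sepc_gaus0 dom_gaus0).
  by apply: Ig_ext => z; rewrite mulrC.
apply: (@Ig_cvg _ _ (1 * C)).
- by move=> i; exact: sepcM sepc_gaus0 (sG (r i)).
- exact: sepcM sepc_gaus0 (sepc_cst _).
- by move=> i; apply: dom_bddM dom_gaus0 _ => z; exact: bg.
- move=> z; apply: ccvgM; first exact: ccvg_cst.
  by have := ccont_seq (cg z) rc; rewrite scale0r addr0.
Qed.

Lemma ccont_line g x0 z : ccontinuous g -> ccontinuous (fun p : R => g (x0 + p *: z)).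
Proof.
move=> cg; apply: seq_ccont => u p up; exact: ccont_seqV cg (@line_cvg x0 z u p up).
Qed.

End FullIntegral.

(** * Mean value estimates, primitives and Fresnel integrals *)

Section Calculus.
Context {R : realType}.
Local Open Scope classical_set_scope.
Local Notation mu := (@lebesgue_measure R).

Lemma derive_compare (f f' g g' : R -> R) (a b : R) : a <= b ->
  (forall t, a <= t <= b -> is_derive t (1 : R) f (f' t)) ->
  (forall t, a <= t <= b -> is_derive t (1 : R) g (g' t)) ->
  (forall t, a <= t <= b -> `|f' t| <= g' t) -> `|f b - f a| <= g b - g a.
Proof.
move=> ab df dg fg.
have key (h h' : R -> R) : (forall t, a <= t <= b -> is_derive t (1 : R) h (h' t)) ->
    (forall t, a <= t <= b -> 0 <= h' t) -> h a <= h b.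
  move=> dh h0.
  have [|||c + e] := @MVT_segment R h h' a b => //.
  - by move=> t; rewrite in_itv/= => /andP[at_ tb]; apply: dh; rewrite !ltW.
  - apply: continuous_in_subspaceT => t; rewrite inE/= in_itv/= => tab.
    exact: is_derive_cont (dh t tab).
  rewrite in_itv/= => cab; rewrite -subr_ge0 e mulr_ge0 ?subr_ge0// h0//.
have h1 := key _ _ (fun t tab => is_derive_sub (dg t tab) (df t tab)).
have h2 := key _ _ (fun t tab => is_derive_add (dg t tab) (df t tab)).
have {}h1 : g a - f a <= g b - f b.
  by apply: h1 => t /fg; rewrite ler_norml subr_ge0 => /andP[].
have {}h2 : g a + f a <= g b + f b.
  by apply: h2 => t /fg; rewrite ler_norml => /andP[+ _]; rewrite -subr_ge0 opprK addrC.
by rewrite ler_norml; apply/andP; split; lra.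
Qed.

(** Projection on the direction of z = f b - f a makes the problem real without losing a constant:
    Re(conj(z) f) increases by |z|^2, and its derivative is at most |z| g' in absolute value. *)
Lemma cder_compare (f f' : R -> R[i]) (g g' : R -> R) (a b : R) : a <= b ->
  (forall t, a <= t <= b -> cder f t (f' t)) ->
  (forall t, a <= t <= b -> is_derive t (1 : R) g (g' t)) ->
  (forall t, a <= t <= b -> nc (f' t) <= g' t) -> nc (f b - f a) <= g b - g a.
Proof.
move=> ab df dg fg; set z := f b - f a.
have sqE (w : R[i]) : nc w ^+ 2 = cRe w ^+ 2 + cIm w ^+ 2.
  by case: w => c d; rewrite /Normc.normc sqr_sqrtr// addr_ge0// sqr_ge0.
have [z0|z0] := eqVneq z 0.
  rewrite z0 Normc.normc0 subr_ge0.
  have h t : a <= t <= b -> `|(fun=> 0 : R) t| <= g' t.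
    by move=> tI; rewrite /= normr0; apply: le_trans (fg t tI); exact: nc_ge0.
  have := @derive_compare (fun=> 0) (fun=> 0) g g' a b ab (fun r _ => is_derive_cst (0 : R) r (1 : R)) dg h.
  by rewrite subrr normr0 subr_ge0.
have r0 : 0 < nc z by rewrite nc_gt0.
have := @derive_compare (fun t => cRe z * cRe (f t) + cIm z * cIm (f t))
  (fun t => cRe z * cRe (f' t) + cIm z * cIm (f' t)) (fun t => nc z * g t) (fun t => nc z * g' t) a b ab.
have dZ (c : R) (h : R -> R) t l : is_derive t (1 : R) h l -> is_derive t (1 : R) (fun s => c * h s) (c * l).
  by move=> hl; apply: is_derive_val (is_derive_mul (is_derive_cst c t (1 : R)) hl) _; rewrite mul0r addr0.
move=> h.
have {}h : `|nc z ^+ 2| <= nc z * (g b - g a).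
  have -> : nc z ^+ 2 = cRe z * cRe (f b) + cIm z * cIm (f b) - (cRe z * cRe (f a) + cIm z * cIm (f a)).
    rewrite sqE /z ReD ImD ReN ImN; ring.
  rewrite mulrBr; apply: h => t tI.
  - by have [h1 h2] := df t tI; apply: is_derive_add; apply: dZ.
  - by apply: dZ; exact: dg.
  apply: le_trans (_ : _ <= nc z * nc (f' t)) _; last by rewrite ler_wpM2l ?nc_ge0// fg.
  rewrite -(@ler_pXn2r _ 2)// ?nnegrE ?mulr_ge0 ?nc_ge0// exprMn !sqE real_normK ?num_real//.
  rewrite -subr_ge0 (_ : _ - _ = (cRe z * cIm (f' t) - cIm z * cRe (f' t)) ^+ 2) ?sqr_ge0//; ring.
move: h; rewrite ger0_norm ?sqr_ge0// expr2 ler_pM2l//.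
Qed.

Lemma cder_const (f : R -> R[i]) (a b : R) :
  (forall t, a < t < b -> cder f t 0) ->
  forall s t, a < s < b -> a < t < b -> f s = f t.
Proof.
move=> df.
have key s t : a < s < b -> a < t < b -> s <= t -> f s = f t.
  move=> /andP[a1 b1] /andP[a2 b2] st.
  have := @cder_compare f (fun=> 0) (fun=> 0) (fun=> 0) s t st.
  have sub r : s <= r <= t -> a < r < b.
    by move=> /andP[sr rt]; rewrite (lt_le_trans a1 sr) (le_lt_trans rt b2).
  move=> /(_ (fun r h => df r (sub r h)) (fun r h => is_derive_cst _ _ _)) h.
  have {}h : nc (f t - f s) <= 0.
    by rewrite -[leRHS](subrr (0 : R)); apply: h => r _; rewrite Normc.normc0.
  apply/esym/eqP; rewrite -subr_eq0 -nc_eq0 eq_le h; exact: nc_ge0.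
move=> s t sI tI; have [st|/ltW ts] := leP s t; first exact: key.
exact/esym/key.
Qed.

Lemma cder_unique (f : R -> R[i]) t l m : cder f t l -> cder f t m -> l = m.
Proof.
move=> [h1 h2] [h3 h4]; apply: eq_ReIm.
  by rewrite -(@derive_val _ _ _ _ _ _ _ h1) -(@derive_val _ _ _ _ _ _ _ h3).
by rewrite -(@derive_val _ _ _ _ _ _ _ h2) -(@derive_val _ _ _ _ _ _ _ h4).
Qed.

(** [F] is glued from integrals to the right and to the left of 0; near a given point it equals
    [FN N], an integral from -N minus a constant, to which the fundamental theorem applies. *)
Lemma primitive (g : R -> R) : continuous g ->
  exists F : R -> R, forall t, is_derive t (1 : R) F (g t).
Proof.
move=> cg.
have ig (a b : R) : mu.-integrable `[a, b] (EFin \o g).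
  apply: continuous_compact_integrable; first exact: segment_compact.
  exact: continuous_subspaceT.
pose F (t : R) : R := if 0 <= t then (\int[mu]_(x in [set` `]0, t]]) g x)%R
                else - (\int[mu]_(x in [set` `]t, 0]]) g x)%R.
pose FN (N t : R) : R := (\int[mu]_(x in [set` `[- N, t]]) g x)%R - (\int[mu]_(x in [set` `[- N, 0]]) g x)%R.
have FE N t : - N < t < N -> FN N t = F t.
  move=> /andP[nt tN]; have N0 : - N <= 0 by lra.
  rewrite /FN /F; case: ifPn => [t0|/negbTE t0].
    by rewrite Rintegral_itvB// bnd_simp.
  have {}t0 : t < 0 by rewrite ltNge t0.
  by rewrite -opprB Rintegral_itvB// bnd_simp ltW.
exists F => t.
pose N := `|t| + 1.
have tN : - N < t < N by rewrite -ltr_norml ltrDl ltr01.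
apply: (@near_eq_is_derive _ _ _ (FN N)).
  have : \forall s \near t, - N < s < N.
    have := near_in_itvoo (_ : t \in `]- N, N[%R).
    rewrite in_itv/= => /(_ tN); apply: filterS => s.
    by rewrite in_itv.
  by apply: filterS => s; exact: FE.
have [tN1 tN2] := andP tN.
have [d1 d2] := @continuous_FTC1_closed R g (- N) t N tN2 (ig _ _) tN1 (cg t).
have d : is_derive t (1 : R) (fun t => \int[mu]_(x in [set` `[- N, t]]) g x)%R (g t).
  by apply: DeriveDef; rewrite -?derive1E.
apply: is_derive_val (is_derive_sub d (is_derive_cst _ t 1)) _.
by rewrite subr0.
Qed.

Lemma cprimitive (g : R -> R[i]) : ccontinuous g ->
  exists F : R -> R[i], forall t, cder F t (g t).
Proof.
move=> [c1 c2]; have [F1 h1] := primitive c1; have [F2 h2] := primitive c2.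
by exists (fun t => F1 t +i* F2 t) => t; split; [exact: h1|exact: h2].
Qed.

Lemma is_derive_sqr (t c : R) : is_derive t (1 : R) (fun v => c * v ^+ 2) (2 * c * t).
Proof.
have h := is_derive_mul (is_derive_cst c t (1 : R)) (is_derive_mul (is_derive_id t (1 : R)) (is_derive_id t (1 : R))).
by apply: is_derive_val h _; rewrite /cst; ring.
Qed.

Lemma is_derive_inv (t : R) : t != 0 -> is_derive t (1 : R) (fun v => v^-1) (- t ^- 2).
Proof.
move=> t0; have h := is_deriveV t0 (is_derive_id t (1 : R)).
by apply: is_derive_val h _; rewrite /GRing.scale /= mulr1.
Qed.

Lemma nc_chirp (x : R) : nc (cexp ('i%C * x%:C)) = 1.
Proof. by rewrite nc_cexp ReM /= mul0r mul1r subrr expR0. Qed.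

(** Up to the critical length [v0] = |c|^(-1/2) the trivial bound by the length is used. Beyond it
    one integration by parts, with boundary term chirp / (2 i c t), leaves a remainder with
    derivative of modulus 1 / (2 |c| t^2). Each of the three contributions is at most [v0]. *)
Lemma fresnel_half (c : R) (E : R -> R[i]) v : c != 0 -> 0 <= v ->
  (forall y, cder E y (cexp ('i%C * (c * y ^+ 2)%:C))) ->
  nc (E v - E 0) <= 4 * (Num.sqrt `|c|)^-1.
Proof.
move=> c0 v_ge0 dE; set v0 := (Num.sqrt `|c|)^-1.
have sc : 0 < Num.sqrt `|c| by rewrite sqrtr_gt0 normr_gt0.
have v0_gt0 : 0 < v0 by rewrite invr_gt0.
have v0c : `|c| * v0 ^+ 2 = 1.
  by rewrite /v0 exprVn sqr_sqrtr// divff// normr_eq0.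
have lip a b : a <= b -> nc (E b - E a) <= b - a.
  move=> ab; apply: (@cder_compare E _ (fun t => t) (fun=> 1) _ _ ab (fun t _ => dE t)).
  by move=> t _; rewrite nc_chirp.
have [vv0|v0v] := leP v v0.
  by apply: le_trans (lip 0 v v_ge0) _; rewrite subr0; lra.
have h1 := lip 0 v0 (ltW v0_gt0).
pose w (t : R) := (2 * c)^-1 * t^-1.
pose K t := E t - (- 'i%C * (w t)%:C) * cexp ('i%C * (c * t ^+ 2)%:C).
have dK t : v0 <= t <= v ->
    cder K t (- 'i%C * (2 * c * t ^+ 2)^-1%:C * cexp ('i%C * (c * t ^+ 2)%:C)).
  move=> /andP[v0t _]; have t0 : t != 0 by rewrite gt_eqF// (lt_le_trans v0_gt0).
  have dw := is_derive_mul (is_derive_cst ((2 * c)^-1) t (1 : R)) (is_derive_inv t0).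
  have dc := cder_cexp (cderZ 'i%C (cder_real (is_derive_sqr t c))).
  have := cderB (dE t) (cderM (cderZ (- 'i%C) (cder_real dw)) dc).
  move/cder_val; apply; rewrite /w.
  set X := cexp _; rewrite mul0r addr0 !(rmorphM, rmorphN, fmorphV, rmorphXn) /=.
  have c0' : c%:C != 0 :> R[i] by rewrite fmorph_eq0.
  have t0' : t%:C != 0 :> R[i] by rewrite fmorph_eq0.
  rewrite rmorph_nat.
  transitivity (X + 'i%C ^+ 2 * X - 'i%C * (2 * c%:C * t%:C ^+ 2)^-1 * X).
    by field; rewrite c0' t0'.
  by rewrite sqr_i; ring.
have d_w t : v0 <= t <= v -> is_derive t (1 : R) (fun t => - `|2 * c|^-1 * t^-1) (`|2 * c|^-1 * t ^- 2).
  move=> /andP[v0t _]; have t0 : t != 0 by rewrite gt_eqF// (lt_le_trans v0_gt0).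
  have := is_derive_mul (is_derive_cst (- `|2 * c|^-1) t (1 : R)) (is_derive_inv t0).
  by move/is_derive_val; apply; rewrite mul0r addr0 mulrNN.
have bK t : v0 <= t <= v -> nc (- 'i%C * (2 * c * t ^+ 2)^-1%:C * cexp ('i%C * (c * t ^+ 2)%:C)) <= `|2 * c|^-1 * t ^- 2.
  move=> _; rewrite ncM nc_chirp mulr1 ncM ncN nc_i mul1r nc_real.
  by rewrite normfV normrM invfM (ger0_norm (sqr_ge0 t)).
have h2 := cder_compare (ltW v0v) dK d_w bK.
have c2 : `|2 * c|^-1 = 2^-1 * v0 ^+ 2.
  rewrite normrM (ger0_norm (ler0n _ 2)) invfM; congr (_ * _).
  by apply: (mulfI (_ : `|c| != 0)); rewrite ?normr_eq0// v0c divff// normr_eq0.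
have wb t : v0 <= t -> nc ((- 'i%C * (w t)%:C) * cexp ('i%C * (c * t ^+ 2)%:C)) <= 2^-1 * v0.
  move=> v0t; rewrite ncM nc_chirp mulr1 ncM ncN nc_i mul1r nc_real /w.
  rewrite normrM normfV c2 -mulrA ler_wpM2l// expr2 -mulrA ger0_norm.
    have t0 : 0 < t by exact: lt_le_trans v0t.
    by rewrite -[leRHS]mulr1 ler_wpM2l ?(ltW v0_gt0)// ler_pdivrMr// mul1r.
  by rewrite invr_ge0; apply: le_trans v0t; exact: ltW.
have h3 : nc (K v - K v0) <= v0.
  apply: le_trans h2 _; rewrite c2.
  have -> : - (2^-1 * v0 ^+ 2) * v^-1 - - (2^-1 * v0 ^+ 2) * v0^-1 = 2^-1 * (v0 - v0 ^+ 2 * v^-1).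
    by field; rewrite !gt_eqF// (lt_trans v0_gt0).
  have : 0 <= v0 ^+ 2 * v^-1 by rewrite mulr_ge0 ?sqr_ge0// invr_ge0.
  lra.
have w1 := wb v (ltW v0v); have w2 := wb v0 (lexx _).
have -> : E v - E 0 = (E v0 - E 0) + ((K v - K v0) +
  ((- 'i%C * (w v)%:C) * cexp ('i%C * (c * v ^+ 2)%:C) - (- 'i%C * (w v0)%:C) * cexp ('i%C * (c * v0 ^+ 2)%:C))).
  by rewrite /K; ring.
apply: le_trans (ncD _ _) _; apply: le_trans (lerD h1 (ncD _ _)) _.
have := lerD h3 (le_trans (ncB _ _) (lerD w1 w2)); lra.
Qed.

(** The primitive that vanishes at [y0]; the side y < y0 follows by reflection, since the chirp is
    even about [y0]. *)
Lemma fresnel (c y0 : R) : c != 0 -> exists E : R -> R[i],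
  (forall y, cder E y (cexp ('i%C * (c * (y - y0) ^+ 2)%:C))) /\
  (forall y, nc (E y) <= 4 * (Num.sqrt `|c|)^-1).
Proof.
move=> c0; pose G v : R[i] := cexp ('i%C * (c * v ^+ 2)%:C).
have dG v := cder_cexp (cderZ 'i%C (cder_real (is_derive_sqr v c))).
have [F dF] := cprimitive (cder_continuous dG).
have dF' v : cder (fun v => - F (- v)) v (G v).
  have := cderN (cder_comp (dF (- v)) (is_derive_opp (is_derive_id v (1 : R)))).
  by move/cder_val; apply; rewrite rmorphN rmorph1 mulN1r opprK sqrrN.
exists (fun y => F (y - y0) - F 0); split => y.
  have := cderB (@cder_comp _ F (fun y => y - y0) y _ _ (dF (y - y0)) (is_derive_sub (is_derive_id y (1 : R)) (is_derive_cst y0 y (1 : R)))) (cder_cst (F 0) y).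
  by move/cder_val; apply; rewrite !subr0 rmorph1 mul1r.
have [y1|/ltW y1] := leP 0 (y - y0); first exact: fresnel_half.
have := fresnel_half c0 (_ : 0 <= - (y - y0)) dF'.
by rewrite opprK oppr0 oppr_ge0 => /(_ y1); rewrite -opprD ncN.
Qed.

End Calculus.

(** * Pairing with Gaussian solutions *)

Section GaussianPairing.
Context {R : realType} {n : nat}.
Local Open Scope classical_set_scope.
Variables (lam : R) (q : 'I_n -> R).
Hypothesis lam0 : 0 < lam.
Implicit Types (x : 'rV[R]_n) (f g h : 'rV[R]_n -> R[i]) (j k : 'I_n).
Implicit Types (a b c : 'I_n -> R[i]).

Definition expo a b c x : R[i] :=
  \sum_k (- a k * (x 0 k)%:C ^+ 2 + b k * (x 0 k)%:C + c k).
Definition gph a b c x : R[i] := cexp (expo a b c x).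
(** The logarithmic derivative of [gph a b c] in coordinate [j]. *)
Definition theta a b j x : R[i] := - (2 * a j * (x 0 j)%:C) + b j.

Lemma lamC0 : lam%:C != 0 :> R[i].
Proof. by rewrite fmorph_eq0 gt_eqF. Qed.

Lemma ccont_coordC (x : 'rV[R]_n) j k : ccontinuous (fun y : R => (upd x j y 0 k)%:C).
Proof.
have ci : ccontinuous (fun y : R => y%:C) by apply: ccont_real => y; exact: cvg_id.
exact: (@sepc_coord R n (fun y : R => y%:C) k ci).
Qed.

Lemma sepc_coordC k : sepc (fun x : 'rV[R]_n => (x 0 k)%:C).
Proof. by move=> x j; exact: ccont_coordC. Qed.

Lemma sepc_theta a b j : sepc (theta a b j).
Proof.
rewrite /theta; apply: sepcD; last exact: sepc_cst.
have -> : (fun x => - (2 * a j * (x 0 j)%:C)) = (fun x => - (2 * a j) * (x 0 j)%:C).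
  by apply/funext => x; rewrite mulNr.
by apply: sepcM; [exact: sepc_cst|exact: sepc_coordC].
Qed.

Lemma cder_coordC t : cder (fun y : R => y%:C) t 1.
Proof. exact: (cder_real (is_derive_id t (1 : R))). Qed.

Lemma pder_gph a b c j x : pder j (gph a b c) x (theta a b j x * gph a b c x).
Proof.
rewrite /pder /gph.
pose rest := \sum_(k | k != j) (- a k * (x 0 k)%:C ^+ 2 + b k * (x 0 k)%:C + c k).
have e y : expo a b c (upd x j y) = (- a j * (y%:C * y%:C) + b j * y%:C + c j) + rest.
  rewrite /expo (bigD1 j)//= upd_same expr2; congr (_ + _).
  by apply: eq_bigr => k kj; rewrite updE (negbTE kj).
have -> : (fun y => cexp (expo a b c (upd x j y))) =
  fun y => cexp ((- a j * (y%:C * y%:C) + b j * y%:C + c j) + rest).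
  by apply/funext => y; rewrite e.
have dy := cder_coordC (x 0 j).
have := cder_cexp (cderD (cderD (cderD (cderZ (- a j) (cderM dy dy)) (cderZ (b j) dy)) (cder_cst (c j) (x 0 j))) (cder_cst rest (x 0 j))).
move/cder_val; apply; rewrite -e upd_id; congr (_ * _).
by rewrite /theta; ring.
Qed.

Lemma sepc_gph a b c : sepc (gph a b c).
Proof. by apply: (@pder_sepc _ _ _ (fun j x => theta a b j x * gph a b c x)) => j x; exact: pder_gph. Qed.

Lemma pder_theta a b j x : pder j (theta a b j) x (- (2 * a j)).
Proof.
rewrite /pder /theta.
have -> : (fun y => - (2 * a j * (upd x j y 0 j)%:C) + b j) = fun y : R => - (2 * a j) * y%:C + b j.
  by apply/funext => y; rewrite upd_same mulNr.
have := cderD (cderZ (- (2 * a j)) (cder_coordC (x 0 j))) (cder_cst (b j) (x 0 j)).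
by move/cder_val; apply; rewrite mulr1 addr0.
Qed.

Lemma pderM j f g x l m : pder j f x l -> pder j g x m ->
  pder j (fun x => f x * g x) x (f x * m + l * g x).
Proof.
move=> fl gm; have := cderM fl gm; move/cder_val; apply.
by rewrite !upd_id.
Qed.

(** Half of the decay exp(-c y^2) absorbs the cube of the weight, whence d = c / 6; the other half
    absorbs the linear term by completing the square. One power of the weight serves membership in
    [dom], the other two serve factors of quadratic growth such as [Tht]. *)
Lemma gauss_bound1 (c M : R) : 0 < c -> exists2 K : R, 0 < K & forall y A B G : R,
  c <= A -> `|B| <= M -> G <= M ->
  oneDsqr y ^+ 3 * expR (- A * y ^+ 2 + B * y + G) <= K.
Proof.
move=> c0; pose d := c / 6; have d0 : 0 < d by rewrite divr_gt0.
pose K := d ^- 3 * expR (c / 2 + M ^+ 2 / (2 * c) + M).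
exists K; first by rewrite mulr_gt0 ?expR_gt0// invr_gt0 exprn_gt0.
move=> y A B G cA BM GM.
have h1 : oneDsqr y ^+ 3 <= d ^- 3 * expR (c / 2 * (1 + y ^+ 2)).
  have -> : c / 2 * (1 + y ^+ 2) = 3%:R * (d * oneDsqr y) by rewrite /d /oneDsqr; field.
  rewrite expRM_natl -exprVn -exprMn; apply: lerXn2r; rewrite ?nnegrE.
  - exact: ltW (w_gt0 _).
  - by rewrite mulr_ge0 ?expR_ge0// invr_ge0 ltW.
  rewrite mulrC ler_pdivlMr// mulrC.
  by apply: le_trans (expR_ge1Dx _); rewrite lerDr.
have h2 : - A * y ^+ 2 + B * y + G <= - (c / 2) * y ^+ 2 + (M ^+ 2 / (2 * c) + M).
  have hB : B * y <= M * `|y|.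
    by apply: le_trans (ler_norm _) _; rewrite normrM ler_wpM2r.
  have hA : c * y ^+ 2 <= A * y ^+ 2 by rewrite ler_wpM2r// sqr_ge0.
  have hs : 0 <= (c * `|y| - M) ^+ 2 / (2 * c) by rewrite divr_ge0 ?sqr_ge0// mulr_ge0// ltW.
  have e : (c * `|y| - M) ^+ 2 / (2 * c) = c / 2 * y ^+ 2 - M * `|y| + M ^+ 2 / (2 * c).
    rewrite -(real_normK (num_real y)); field; exact: lt0r_neq0.
  rewrite e in hs; lra.
have h0 : 0 <= oneDsqr y ^+ 3 by rewrite exprn_ge0// ltW// w_gt0.
rewrite -ler_expR in h2.
apply: le_trans (ler_pM h0 (expR_ge0 _) h1 h2) _.
rewrite -[leLHS]mulrA -expRD /K ler_wpM2l ?invr_ge0 ?exprn_ge0 ?(ltW d0)// ler_expR; lra.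
Qed.

Definition gbd (c M : R) (a b g : 'I_n -> R[i]) :=
  forall k, [/\ c <= cRe (a k), nc (b k) <= M, nc (a k) <= M & nc (g k) <= M].

Lemma gph_bound (c M : R) : 0 < c -> exists2 K : R, 0 <= K & forall a b (g : 'I_n -> R[i]), gbd c M a b g ->
  forall x, Wt x ^+ 3 * nc (gph a b g x) <= K.
Proof.
move=> c0; have [K K0 hK] := gauss_bound1 M c0.
exists (K ^+ n); first by rewrite exprn_ge0// ltW.
move=> a b g hb x; rewrite /gph nc_cexp Re_sum.
have -> : expR (\sum_k cRe (- a k * (x 0 k)%:C ^+ 2 + b k * (x 0 k)%:C + g k)) =
   \prod_(k <- enum 'I_n) expR (- cRe (a k) * x 0 k ^+ 2 + cRe (b k) * x 0 k + cRe (g k)).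
  rewrite big_enum /=; elim/big_rec2: _ => [|i y1 y2 _ <-]; rewrite ?expR0// expRD.
  by congr (expR _ * _); rewrite !ReD -rmorphXn !ReM !ReN !ImN /=; ring.
rewrite /Wt /Wsub -prodrXl -big_split /= -[X in K ^+ X](size_enum_ord n).
elim: (enum 'I_n) => [|k s IH]; first by rewrite big_nil.
rewrite big_cons [leRHS]exprS; apply: ler_pM => //.
- by rewrite mulr_ge0 ?expR_ge0// exprn_ge0// ltW// wj_gt0.
- by apply: prodr_ge0 => i _; rewrite mulr_ge0 ?expR_ge0// exprn_ge0// ltW// wj_gt0.
have [h1 h2 _ h3] := hb k; apply: hK => //.
- by apply: le_trans (nc_Re _) h2.
- by apply: le_trans (ler_norm _) (le_trans (nc_Re _) h3).
Qed.

Lemma wj_le j x : wj j x <= Wt x.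
Proof. by rewrite (Wt_split j) ler_peMr ?Wsub_ge1// ltW// wj_gt0. Qed.

Lemma coord_sqr_le j x : x 0 j ^+ 2 <= Wt x.
Proof. by apply: le_trans (wj_le j x); rewrite /wj /oneDsqr lerDr. Qed.

Lemma coord_le j x : `|x 0 j| <= Wt x.
Proof.
apply: le_trans (wj_le j x); rewrite /wj /oneDsqr -(real_normK (num_real (x 0 j))).
have := sqr_ge0 (`|x 0 j| - 1); rewrite sqrrB1; have := sqr_ge0 `|x 0 j|; have := normr_ge0 (x 0 j); lra.
Qed.

Lemma dom_gph (K D : R) a b (g : 'I_n -> R[i]) h : (forall x, Wt x ^+ 3 * nc (gph a b g x) <= K) ->
  (forall x, nc (h x) <= D * Wt x ^+ 2) -> dom (D * K) (fun x => h x * gph a b g x).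
Proof.
move=> hK hh; apply/domE => x; rewrite ncM.
have W0 := Wt_gt0 x.
have D0 : 0 <= D.
  by have := le_trans (nc_ge0 _) (hh x); rewrite pmulr_lge0// exprn_gt0.
apply: (@le_trans _ _ (Wt x * ((D * Wt x ^+ 2) * nc (gph a b g x)))).
  by rewrite ler_wpM2l ?(ltW W0)// ler_wpM2r// nc_ge0.
have -> : Wt x * ((D * Wt x ^+ 2) * nc (gph a b g x)) = D * (Wt x ^+ 3 * nc (gph a b g x)) by ring.
by rewrite ler_wpM2l.
Qed.

Lemma theta_bound (M : R) a b j x : nc (a j) <= M -> nc (b j) <= M ->
  nc (theta a b j x) <= 3 * M * Wt x.
Proof.
move=> aM bM; rewrite /theta; apply: le_trans (ncD _ _) _.
rewrite ncN !ncM !nc_real (_ : nc 2%:R = 2); last first.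
  by rewrite -(rmorph_nat (real_complex R)) nc_real ger0_norm.
have M0 : 0 <= M by exact: le_trans (nc_ge0 _) aM.
have h1 : nc (a j) * `|x 0 j| <= M * Wt x by apply: ler_pM; rewrite ?nc_ge0// coord_le.
have h2 : nc (b j) <= M * Wt x by apply: le_trans bM _; rewrite ler_peMr// Wt_ge1.
lra.
Qed.

(** Boundedness is all that is asked at infinity, because the Gaussian supplies the decay in every
    pairing. *)
Record nice f (d1 d2 : 'I_n -> 'rV[R]_n -> R[i]) : Prop := Nice {
  nice_d1 : forall j x, pder j f x (d1 j x);
  nice_d2 : forall j x, pder j (d1 j) x (d2 j x);
  nice_c1 : forall j, sepc (d1 j);
  nice_c2 : forall j, sepc (d2 j);
  nice_b : exists2 D : R, 0 <= D & forall x, nc (f x) <= D /\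
    forall j, nc (d1 j x) <= D /\ nc (d2 j x) <= D }.

(* The equation reads u_t = Lop u, where d2 stands for the second derivatives of u. For
   the Gaussian phi = gph one has Lop phi = - Tht * phi, and Lop is symmetric for the
   bilinear pairing, so the pairing is constant when phi_t = Tht * phi. *)
Definition iq : R[i] := 'i%C * (4 * lam)^-1%:C.
Definition Vq x : R[i] := 'i%C * (lam * \sum_j q j * x 0 j ^+ 2)%:C.
Definition Lop f (d2 : 'I_n -> 'rV[R]_n -> R[i]) x : R[i] :=
  iq * \sum_j d2 j x - Vq x * f x.
Definition Tht a b x : R[i] :=
  \sum_j (- iq * (theta a b j x ^+ 2 - 2 * a j) + 'i%C * (lam * (q j * x 0 j ^+ 2))%:C).

Lemma VqE x : Vq x = \sum_j 'i%C * (lam * (q j * x 0 j ^+ 2))%:C.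
Proof. by rewrite /Vq mulr_sumr rmorph_sum mulr_sumr. Qed.

Lemma sepc_Vq : sepc Vq.
Proof.
pose F j x : R[i] := ('i%C * (lam * q j)%:C) * ((x 0 j)%:C * (x 0 j)%:C).
have cF j : sepc (F j).
  exact: (sepcM (sepc_cst _) (sepcM (sepc_coordC j) (sepc_coordC j))).
have -> : Vq = fun x => \sum_j F j x.
  apply/funext => x; rewrite VqE; apply: eq_bigr => j _.
  by rewrite /F expr2 !rmorphM /=; ring.
exact: (sepc_sum (index_enum _) xpredT cF).
Qed.

Lemma sepc_Tht a b : sepc (Tht a b).
Proof.
pose F j x : R[i] := - iq * (theta a b j x * theta a b j x + - (2 * a j))
     + ('i%C * (lam * q j)%:C) * ((x 0 j)%:C * (x 0 j)%:C).
have cF j : sepc (F j).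
  exact: (sepcD (sepcM (sepc_cst _) (sepcD (sepcM (sepc_theta a b j) (sepc_theta a b j)) (sepc_cst _)))
    (sepcM (sepc_cst _) (sepcM (sepc_coordC j) (sepc_coordC j)))).
have -> : Tht a b = fun x => \sum_j F j x.
  apply/funext => x; rewrite /Tht; apply: eq_bigr => j _.
  by rewrite /F !expr2 !rmorphM /=; ring.
exact: (sepc_sum (index_enum _) xpredT cF).
Qed.

Lemma sepc_Lop f d2 : sepc f -> (forall j, sepc (d2 j)) -> sepc (Lop f d2).
Proof.
move=> cf c2.
have -> : Lop f d2 = fun x => iq * \sum_j d2 j x + (-1) * (Vq x * f x).
  by apply/funext => x; rewrite mulN1r.
apply: sepcD; apply: sepcM; try exact: sepc_cst.
  exact: (sepc_sum (index_enum _) xpredT c2).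
by apply: sepcM => //; exact: sepc_Vq.
Qed.

Lemma nice_sepc f d1 d2 : nice f d1 d2 -> sepc f.
Proof. by case=> h _ _ _ _; exact: pder_sepc h. Qed.

Lemma nc2 : nc (2 : R[i]) = 2.
Proof. by rewrite -(rmorph_nat (real_complex R)) nc_real ger0_norm. Qed.

Lemma W1_le x : Wt x <= Wt x ^+ 2.
Proof. by rewrite expr2 ler_peMl ?Wt_ge1// ltW// Wt_gt0. Qed.

Lemma theta2_bound (M : R) a b j x : nc (a j) <= M -> nc (b j) <= M ->
  nc (theta a b j x ^+ 2 - 2 * a j) <= (9 * M ^+ 2 + 2 * M) * Wt x ^+ 2.
Proof.
move=> aM bM; apply: le_trans (ncB _ _) _; rewrite nc_X ncM nc2.
have M0 : 0 <= M by exact: le_trans (nc_ge0 _) aM.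
have h1 : nc (theta a b j x) ^+ 2 <= (3 * M * Wt x) ^+ 2.
  apply: lerXn2r; rewrite ?nnegrE ?nc_ge0//; last exact: theta_bound.
  by rewrite !mulr_ge0// ltW// Wt_gt0.
have h2 : nc (a j) <= M * Wt x ^+ 2.
  apply: le_trans aM _; rewrite ler_peMr//.
  exact: le_trans (Wt_ge1 x) (W1_le x).
by rewrite !exprMn in h1; lra.
Qed.

Lemma Ig_Lop f d1 d2 a b (g : 'I_n -> R[i]) (c M : R) : 0 < c -> gbd c M a b g ->
  nice f d1 d2 ->
  Ig (fun x => Lop f d2 x * gph a b g x) = - Ig (fun x => f x * Tht a b x * gph a b g x).
Proof.
move=> c0 hb nf; have cf := nice_sepc nf.
case: nf => df dd c1 c2 [D D0 bD].
have [K K0 hK] := gph_bound M c0; have {}hK := hK a b g hb.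
have cg := sepc_gph a b g.
have M0 (j : 'I_n) : 0 <= M by have [_ h _ _] := hb j; exact: le_trans (nc_ge0 _) h.
pose N : R := 9 * M ^+ 2 + 2 * M.
(* The flux of Green's formula: its derivative [F'] is f_jj phi - f phi_jj, which integrates to 0,
   and i / (4 lam) times the sum over j is the difference of the two sides. *)
pose F j x := (d1 j x - f x * theta a b j x) * gph a b g x.
pose F' j x := (d2 j x - f x * (theta a b j x ^+ 2 - 2 * a j)) * gph a b g x.
have sm1 (u v : 'rV[R]_n -> R[i]) : sepc u -> sepc v -> sepc (fun x => u x - v x).
  move=> cu cv; have -> : (fun x => u x - v x) = fun x => u x + (-1) * v x.
    by apply/funext => x; rewrite mulN1r.
  by apply: sepcD => //; apply: sepcM => //; exact: sepc_cst.
have ct2 j : sepc (fun x => theta a b j x ^+ 2 - 2 * a j).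
  by apply: sm1; [apply: sepcM; exact: sepc_theta|exact: sepc_cst].
have cF j : sepc (F j).
  apply: sepcM => //; apply: sm1 => //; apply: sepcM => //; exact: sepc_theta.
have cF' j : sepc (F' j).
  by apply: sepcM => //; apply: sm1 => //; apply: sepcM.
have W2 x : 1 <= Wt x ^+ 2 by exact: le_trans (Wt_ge1 x) (W1_le x).
have bF j : dom ((D + D * (3 * M)) * K) (F j).
  apply: dom_gph => // x; have [b0 /(_ j)[b1 b2]] := bD x; have [_ h2 h3 _] := hb j.
  apply: le_trans (ncB _ _) _; rewrite ncM [leRHS]mulrDl; apply: lerD.
    by apply: le_trans b1 _; rewrite ler_peMr.
  rewrite -mulrA; apply: ler_pM; rewrite ?nc_ge0//.
  apply: le_trans (theta_bound x h3 h2) _; rewrite ler_wpM2l ?W1_le//.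
  by rewrite mulr_ge0// (M0 j).
have bF' j : dom ((D + D * N) * K) (F' j).
  apply: dom_gph => // x; have [b0 /(_ j)[b1 b2]] := bD x; have [_ h2 h3 _] := hb j.
  apply: le_trans (ncB _ _) _; rewrite ncM [leRHS]mulrDl; apply: lerD.
    by apply: le_trans b2 _; rewrite ler_peMr.
  rewrite -mulrA; apply: ler_pM; rewrite ?nc_ge0//.
  exact: theta2_bound.
have dF j x : pder j (F j) x (F' j x).
  have dt := pderM (df j x) (pder_theta a b j x).
  have d12 : pder j (fun x => d1 j x - f x * theta a b j x) x
      (d2 j x - (f x * - (2 * a j) + d1 j x * theta a b j x)) := cderB (dd j x) dt.
  have := pderM d12 (pder_gph a b g j x).
  by move/cder_val; apply; rewrite /F'; ring.
have z j : Ig (F' j) = 0.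
  pose C := Num.max ((D + D * (3 * M)) * K) ((D + D * N) * K).
  apply: (@Ig_IBP _ _ j (F j) (F' j) C (dF j) (cF j) (cF' j)).
    by move=> x; apply: le_trans (bF j x) _; rewrite /C le_max lexx.
  by move=> x; apply: le_trans (bF' j x) _; rewrite /C le_max lexx orbT.
have bVq : exists2 E, 0 <= E & forall x, nc (Vq x) <= E * Wt x ^+ 2.
  exists (lam * \sum_j `|q j|).
    by rewrite mulr_ge0 ?(ltW lam0)// sumr_ge0.
  move=> x; rewrite /Vq ncM nc_i mul1r nc_real normrM (gtr0_norm lam0) -mulrA.
  rewrite ler_wpM2l ?(ltW lam0)// mulr_suml; apply: le_trans (ler_norm_sum _ _ _) _.
  apply: ler_sum => j _; rewrite normrM (ger0_norm (sqr_ge0 _)) ler_wpM2l//.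
  exact: le_trans (coord_sqr_le j x) (W1_le x).
have [E E0 hE] := bVq.
have bL : dom ((nc iq * (D *+ n) + E * D) * K) (fun x => Lop f d2 x * gph a b g x).
  apply: dom_gph => // x; have [b0 bj] := bD x.
  rewrite /Lop; apply: le_trans (ncB _ _) _; rewrite [X in X + _]ncM [X in _ + X]ncM [leRHS]mulrDl; apply: lerD.
    rewrite -mulrA ler_wpM2l ?nc_ge0//; apply: le_trans (nc_sum _ _ _) _.
    apply: (@le_trans _ _ (D *+ n)).
      rewrite -[n in leRHS]card_ord -sumr_const; apply: ler_sum => j _.
      by have [_] := bj j.
    by rewrite ler_peMr// mulrn_wge0.
  rewrite [leRHS]mulrAC; apply: ler_pM; rewrite ?nc_ge0//.
have eqs x : f x * Tht a b x * gph a b g x =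
    (-1) * (Lop f d2 x * gph a b g x) + \sum_j iq * F' j x.
  have -> : \sum_j iq * F' j x = (iq * \sum_j d2 j x - iq * f x * \sum_j (theta a b j x ^+ 2 - 2 * a j)) * gph a b g x.
    rewrite mulr_sumr mulr_sumr -sumrB mulr_suml; apply: eq_bigr => j _.
    by rewrite /F'; ring.
  rewrite /Tht big_split /= -VqE -mulr_sumr /Lop; ring.
rewrite (Ig_ext eqs) (@IgD _ _ _ _ _ _ _ (domZ (-1) bL) _ (dom_sum _ (fun j => domZ iq (bF' j)))); last 2 first.
- by apply: sepcM; [exact: sepc_cst|apply: sepcM => //; exact: sepc_Lop].
- by apply: sepc_sum => j; apply: sepcM; [exact: sepc_cst|].
rewrite (IgZ _ _ bL); last by apply: sepcM => //; exact: sepc_Lop.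
rewrite (Ig_sum _ _ (fun j => domZ iq (bF' j))); last first.
  by move=> j; apply: sepcM; [exact: sepc_cst|].
rewrite big1 ?addr0 ?mulN1r ?opprK// => j _.
by rewrite (IgZ _ (cF' j) (bF' j)) z mulr0.
Qed.

End GaussianPairing.

(** * Conservation of the pairing along Gaussian families *)

Section GaussianEvolution.
Context {R : realType} {n : nat}.
Local Open Scope classical_set_scope.
Variables (lam : R) (q : 'I_n -> R).
Hypothesis lam0 : 0 < lam.
Implicit Types (x : 'rV[R]_n) (j k : 'I_n) (s t : R).

(* The Riccati system for the coefficients of phi equivalent to phi_t = Tht * phi. *)
Record Gfam (al be ga : 'I_n -> R -> R[i]) : Prop := GFam {
  gf_al : forall k t, cder (al k) t ('i%C * lam^-1%:C * al k t ^+ 2 - 'i%C * (lam * q k)%:C);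
  gf_be : forall k t, cder (be k) t ('i%C * lam^-1%:C * (al k t * be k t));
  gf_ga : forall k t, cder (ga k) t (- iq lam * (be k t ^+ 2 - 2 * al k t));
  gf_pos : forall k t, 0 < cRe (al k t) }.

Definition at_ (al : 'I_n -> R -> R[i]) t : 'I_n -> R[i] := al ^~ t.

Lemma Gfam_shift al be ga (s : R) : Gfam al be ga ->
  Gfam (fun k t => al k (t + s)) (fun k t => be k (t + s)) (fun k t => ga k (t + s)).
Proof.
move=> [h1 h2 h3 h4].
have ds t : is_derive t (1 : R) (fun t => t + s) 1.
  have := is_derive_add (is_derive_id t (1 : R)) (is_derive_cst s t (1 : R)).
  by move/is_derive_val; apply; rewrite addr0.
have sh (f : R -> R[i]) t l : cder f (t + s) l -> cder (fun t => f (t + s)) t l.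
  move=> fl; have := @cder_comp _ f (fun t => t + s) t _ _ fl (ds t).
  by move/cder_val; apply; rewrite rmorph1 mul1r.
split=> k t; [exact: sh (h1 k _)|exact: sh (h2 k _)|exact: sh (h3 k _)|exact: h4].
Qed.

Lemma cder_ext_bounded (f : R -> R[i]) (t1 t2 : R) : t1 <= t2 -> ccontinuous f ->
  exists2 M, 0 <= M & forall t, t1 <= t <= t2 -> nc (f t) <= M.
Proof.
move=> t12 [c1 c2].
have bd (h : R -> R) : continuous h -> exists2 M, 0 <= M & forall t, t1 <= t <= t2 -> `|h t| <= M.
  move=> ch; have [c _ hc] := @EVT_max R (fun t => `|h t|) t1 t2 t12
    (continuous_subspaceT (fun t => @continuous_comp _ _ _ h (fun y => `|y|) t (ch t) (@norm_continuous _ _ (h t)))).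
  by exists `|h c| => // t tI; apply: hc; rewrite in_itv.
have [M1 M10 h1] := bd _ c1; have [M2 M20 h2] := bd _ c2.
exists (M1 + M2); first exact: addr_ge0.
by move=> t tI; apply: le_trans (nc_le_ReIm _) (lerD (h1 t tI) (h2 t tI)).
Qed.

Lemma Gfam_bound al be ga (t1 t2 : R) : Gfam al be ga -> t1 <= t2 ->
  exists c M : R, 0 < c /\ forall t, t1 <= t <= t2 ->
    gbd c M (at_ al t) (at_ be t) (at_ ga t).
Proof.
move=> [h1 h2 h3 h4] t12.
have fam (f : 'I_n -> R -> R[i]) : (forall k, ccontinuous (f k)) ->
    exists2 M, 0 <= M & forall k t, t1 <= t <= t2 -> nc (f k t) <= M.
  move=> cf.
  have /choice[M hM] : forall k, exists M, 0 <= M /\ forall t, t1 <= t <= t2 -> nc (f k t) <= M.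
    by move=> k; have [M M0 hM] := cder_ext_bounded t12 (cf k); exists M.
  exists (\sum_k M k); first by apply: sumr_ge0 => k _; case: (hM k).
  move=> k t tI; apply: le_trans (_ : M k <= _).
    by have [_] := hM k; apply.
  by rewrite (bigD1 k)//= lerDl; apply: sumr_ge0 => j _; case: (hM j).
have ca k := cder_continuous (h1 k); have cb k := cder_continuous (h2 k).
have cg k := cder_continuous (h3 k).
have [Ma Ma0 hMa] := fam al ca; have [Mb Mb0 hMb] := fam be cb; have [Mg Mg0 hMg] := fam ga cg.
(* A positive lower bound for Re [al] on the compact interval is obtained as an upper bound for its
   inverse. *)
have ci (k : 'I_n) : ccontinuous (fun t => ((cRe (al k t))^-1)%:C).
  apply: ccont_real => t; apply: continuousV; first by rewrite gt_eqF.
  by case: (ca k) => + _; apply.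
have [Mi Mi0 hMi] := fam _ ci.
exists (1 + Mi)^-1, (Ma + Mb + Mg).
have p1 : 0 < 1 + Mi by rewrite ltr_wpDr.
split; first by rewrite invr_gt0.
move=> t tI k; split; rewrite /at_.
- have := hMi k t tI; rewrite nc_real gtr0_norm ?invr_gt0// => h.
  by rewrite -[leRHS]invrK lef_pV2 ?posrE ?invr_gt0//; apply: le_trans h _; rewrite lerDr.
- by have := hMb k t tI; lra.
- by have := hMa k t tI; lra.
- by have := hMg k t tI; lra.
Qed.

Lemma cder_gph al be ga x t : Gfam al be ga ->
  cder (fun t => gph (at_ al t) (at_ be t) (at_ ga t) x) t
    (Tht lam q (at_ al t) (at_ be t) x * gph (at_ al t) (at_ be t) (at_ ga t) x).
Proof.
move=> [h1 h2 h3 _]; rewrite /gph.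
have dk k := cderD (cderD (cderM (cderN (h1 k t)) (cder_cst ((x 0 k)%:C ^+ 2) t))
  (cderM (h2 k t) (cder_cst (x 0 k)%:C t))) (h3 k t).
have := cder_cexp (cder_sum (index_enum _) xpredT dk).
rewrite /expo; move/cder_val; apply; congr (_ * _).
rewrite /Tht; apply: eq_bigr => k _; rewrite /theta /at_ /iq.
rewrite !(rmorphM, rmorphXn, fmorphV, rmorph_nat) /=.
have l0 := lamC0 lam0.
by field.
Qed.

Variables (u : R -> 'rV[R]_n -> R[i]) (d1 d2 : 'I_n -> R -> 'rV[R]_n -> R[i]).
Hypothesis nu : forall t, nice (u t) (fun j => d1 j t) (fun j => d2 j t).
Hypothesis du : forall x t, cder (u ^~ x) t (Lop lam q (u t) (fun j => d2 j t) x).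

Hypothesis n_gt0 : (0 < n)%N.

Let Lu t := Lop lam q (u t) (fun j => d2 j t).

Definition ubd (k : R) (t1 t2 : R) := forall t x, t1 <= t <= t2 ->
  nc (u t x) <= k /\ nc (Lop lam q (u t) (fun j => d2 j t) x) <= k.

(** The times of [u] and of the Gaussian are kept apart because [pairing_Lop_const] freezes the
    first and differentiates in the second. *)
Definition pairing (al be ga : 'I_n -> R -> R[i]) (t r : R) : R[i] :=
  Ig (fun x => u t x * gph (at_ al r) (at_ be r) (at_ ga r) x).

Lemma Tht_bound (c M : R) : 0 <= M -> exists2 N : R, 0 <= N &
  forall (a b g : 'I_n -> R[i]), gbd c M a b g ->
  forall x, nc (Tht lam q a b x) <= N * Wt x ^+ 2.
Proof.
move=> M0.
exists (\sum_j (nc (iq lam) * (9 * M ^+ 2 + 2 * M) + lam * `|q j|)).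
  apply: sumr_ge0 => j _; rewrite addr_ge0// mulr_ge0 ?nc_ge0 ?(ltW lam0)//.
  by rewrite addr_ge0// mulr_ge0// sqr_ge0.
move=> a b g hb x; rewrite /Tht mulr_suml; apply: le_trans (nc_sum _ _ _) _.
apply: ler_sum => j _; have [_ h2 h3 _] := hb j.
apply: le_trans (ncD _ _) _; rewrite [leRHS]mulrDl; apply: lerD.
  rewrite ncM ncN -mulrA ler_wpM2l ?nc_ge0//; exact: theta2_bound.
rewrite ncM nc_i mul1r nc_real normrM (gtr0_norm lam0) -mulrA ler_wpM2l ?(ltW lam0)//.
rewrite normrM (ger0_norm (sqr_ge0 _)) ler_wpM2l//.
exact: le_trans (coord_sqr_le j x) (W1_le x).
Qed.

Lemma sepc_u t : sepc (u t). Proof. exact: nice_sepc (nu t). Qed.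

Lemma sepc_Lu t : sepc (Lu t).
Proof. by apply: sepc_Lop; [exact: sepc_u|case: (nu t)]. Qed.

Lemma ubd_M0 (k t1 t2 : R) : t1 <= t2 -> ubd k t1 t2 -> 0 <= k.
Proof.
move=> t12 /(_ t1 0); rewrite lexx => /(_ t12)[h _].
exact: le_trans (nc_ge0 _) h.
Qed.

Lemma W2_ge1 x : 1 <= Wt x ^+ 2.
Proof. exact: le_trans (Wt_ge1 x) (W1_le x). Qed.

(** The integrand has time derivative (Lop u + u Tht) phi, whose integral is 0 by [Ig_Lop]; the
    bound [ubd] allows differentiation under the integral in the open interval. The endpoints are
    reached by dominated convergence. *)
Lemma pairing_const al be ga (k t1 t2 : R) : Gfam al be ga -> t1 <= t2 -> ubd k t1 t2 ->
  forall s t, t1 <= s <= t2 -> t1 <= t <= t2 ->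
  pairing al be ga s s = pairing al be ga t t.
Proof.
move=> gf t12 hu.
have [c [M [c0 hM]]] := Gfam_bound gf t12.
have k0 := ubd_M0 t12 hu.
have [K K0 hK] := @gph_bound R n c M c0.
have M0 : 0 <= M.
  have tt : t1 <= t1 <= t2 by rewrite lexx.
  have [_ _ _ h] := hM t1 tt (Ordinal n_gt0).
  exact: le_trans (nc_ge0 _) h.
have [N N0 hN] := Tht_bound c M0.
pose ph t x := gph (at_ al t) (at_ be t) (at_ ga t) x.
pose g t x := u t x * ph t x.
pose g' t x := (u t x * Tht lam q (at_ al t) (at_ be t) x + Lu t x) * ph t x.
have dg t x : cder (g ^~ x) t (g' t x).
  have := cderM (du x t) (cder_gph x t gf).
  by move/cder_val; apply; rewrite /g' /ph /Lu; ring.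
have cph t : sepc (ph t) by exact: sepc_gph.
have cg t : sepc (g t) by apply: sepcM => //; exact: sepc_u.
have cg' t : sepc (g' t).
  apply: sepcM => //; apply: sepcD; last exact: sepc_Lu.
  by apply: sepcM; [exact: sepc_u|exact: sepc_Tht].
have bg' t : t1 <= t <= t2 -> dom ((k * N + k) * K) (g' t).
  move=> tI; apply: dom_gph; first exact: hK (hM t tI).
  move=> x; have [h1 h2] := hu t x tI; apply: le_trans (ncD _ _) _.
  rewrite ncM [leRHS]mulrDl; apply: lerD.
    by rewrite -mulrA; apply: ler_pM; rewrite ?nc_ge0//; exact: hN (hM t tI) x.
  by apply: le_trans h2 _; rewrite ler_peMr// W2_ge1.
have bg t : t1 <= t <= t2 -> dom (k * K) (g t).
  move=> tI; apply: dom_gph; first exact: hK (hM t tI).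
  move=> x; have [h1 _] := hu t x tI.
  by apply: le_trans h1 _; rewrite ler_peMr// W2_ge1.
have z t : t1 <= t <= t2 -> Ig (g' t) = 0.
  move=> tI; have e := Ig_Lop q lam0 c0 (hM t tI) (nu t).
  have b1 : dom (k * N * K) (fun x => u t x * Tht lam q (at_ al t) (at_ be t) x * ph t x).
    apply: dom_gph; first exact: hK (hM t tI).
    move=> x; have [h1 _] := hu t x tI; rewrite ncM -mulrA.
    by apply: ler_pM; rewrite ?nc_ge0//; exact: hN (hM t tI) x.
  have b2 : dom (k * K) (fun x => Lu t x * ph t x).
    apply: dom_gph; first exact: hK (hM t tI).
    move=> x; have [_ h1] := hu t x tI.
    by apply: le_trans h1 _; rewrite ler_peMr// W2_ge1.
  transitivity (Ig (fun x => u t x * Tht lam q (at_ al t) (at_ be t) x * ph t x + Lu t x * ph t x)).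
    by apply: Ig_ext => x; rewrite /g'; ring.
  rewrite (IgD _ b1 _ b2); last by apply: sepcM => //; exact: sepc_Lu.
    by rewrite e subrr.
  by apply: sepcM => //; apply: sepcM; [exact: sepc_u|exact: sepc_Tht].
have dI t : t1 < t < t2 -> cder (fun r => Ig (g r)) t 0.
  move=> tI; rewrite -(z t); last by have /andP[a1 a2] := tI; rewrite !ltW.
  have sub r : t1 < r < t2 -> t1 <= r <= t2 by move=> /andP[a1 a2]; rewrite !ltW.
  apply: (@Ig_diff _ _ g g' ((k * N + k) * K) t1 t2) => //.
  - by move=> r /sub; exact: bg'.
  - by move=> r /sub rI; exists (k * K); exact: bg.
move=> s0 t0; rewrite /pairing -/(g s0) -/(g t0).
move: t12; rewrite le_eqVlt => /predU1P[<-|t12].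
  by rewrite -!eq_le => /eqP <- /eqP <-.
pose m := (t1 + t2) / 2.
have mI : t1 < m < t2 by rewrite /m; apply/andP; split; lra.
suff key t : t1 <= t <= t2 -> Ig (g t) = Ig (g m).
  by move=> /key h1 /key h2; transitivity (Ig (g m)).
move=> tI.
(* The divisor is at least 2, so every [v i] lies strictly inside the interval even when [t] is an
   endpoint. *)
pose v i : R := t + (m - t) / (i.+2)%:R.
have vI i : t1 < v i < t2.
  have h1 : 0 < (i.+2%:R : R)^-1 by rewrite invr_gt0 ltr0n.
  have h2 : (i.+2%:R : R)^-1 < 1 by rewrite invf_lt1 ?ltr0n// ltr1n.
  rewrite /v; set w := (i.+2%:R : R)^-1 in h1 h2 *.
  have -> : t + (m - t) * w = t * (1 - w) + m * w by ring.
  have w1 : 0 < 1 - w by rewrite subr_gt0.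
  move: tI mI => /andP[a1 a2] /andP[a3 a4]; apply/andP; split; nra.
have vc : v i @[i --> \oo] --> t.
  rewrite -[X in _ --> X]addr0; apply: cvgD; first exact: cvg_cst.
  rewrite -[X in _ --> X](mulr0 (m - t)); apply: cvgM; first exact: cvg_cst.
  by have := @cvg_harmonic R; rewrite -(cvg_shiftS (@harmonic R)).
have cv : ccvg (fun i => Ig (g (v i))) (Ig (g t)).
  apply: (@Ig_cvg _ _ _ _ (k * K)) => //.
  - by move=> i; apply: bg; have /andP[a1 a2] := vI i; rewrite !ltW.
  - move=> x; exact: ccont_seq (cder_continuous (fun r => dg r x)) vc.
apply: ccvg_unique cv _.
have -> : (fun i => Ig (g (v i))) = fun=> Ig (g m).
  by apply/funext => i; apply: (cder_const dI (vI i) mI).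
exact: ccvg_cst.
Qed.

End GaussianEvolution.

(** * Explicit solution of the Riccati system *)

Section ExplicitGaussians.
Context {R : realType} {n : nat}.
Local Open Scope classical_set_scope.
Variables (lam : R) (q : 'I_n -> R).
Hypothesis lam0 : 0 < lam.
Implicit Types (x : 'rV[R]_n) (j k : 'I_n) (s t : R).

Section LopPairing.
Variables (u : R -> 'rV[R]_n -> R[i]) (d1 d2 : 'I_n -> R -> 'rV[R]_n -> R[i]).
Hypothesis nu : forall t, nice (u t) (fun j => d1 j t) (fun j => d2 j t).
Hypothesis du : forall x t, cder (u ^~ x) t (Lop lam q (u t) (fun j => d2 j t) x).
Hypothesis n_gt0 : (0 < n)%N.

(** Lop u formally solves the same equation, but its time derivative is not at hand. Instead the
    Gaussian is moved: shifting the family by r gives another solution family, so the pairing of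
    u(t) with phi(t + r) does not depend on t for any r. Its r-derivative at 0 is minus the pairing
    of Lop u with phi. *)
Lemma pairing_Lop_const al be ga (k t1 t2 : R) :
  Gfam lam q al be ga -> t1 <= t2 -> ubd lam q u d2 k t1 t2 ->
  forall s t, t1 <= s <= t2 -> t1 <= t <= t2 ->
  Ig (fun x => Lop lam q (u s) (fun j => d2 j s) x * gph (at_ al s) (at_ be s) (at_ ga s) x) =
  Ig (fun x => Lop lam q (u t) (fun j => d2 j t) x * gph (at_ al t) (at_ be t) (at_ ga t) x).
Proof.
move=> gf t12 hu s t sI tI.
pose F t r := pairing u al be ga t (t + r).
have dF t0 : cder (F t0) 0 (- Ig (fun x => Lop lam q (u t0) (fun j => d2 j t0) x *
    gph (at_ al t0) (at_ be t0) (at_ ga t0) x)).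
  have tt : t0 - 1 <= t0 + 1 by lra.
  have [c [M [c0 hM]]] := Gfam_bound gf tt.
  have [K K0 hK] := @gph_bound R n c M c0.
  have hs r : -1 < r < 1 -> t0 - 1 <= t0 + r <= t0 + 1 by move=> /andP[h1 h2]; apply/andP; split; lra.
  have z1 : -1 < (0 : R) < 1 by rewrite ltr01 oppr_lt0 ltr01.
  have M0 : 0 <= M.
    have [_ _ _ h] := hM _ (hs _ z1) (Ordinal n_gt0).
    exact: le_trans (nc_ge0 _) h.
  have [N N0 hN] := Tht_bound q lam0 c M0.
  have [D D0 hD] := nice_b (nu t0).
  have hM0 := hM _ (hs _ z1); rewrite addr0 in hM0.
  have cu := nice_sepc (nu t0).
  rewrite (Ig_Lop q lam0 c0 hM0 (nu t0)) opprK.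
  have gs r := Gfam_shift r gf.
  pose G r x := u t0 x * gph (at_ al (t0 + r)) (at_ be (t0 + r)) (at_ ga (t0 + r)) x.
  pose G' r x := (u t0 x * Tht lam q (at_ al (t0 + r)) (at_ be (t0 + r)) x) *
     gph (at_ al (t0 + r)) (at_ be (t0 + r)) (at_ ga (t0 + r)) x.
  have := @Ig_diff _ _ G G' (D * N * K) (-1) 1 _ _ _ _ _ 0 z1.
  rewrite /G' addr0; apply.
  - move=> r x _.
    have dr : is_derive r (1 : R) (fun r => t0 + r) 1.
      have := is_derive_add (is_derive_cst t0 r (1 : R)) (is_derive_id r (1 : R)).
      by move/is_derive_val; apply; rewrite add0r.
    have := cderZ (u t0 x) (@cder_comp _ (fun t => gph (at_ al t) (at_ be t) (at_ ga t) x)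
       (fun r => t0 + r) r _ _ (cder_gph lam0 x (t0 + r) gf) dr).
    by move/cder_val; apply; rewrite rmorph1 mul1r mulrA.
  - move=> r /hs rI; apply: dom_gph; first exact: hK (hM _ rI).
    move=> x; have [h1 _] := hD x; rewrite ncM -mulrA.
    by apply: ler_pM; rewrite ?nc_ge0//; exact: hN (hM _ rI) x.
  - by move=> r _; apply: sepcM => //; exact: sepc_gph.
  - by move=> r _; apply: sepcM; [apply: sepcM => //; exact: sepc_Tht|exact: sepc_gph].
  - move=> r /hs rI; exists (D * K); apply: dom_gph; first exact: hK (hM _ rI).
    move=> x; have [h1 _] := hD x.
    by apply: le_trans h1 _; rewrite ler_peMr// W2_ge1.
have eF r : F s r = F t r.
  exact: (pairing_const lam0 nu du n_gt0 (Gfam_shift r gf) t12 hu sI tI).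
apply: oppr_inj; apply: (cder_unique (dF s)).
by apply: cder_ext (dF t) => r; rewrite eF.
Qed.

End LopPairing.

Variables (Cs Ss : 'I_n -> R -> R).
Hypothesis dCs : forall k t, is_derive t (1 : R) (Cs k) (- q k * Ss k t).
Hypothesis dSs : forall k t, is_derive t (1 : R) (Ss k) (Cs k t).
Hypothesis Cs0 : forall k, Cs k 0 = 1.
Hypothesis Ss0 : forall k, Ss k 0 = 0.

(** [Cs] and [Ss] stand for cos(omega t) and sin(omega t) / omega, and [q] for omega^2. They enter
    through their differential equations only, which treats real and imaginary omega alike; this is
    the conserved energy. *)
Lemma wronskian k t : Cs k t ^+ 2 + q k * Ss k t ^+ 2 = 1.
Proof.
pose f t : R[i] := (Cs k t * Cs k t + q k * (Ss k t * Ss k t))%:C.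
have df r : cder f r 0.
  have := cder_real (is_derive_add (is_derive_mul (dCs k r) (dCs k r))
    (is_derive_mul (is_derive_cst (q k) r (1 : R)) (is_derive_mul (dSs k r) (dSs k r)))).
  by move/cder_val; apply; rewrite /cst; congr (_%:C); ring.
have : f t = f 0.
  apply: (@cder_const _ f (Num.min t 0 - 1) (Num.max t 0 + 1)) => //.
    by apply/andP; split; [rewrite ltrBlDr ltr_pwDr// ge_min lexx|rewrite ltr_pwDr// le_max lexx].
  by apply/andP; split; [rewrite ltrBlDr ltr_pwDr// ge_min lexx orbT|rewrite ltr_pwDr// le_max lexx orbT].
by rewrite /f Cs0 Ss0 => /complexI; rewrite !expr2 !mulr0 addr0 mulr1.
Qed.

Variables (r B : 'I_n -> R) (X : 'rV[R]_n).
Hypothesis B0 : forall k, 0 < B k.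

(* The Riccati equation is linearized by al = i lam pp' / pp with pp'' = - q pp; pp 0 = 1
   and pp' 0 encode the Gaussian E0 at time 0, and La is a continuous logarithm of pp,
   so that exp(- La / 2) is the branch of 1 / sqrt(pp) along the evolution. *)
Definition pp k t : R[i] := (Cs k t - r k * Ss k t)%:C - 'i%C * (B k / lam * Ss k t)%:C.
Definition pp' k t : R[i] := (- q k * Ss k t - r k * Cs k t)%:C - 'i%C * (B k / lam * Cs k t)%:C.

Lemma Re_pp k t : cRe (pp k t) = Cs k t - r k * Ss k t.
Proof. by rewrite /pp ReD ReN ReM /= mul0r mul1r subrr oppr0 addr0. Qed.
Lemma Im_pp k t : cIm (pp k t) = - (B k / lam * Ss k t).
Proof. by rewrite /pp ImD ImN ImM /= mul0r mul1r !add0r. Qed.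
Lemma Re_pp' k t : cRe (pp' k t) = - q k * Ss k t - r k * Cs k t.
Proof. by rewrite /pp' ReD ReN ReM /= mul0r mul1r subrr oppr0 addr0. Qed.
Lemma Im_pp' k t : cIm (pp' k t) = - (B k / lam * Cs k t).
Proof. by rewrite /pp' ImD ImN ImM /= mul0r mul1r !add0r. Qed.

Lemma Bl0 k : 0 < B k / lam. Proof. by rewrite divr_gt0. Qed.

(** Since B > 0, a zero forces Ss = 0 from the imaginary part and then Cs = 0 from the real part,
    against [wronskian]. *)
Lemma pp_neq0 k t : pp k t != 0.
Proof.
apply/eqP => p0; have := Im_pp k t; have := Re_pp k t; rewrite p0 /= => e1 /eqP.
rewrite eq_sym oppr_eq0 mulf_eq0 gt_eqF ?Bl0//= => /eqP s0.
have := wronskian k t; rewrite s0 in e1 *; rewrite mulr0 subr0 in e1.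
by rewrite -e1 expr0n mulr0 addr0 => /eqP; rewrite eq_sym oner_eq0.
Qed.

Lemma cder_pp k t : cder (pp k) t (pp' k t).
Proof.
have := cderB (cder_real (is_derive_sub (dCs k t) (is_derive_mul (is_derive_cst (r k) t (1 : R)) (dSs k t))))
  (cderZ 'i%C (cder_real (is_derive_mul (is_derive_cst (B k / lam) t (1 : R)) (dSs k t)))).
by move/cder_val; apply; rewrite /pp' /cst !mul0r !addr0.
Qed.

Lemma cder_pp' k t : cder (pp' k) t (- (q k)%:C * pp k t).
Proof.
have := cderB (cder_real (is_derive_sub (is_derive_mul (is_derive_cst (- q k) t (1 : R)) (dSs k t)) (is_derive_mul (is_derive_cst (r k) t (1 : R)) (dCs k t))))
  (cderZ 'i%C (cder_real (is_derive_mul (is_derive_cst (B k / lam) t (1 : R)) (dCs k t)))).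
move/cder_val; apply; rewrite /pp /cst !mul0r !addr0.
by rewrite !(rmorphB, rmorphM, rmorphN, rmorphD) /=; ring.
Qed.

(** Differentiability comes from 1/f = conj(f) / |f|^2; the value is then read off by
    differentiating f (1/f) = 1. *)
Lemma cder_inv (f : R -> R[i]) t l : (forall t, f t != 0) -> cder f t l ->
  cder (fun t => (f t)^-1) t (- l / f t ^+ 2).
Proof.
move=> f0 [d1 d2].
have N0 s : cRe (f s) ^+ 2 + cIm (f s) ^+ 2 != 0.
  apply: contra (f0 s) => /eqP h; have h1 := sqr_ge0 (cRe (f s)); have h2 := sqr_ge0 (cIm (f s)).
  have e1 : cRe (f s) ^+ 2 = 0 by lra.
  have e2 : cIm (f s) ^+ 2 = 0 by lra.
  by apply/eqP; apply: eq_ReIm => /=; apply/eqP; rewrite -sqrf_eq0; apply/eqP.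
pose N s := cRe (f s) * cRe (f s) + cIm (f s) * cIm (f s).
have NN0 : N t != 0 by rewrite /N -!expr2.
have dN := is_derive_add (is_derive_mul d1 d1) (is_derive_mul d2 d2).
have dV := is_derive_comp (is_derive_inv NN0) dN.
have dI := cderM (cderB (cder_real d1) (cderZ 'i%C (cder_real d2))) (cder_real dV).
have e s : (f s)^-1 = ((cRe (f s))%:C - 'i%C * (cIm (f s))%:C) * ((N s)^-1)%:C.
  apply: (mulfI (f0 s)); rewrite divff// {1}(complexRI (f s)) mulrA.
  rewrite (_ : _ * (_ - _) = (N s)%:C).
    by rewrite -rmorphM divff// /N -!expr2.
  rewrite /N rmorphD !rmorphM /=.
  transitivity ((cRe (f s))%:C * (cRe (f s))%:C - 'i%C ^+ 2 * ((cIm (f s))%:C * (cIm (f s))%:C)); first by ring.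
  by rewrite sqr_i; ring.
rewrite (_ : (fun s => _ * _) = fun s => (f s)^-1) in dI; last by apply/funext => s; rewrite e.
set l' := (X in cder _ _ X) in dI.
have d1f : cder (fun s => f s * (f s)^-1) t (f t * l' + l * (f t)^-1) by apply: cderM.
have dc : cder (fun s => f s * (f s)^-1) t 0.
  by rewrite (_ : (fun s => _) = fun=> 1); [exact: cder_cst|apply/funext => s; rewrite divff].
have := cder_unique d1f dc => /eqP; rewrite addr_eq0 => /eqP h.
have -> : - l / f t ^+ 2 = l'; last by [].
have -> : l' = (f t)^-1 * (f t * l') by rewrite mulKf.
by rewrite h; field.
Qed.

Lemma nc_sqr (z : R[i]) : nc z ^+ 2 = cRe z ^+ 2 + cIm z ^+ 2.
Proof.
by case: z => a b; rewrite /Normc.normc sqr_sqrtr// addr_ge0 ?sqr_ge0.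
Qed.

Lemma Im_div (w z : R[i]) :
  cIm (w / z) = (cIm w * cRe z - cRe w * cIm z) / (cRe z ^+ 2 + cIm z ^+ 2).
Proof. case: w => a b; case: z => c d /=. ring. Qed.

(** Equivalently (Ss / pp)' = 1 / pp^2, which integrates the term [be]^2 in the equation for
    [ga]. *)
Lemma pp_wronskian k t : (Cs k t)%:C * pp k t - (Ss k t)%:C * pp' k t = 1.
Proof.
rewrite -[RHS](rmorph1 (real_complex R)) -(wronskian k t) /pp /pp'.
by rewrite !(rmorphD, rmorphB, rmorphM, rmorphXn, rmorphN) /=; ring.
Qed.

Variable La : 'I_n -> R -> R[i].
Hypothesis dLa : forall k t, cder (La k) t (pp' k t / pp k t).
Hypothesis La0 : forall k, La k 0 = 0.

(** The system is solved in cascade: [bex] from its linear equation, then [gax] by quadrature, where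
    Ss / pp integrates [be]^2 and [La] integrates [al]. *)
Definition alx k t : R[i] := 'i%C * lam%:C * (pp' k t / pp k t).
Definition bex k t : R[i] := (2 * B k * X 0 k)%:C / pp k t.
Definition gax k t : R[i] := - (B k * X 0 k ^+ 2)%:C
  - 'i%C * (B k ^+ 2 * X 0 k ^+ 2 / lam)%:C * ((Ss k t)%:C / pp k t) - 2^-1 * La k t.

Lemma Gfam_explicit : Gfam lam q alx bex gax.
Proof.
have l0 := lamC0 lam0; have i2 := sqr_i R.
have dV k t := cder_inv (pp_neq0 k) (cder_pp k t).
have dP k t := cderM (cder_pp' k t) (dV k t).
split=> k t.
- have := cderZ ('i%C * lam%:C) (dP k t); move/cder_val; apply.
  have p0 := pp_neq0 k t; rewrite /alx !(rmorphM, fmorphV) /=.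
  transitivity (- 'i%C * lam%:C * (q k)%:C + 'i%C * ('i%C ^+ 2) * lam%:C * (pp' k t / pp k t) ^+ 2).
    by rewrite i2; field.
  by field; rewrite l0 p0.
- have := cderZ ((2 * B k * X 0 k)%:C) (dV k t); move/cder_val; apply.
  have p0 := pp_neq0 k t; rewrite /alx /bex !(rmorphM, fmorphV) /=.
  transitivity ('i%C ^+ 2 * (2%:R%:C * (B k)%:C * (X 0 k)%:C) * (pp' k t / pp k t ^+ 2)).
    by rewrite i2; field.
  by field; rewrite l0 p0.
- have := cderB (cderB (cder_cst (- (B k * X 0 k ^+ 2)%:C) t)
    (cderZ ('i%C * (B k ^+ 2 * X 0 k ^+ 2 / lam)%:C) (cderM (cder_real (dSs k t)) (dV k t))))
    (cderZ 2^-1 (dLa k t)).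
  move/cder_val; apply.
  have p0 := pp_neq0 k t; rewrite /alx /bex /iq !(rmorphM, fmorphV, rmorphXn, rmorph_nat) /=.
  have e : (Ss k t)%:C * (- pp' k t / pp k t ^+ 2) + (Cs k t)%:C * (pp k t)^-1 = (pp k t ^+ 2)^-1.
    by rewrite -[RHS]mul1r -(pp_wronskian k t); field.
  rewrite e.
  transitivity (- 'i%C * ((B k)%:C ^+ 2 * (X 0 k)%:C ^+ 2 / lam%:C) / pp k t ^+ 2 + 'i%C ^+ 2 * 2^-1 * (pp' k t / pp k t)).
    by rewrite i2; field; rewrite p0 l0.
  by field; rewrite l0 p0.
(* By [wronskian] the real part of [al] is B / |pp|^2. *)
- rewrite /alx -mulrA ReM (_ : cRe 'i%C = 0)// (_ : cIm 'i%C = 1)// mul0r mul1r sub0r Im_wM Im_div Re_pp Im_pp Re_pp' Im_pp'.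
  set N := (_ ^+ 2 + _ ^+ 2).
  have N0 : 0 < N.
    by rewrite /N -Re_pp -Im_pp -nc_sqr exprn_gt0// nc_gt0 pp_neq0.
  have -> : - (lam * ((- (B k / lam * Cs k t) * (Cs k t - r k * Ss k t) -
    (- q k * Ss k t - r k * Cs k t) * - (B k / lam * Ss k t)) / N)) =
    B k * (Cs k t ^+ 2 + q k * Ss k t ^+ 2) / N by field; rewrite !gt_eqF.
  by rewrite wronskian mulr1 divr_gt0.
Qed.

Lemma pp_0 k : pp k 0 = 1.
Proof. by apply: eq_ReIm; [rewrite Re_pp Cs0 Ss0 mulr0 subr0|rewrite Im_pp Ss0 mulr0 oppr0]. Qed.

Lemma cexp_La k t : cexp (La k t) = pp k t.
Proof.
pose f s := cexp (- La k s) * pp k s.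
have df s : cder f s 0.
  have := cderM (cder_cexp (cderN (dLa k s))) (cder_pp k s).
  by move/cder_val; apply; have p0 := pp_neq0 k s; field.
have : f t = f 0.
  apply: (@cder_const _ f (Num.min t 0 - 1) (Num.max t 0 + 1)) => //.
    by apply/andP; split; [rewrite ltrBlDr ltr_pwDr// ge_min lexx|rewrite ltr_pwDr// le_max lexx].
  by apply/andP; split; [rewrite ltrBlDr ltr_pwDr// ge_min lexx orbT|rewrite ltr_pwDr// le_max lexx orbT].
rewrite /f La0 oppr0 cexp0 mul1r pp_0 cexpN => h.
by rewrite -[LHS]mulr1 -[X in _ * X]h mulrA divff ?mul1r ?cexp_neq0.
Qed.

Definition E0 x : R[i] := cexp (\sum_k ('i%C * (lam * r k * x 0 k ^+ 2)%:C - (B k * (x 0 k - X 0 k) ^+ 2)%:C)).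

Lemma gph_at0 : gph (at_ alx 0) (at_ bex 0) (at_ gax 0) = E0.
Proof.
apply/funext => x; rewrite /gph /E0 /expo; congr cexp; apply: eq_bigr => k _.
have p0 := pp_0 k.
have p0' : pp' k 0 = - (r k)%:C - 'i%C * (B k / lam)%:C.
  by rewrite /pp' Cs0 Ss0 !mulr0 sub0r !mulr1 rmorphN.
have l0 := lamC0 lam0; have i2 := sqr_i R.
rewrite /at_ /alx /bex /gax p0 p0' La0 Ss0 !mulr0 subr0 !divr1.
rewrite !(rmorphM, fmorphV, rmorphXn, rmorphB, rmorph_nat) /= rmorph0 !mulr0 subr0.
transitivity ('i%C * lam%:C * (r k)%:C * (x 0 k)%:C ^+ 2 + 'i%C ^+ 2 * (B k)%:C * (x 0 k)%:C ^+ 2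
  + 2 * (B k)%:C * (X 0 k)%:C * (x 0 k)%:C - (B k)%:C * (X 0 k)%:C ^+ 2).
  by field.
by rewrite i2; ring.
Qed.

Definition E1 (tau : R) x : R[i] := cexp (\sum_k (- (lam ^+ 2 / (B k * Ss k tau ^+ 2) * x 0 k ^+ 2)%:C
  + 'i%C * (- (lam * r k * x 0 k ^+ 2) + 2 * lam * X 0 k * x 0 k / Ss k tau)%:C)).

(** This choice of [r] cancels the real part of [pp] at [tau], leaving pp = - i B Ss / lam. Hence
    [X] survives only in a phase, the two terms B X^2 of [gax] cancel, and B enters [E1] only
    through lam^2 / (B Ss^2). *)
Lemma gph_at_tau tau : (forall k, Ss k tau != 0) -> (forall k, r k = Cs k tau / Ss k tau) ->
  gph (at_ alx tau) (at_ bex tau) (at_ gax tau) =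
  fun x => cexp (\sum_k - (2^-1 * La k tau)) * E1 tau x.
Proof.
move=> S0 hr; apply/funext => x; rewrite /gph /E1 /expo -cexpD -big_split; congr cexp.
apply: eq_bigr => k _ /=.
have Sn := S0 k.
have p0 : pp k tau = - 'i%C * ((B k)%:C / lam%:C * (Ss k tau)%:C).
  by rewrite /pp hr mulfVK// subrr !(rmorphM, fmorphV) rmorph0 sub0r mulNr.
have p0' : pp' k tau = - ((Ss k tau)%:C)^-1 - 'i%C * ((B k)%:C / lam%:C * (Cs k tau)%:C).
  rewrite /pp' hr !(rmorphM, fmorphV); congr (_ - _).
  rewrite -fmorphV -rmorphN; congr (_%:C).
  by rewrite -[RHS](mul1r) -(wronskian k tau) mulrN; field.
have l0 := lamC0 lam0; have i2 := sqr_i R.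
have SC : (Ss k tau)%:C != 0 :> R[i] by rewrite fmorph_eq0.
have BC : (B k)%:C != 0 :> R[i] by rewrite fmorph_eq0 gt_eqF.
have iC := @i_neq0 R.
rewrite /at_ /alx /bex /gax p0 p0' hr.
rewrite !(rmorphD, rmorphN, rmorphM, fmorphV, rmorphXn, rmorphB, rmorph_nat) /=.
set S := (Ss k tau)%:C in SC *; set C := (Cs k tau)%:C; set b := (B k)%:C in BC *.
set l := lam%:C in l0 *; set y := (x 0 k)%:C; set z := (X 0 k)%:C.
have a1 : 'i%C * l * ((- S^-1 - 'i%C * (b / l * C)) / (- 'i%C * (b / l * S))) =
   l ^+ 2 / (b * S ^+ 2) + 'i%C * l * (C / S) by field; rewrite SC BC l0 iC.
have iV := @invr_i R.
have a2 : 2 * b * z / (- 'i%C * (b / l * S)) = 2 * 'i%C * (l * z / S).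
  transitivity (- (2 * 'i%C^-1 * (l * z / S))); last by rewrite iV; ring.
  by field; rewrite SC BC l0 iC.
have a3 : 'i%C * (b ^+ 2 * z ^+ 2 / l) * (S / (- 'i%C * (b / l * S))) = - (b * z ^+ 2).
  by field; rewrite SC BC l0 iC.
rewrite a1 a2 a3; field; rewrite SC BC //.
Qed.

End ExplicitGaussians.

(** * Bounds locally uniform in time *)

Section KernelBound.
Context {R : realType} {n : nat}.
Local Open Scope classical_set_scope.
Implicit Types (x X : 'rV[R]_n) (j k : 'I_n).

(** A function [F [::]] with its iterated partial derivatives, kept abstract since it is
    instantiated both by u and by Lop u. *)
Record chain (F : seq 'I_n -> 'rV[R]_n -> R[i]) : Prop := Chain {
  chain_d : forall s j x, pder j (F s) x (F (j :: s) x);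
  chain_dom : forall s, exists C, dom C (F s) }.

Lemma chain_sepc F s : chain F -> sepc (F s).
Proof. by case=> h _; exact: pder_sepc (h s). Qed.

(* e k is a bounded primitive of the chirp e' k; mixprod e e' s is the kernel after
   integration by parts in the coordinates of s. *)
Definition mixprod (e e' : 'I_n -> R -> R[i]) (s : seq 'I_n) x : R[i] :=
  \prod_k (if k \in s then e k (x 0 k) else e' k (x 0 k)).

Section Chirp.
Variables (F : seq 'I_n -> 'rV[R]_n -> R[i]) (e e' : 'I_n -> R -> R[i]) (M : R).
Hypothesis cF : chain F.
Hypothesis de : forall k y, cder (e k) y (e' k y).
Hypothesis ce' : forall k, ccontinuous (e' k).
Hypothesis be : forall k y, nc (e k y) <= M.
Hypothesis be' : forall k y, nc (e' k y) <= M.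

Lemma mixprod_bound s x : nc (mixprod e e' s x) <= M ^+ n.
Proof.
rewrite /mixprod nc_prod -[n in leRHS]card_ord -prodr_const.
apply: ler_prod => k _; rewrite nc_ge0 /=.
by case: ifP.
Qed.

Lemma sepc_mixprod s : sepc (mixprod e e' s).
Proof.
have cf k : sepc (fun x => if k \in s then e k (x 0 k) else e' k (x 0 k)).
  case: (k \in s); apply: sepc_coord; last exact: ce'.
  exact: cder_continuous (de k).
exact: (sepc_prod (index_enum _) xpredT cf).
Qed.

Lemma Ig_chirp_step s j : j \notin s ->
  nc (Ig (fun x => F s x * mixprod e e' s x)) =
  nc (Ig (fun x => F (j :: s) x * mixprod e e' (j :: s) x)).
Proof.
move=> js.
pose rest x := \prod_(k | k != j) (if k \in s then e k (x 0 k) else e' k (x 0 k)).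
have m1 x : mixprod e e' s x = e' j (x 0 j) * rest x.
  by rewrite /mixprod (bigD1 j)//= (negbTE js).
have m2 x : mixprod e e' (j :: s) x = e j (x 0 j) * rest x.
  rewrite /mixprod (bigD1 j)//= mem_head; congr (_ * _).
  by apply: eq_bigr => k kj; rewrite inE (negbTE kj).
have r1 x y : rest (upd x j y) = rest x.
  by apply: eq_bigr => k kj; rewrite updE (negbTE kj).
have [C1 h1] := chain_dom cF s; have [C2 h2] := chain_dom cF (j :: s).
have s1 := chain_sepc s cF; have s2 := chain_sepc (j :: s) cF.
have d1 := dom_bddM h1 (mixprod_bound s).
have d2 := dom_bddM h2 (mixprod_bound (j :: s)).
have d3 := dom_bddM h1 (mixprod_bound (j :: s)).
pose G x := F s x * mixprod e e' (j :: s) x.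
pose G' x := F (j :: s) x * mixprod e e' (j :: s) x + F s x * mixprod e e' s x.
have dm x : pder j (mixprod e e' (j :: s)) x (mixprod e e' s x).
  rewrite /pder m1.
  rewrite (_ : (fun y => _) = fun y => rest x * e j y); last first.
    by apply/funext => y; rewrite m2 upd_same r1 mulrC.
  by have := cderZ (rest x) (de j (x 0 j)); move/cder_val; apply; rewrite mulrC.
have dG x : pder j G x (G' x).
  have := pderM (chain_d cF s j x) (dm x).
  by move/cder_val; apply; rewrite /G' addrC.
have cG : sepc G := sepcM s1 (sepc_mixprod _).
have c1 := sepcM s1 (sepc_mixprod s).
have c2 := sepcM s2 (sepc_mixprod (j :: s)).
have cG' : sepc G' := sepcD c2 c1.
have := domD d2 d1; set C := _ + _ => dG'.
have := @Ig_IBP _ _ j G G' (Num.max (C1 * M ^+ n) C) dG cG cG' _ _.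
rewrite (IgD c2 d2 c1 d1) => h.
have : Ig (fun x => F (j :: s) x * mixprod e e' (j :: s) x) +
  Ig (fun x => F s x * mixprod e e' s x) = 0.
  apply: h => x; rewrite le_max.
    by rewrite d3.
  by rewrite dG' orbT.
by move/eqP; rewrite addr_eq0 => /eqP ->; rewrite ncN.
Qed.

Lemma Ig_chirp s : uniq s -> nc (Ig (fun x => F [::] x * mixprod e e' [::] x)) =
  nc (Ig (fun x => F s x * mixprod e e' s x)).
Proof.
by elim: s => [//|j s IH] /= /andP[js us]; rewrite IH// (Ig_chirp_step js).
Qed.

End Chirp.

(** One integration by parts per coordinate replaces each chirp by its bounded primitive: the
    product of the [eps k] is gained at the price of the mixed derivative [F (enum 'I_n)]. *)
Lemma chirp_bound F (e e' : 'I_n -> R -> R[i]) (eps : 'I_n -> R) C : chain F ->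
  (forall k y, cder (e k) y (e' k y)) -> (forall k, ccontinuous (e' k)) ->
  (forall k y, nc (e k y) <= eps k) -> (forall k y, nc (e' k y) <= 1) ->
  dom C (F (enum 'I_n)) ->
  nc (Ig (fun x => F [::] x * \prod_k e' k (x 0 k))) <= kap ^+ n * (C * \prod_k eps k).
Proof.
move=> cF de ce' be be' dC.
have e0 k : 0 <= eps k by exact: le_trans (nc_ge0 _) (be k 0).
(* A crude common bound, used only to justify the integrations by parts; the final estimate keeps
   the individual [eps k]. *)
pose M := 1 + \sum_k eps k.
have M1 : 1 <= M by rewrite lerDl sumr_ge0.
have beM k y : nc (e k y) <= M.
  apply: le_trans (be k y) _; rewrite /M (bigD1 k)//= addrCA lerDl.
  by rewrite addr_ge0// sumr_ge0.
have beM' k y : nc (e' k y) <= M by apply: le_trans (be' k y) M1.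
have -> : Ig (fun x => F [::] x * \prod_k e' k (x 0 k)) = Ig (fun x => F [::] x * mixprod e e' [::] x).
  by [].
rewrite (Ig_chirp cF de ce' beM beM' (enum_uniq 'I_n)).
apply: Ig_bound.
  exact: sepcM (chain_sepc _ cF) (sepc_mixprod de ce' _).
apply: dom_bddM dC _ => x; rewrite /mixprod nc_prod.
apply: ler_prod => k _; rewrite nc_ge0 /=.
by have -> : k \in enum 'I_n by rewrite mem_enum.
Qed.

Variables (lam : R).
Hypothesis lam0 : 0 < lam.

(* The hypothesis relates v0, tested against Gaussians of width B^(-1/2) at X, to F [::]
   tested against chirps of frequency lam cc / ss. Integrating by parts once in every
   coordinate gains the factor |ss|^(1/2) that compensates A, and B -> oo isolates v0 X. *)
Lemma kernel_bound (v0 : 'rV[R]_n -> R[i]) F (C0 C1 : R) (cc ss : 'I_n -> R) :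
  sepc v0 -> bdd C0 v0 -> (forall x z, ccontinuous (fun p : R => v0 (x + p *: z))) ->
  chain F -> dom C1 (F (enum 'I_n)) ->
  (forall k, ss k != 0) -> (forall k, 2^-1 <= `|cc k|) ->
  (forall X (B : 'I_n -> R), (forall k, 0 < B k) -> exists A : R[i],
     A ^+ 2 = \prod_k ('i%C * (lam / (B k * ss k))%:C) /\
     Ig (fun x => v0 x * cexp (\sum_k ('i%C * (lam * (cc k / ss k) * x 0 k ^+ 2)%:C - (B k * (x 0 k - X 0 k) ^+ 2)%:C))) =
     A * Ig (fun x => F [::] x * cexp (\sum_k (- (lam ^+ 2 / (B k * ss k ^+ 2) * x 0 k ^+ 2)%:C
       + 'i%C * (- (lam * (cc k / ss k) * x 0 k ^+ 2) + 2 * lam * X 0 k * x 0 k / ss k)%:C)))) ->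
  forall X, nc (v0 X) <= (nc (@gmass R n))^-1 * (kap ^+ n * (8 ^+ n * C1)).
Proof.
move=> cv bv lv cF dF s0 c2 htr X.
have c0 k : cc k != 0 by rewrite -normr_gt0; apply: lt_le_trans (c2 k).
pose a0 : R := \prod_k Num.sqrt (lam / `|ss k|).
pose rr i : R := (i.+1%:R)^-1.
have rr0 i : 0 < rr i by rewrite invr_gt0 ltr0n.
have rrc : rr i @[i --> \oo] --> (0 : R) by exact: cvg_harmonic.
pose B (i : nat) (k : 'I_n) : R := rr i ^- 2.
have B0 i k : 0 < B i k by rewrite invr_gt0 exprn_gt0.
have /choice[A hA] := fun i => htr X (B i) (B0 i).
pose ch x : R[i] := cexp (\sum_k 'i%C * (lam * (cc k / ss k) * x 0 k ^+ 2)%:C).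
have chE x : ch x = \prod_k cexp ('i%C * (lam * (cc k / ss k) * x 0 k ^+ 2)%:C) by rewrite /ch cexp_sum.
(* The chirp of [E0] is unimodular, so it can be merged with [v0] without changing |v0 X|. *)
have nch x : nc (ch x) = 1.
  by rewrite chE nc_prod big1// => k _; rewrite nc_chirp.
have cch1 (c : R) : ccontinuous (fun y : R => cexp ('i%C * (c * y ^+ 2)%:C)).
  exact: cder_continuous (fun y => cder_cexp (cderZ 'i%C (cder_real (is_derive_sqr y c)))).
have sch : sepc ch.
  have h k : sepc (fun x => cexp ('i%C * (lam * (cc k / ss k) * x 0 k ^+ 2)%:C)).
    exact: (sepc_coord k (cch1 (lam * (cc k / ss k)))).
  have := sepc_prod (index_enum _) xpredT h.
  by under eq_fun do rewrite -chE.
have lch x z : ccontinuous (fun p : R => ch (x + p *: z)).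
  have h k : ccontinuous (fun p : R => cexp ('i%C * (lam * (cc k / ss k) * ((x + p *: z) 0 k) ^+ 2)%:C)).
    apply: (@ccont_comp _ (fun y => cexp ('i%C * (lam * (cc k / ss k) * y ^+ 2)%:C)) (fun p : R => (x + p *: z) 0 k)).
      exact: cch1.
    under eq_fun do rewrite !mxE.
    move=> p; apply: cvgD; first exact: cvg_cst.
    by apply: cvgM; [exact: cvg_id|exact: cvg_cst].
  have := @ccont_prod _ _ (index_enum _) xpredT (fun k p => _) h.
  by under eq_fun do rewrite -chE.
pose g x := v0 x * ch x.
have sg : sepc g := sepcM cv sch.
have bg : bdd C0 g by move=> x; rewrite /g ncM nch mulr1; exact: bv.
have lg z : ccontinuous (fun p : R => g (X + p *: z)) by exact: ccontM (lv X z) (lch X z).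
have lim1 := ccvg_nc (approx_id sg lg bg rr0 rrc).
pose E i x := cexp (\sum_k (- (lam ^+ 2 / (B i k * ss k ^+ 2) * x 0 k ^+ 2)%:C
       + 'i%C * (- (lam * (cc k / ss k) * x 0 k ^+ 2) + 2 * lam * X 0 k * x 0 k / ss k)%:C)).
(* Since B = rr^(-2), the normalization rr^(-n) exactly compensates the dependence of |A| on B; only
   |A|^2 has to be known. *)
have eq1 i : nc (((rr i)^-1 ^+ n)%:C * Ig (fun z => (gaus X (rr i) z)%:C * g z)) =
   a0 * nc (Ig (fun x => F [::] x * E i x)).
  have [hA1 hA2] := hA i.
  have -> : Ig (fun z => (gaus X (rr i) z)%:C * g z) = A i * Ig (fun x => F [::] x * E i x).
    rewrite -hA2; apply: Ig_ext => x; rewrite /g mulrCA; congr (_ * _).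
    rewrite big_split /= cexpD -/(ch x) mulrC; congr (_ * _).
    rewrite /gaus /gaus0 /sqr_enorm sumrN -rmorph_sum -rmorphN cexp_real; congr (expR _)%:C.
    congr (- _); apply: eq_bigr => k _; rewrite !mxE exprMn exprVn; congr (_ * _).
  rewrite ncM ncM mulrA; congr (_ * _).
  have hn : nc (A i) ^+ 2 = \prod_(k < n) (lam / (B i k * `|ss k|)).
    rewrite -nc_X hA1 nc_prod; apply: eq_bigr => k _.
    rewrite ncM nc_i mul1r nc_real normrM normfV normrM !(gtr0_norm lam0).
    by rewrite (gtr0_norm (B0 i k)).
  have hs : (nc (((rr i)^-1 ^+ n)%:C) * nc (A i)) ^+ 2 = a0 ^+ 2.
    rewrite exprMn hn nc_real ger0_norm ?exprn_ge0 ?invr_ge0 ?(ltW (rr0 i))//.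
    rewrite -exprM mulnC exprM -[n in X in X * _]card_ord -prodr_const -big_split /=.
    rewrite /a0 -prodrXl; apply: eq_bigr => k _.
    rewrite sqr_sqrtr ?divr_ge0 ?(ltW lam0)// /B exprVn; field.
    by rewrite normr_eq0 s0 gt_eqF.
  apply: (@pexpIrn _ 2) => //; rewrite ?nnegrE//.
    by rewrite mulr_ge0// nc_ge0.
  by apply: prodr_ge0 => k _; exact: sqrtr_ge0.
pose e' k (y : R) : R[i] := cexp ('i%C * (- (lam * (cc k / ss k) * y ^+ 2) + 2 * lam * X 0 k * y / ss k)%:C).
pose Einf x := \prod_k e' k (x 0 k).
have de'0 k y : cder (e' k) y ('i%C * (- (2 * (lam * (cc k / ss k)) * y) + 2 * lam * X 0 k / ss k)%:C * e' k y).
  have d := is_derive_add (is_derive_opp (is_derive_sqr y (lam * (cc k / ss k))))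
     (is_derive_mul (is_derive_cst (2 * lam * X 0 k / ss k) y (1 : R)) (is_derive_id y (1 : R))).
  have d' : is_derive y (1 : R) (fun y => - (lam * (cc k / ss k) * y ^+ 2) + 2 * lam * X 0 k * y / ss k)
      (- (2 * (lam * (cc k / ss k)) * y) + 2 * lam * X 0 k / ss k).
    apply: is_derive_ext (is_derive_val d _) => [s|]; first by rewrite /cst; ring.
    by rewrite /cst mulr1 mul0r addr0.
  exact: cder_cexp (cderZ 'i%C (cder_real d')).
have ce' k : ccontinuous (e' k) := cder_continuous (de'0 k).
have be' k y : nc (e' k y) <= 1 by rewrite nc_chirp.
have ee' k : exists e : R -> R[i], (forall y, cder e y (e' k y)) /\ (forall y, nc (e y) <= 4 * (Num.sqrt `|- (lam * (cc k / ss k))|)^-1).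
  have r0 : - (lam * (cc k / ss k)) != 0.
    by rewrite oppr_eq0 !mulf_neq0 ?invr_eq0// gt_eqF.
  (* Completing the square in the phase: the chirp is centred at X_k / cc_k, up to the constant
     unimodular factor [ct]. *)
  have [f [f1 f2]] := fresnel (X 0 k / cc k) r0.
  pose ct := cexp ('i%C * (lam * X 0 k ^+ 2 / (cc k * ss k))%:C).
  exists (fun y => ct * f y); split => y; last by rewrite ncM nc_chirp mul1r.
  have := cderZ ct (f1 y); move/cder_val; apply.
  rewrite /ct /e' -cexpD -mulrDr -rmorphD; congr (cexp (_ * _%:C)).
  by field; rewrite s0 c0.
have /choice[e he] := ee'.
pose eps k := 4 * (Num.sqrt `|- (lam * (cc k / ss k))|)^-1.
have bnd : nc (Ig (fun x => F [::] x * Einf x)) <= kap ^+ n * (C1 * \prod_k eps k).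
  apply: (chirp_bound cF (e := e)) => // [k y|k y].
    by have [+ _] := he k; apply.
  by have [_] := he k; apply.
have E_ i x : E i x = Einf x * (\prod_k expR (- (lam ^+ 2 / (B i k * ss k ^+ 2) * x 0 k ^+ 2)))%:C.
  rewrite /E big_split /= cexpD mulrC; congr (_ * _).
    by rewrite cexp_sum.
  rewrite cexp_sum rmorph_prod; apply: eq_bigr => k _.
  by rewrite -rmorphN cexp_real.
have nE i x : nc (E i x) <= 1.
  rewrite E_ ncM nc_real ger0_norm; last by apply: prodr_ge0 => k _; exact: expR_ge0.
  apply: mulr_ile1; rewrite ?nc_ge0//.
  - by apply: prodr_ge0 => k _; exact: expR_ge0.
  - by rewrite nc_prod prodr_ile1// => k _; rewrite nc_ge0 be'.
  - apply: prodr_ile1 => k _; rewrite expR_ge0 /= -expR0 ler_expR oppr_le0.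
    by rewrite mulr_ge0 ?sqr_ge0// divr_ge0 ?sqr_ge0// mulr_ge0 ?sqr_ge0// ltW.
have [CF dF0] := chain_dom cF [::].
have sF := chain_sepc [::] cF.
have sE0 : sepc Einf.
  have h k : sepc (fun x => e' k (x 0 k)) by exact: sepc_coord.
  exact: (sepc_prod (index_enum _) xpredT h).
have lim2 : ccvg (fun i => Ig (fun x => F [::] x * E i x)) (Ig (fun x => F [::] x * Einf x)).
  apply: (@Ig_cvg _ _ _ _ (CF * 1)).
  - move=> i; apply: sepcM => //.
    rewrite (_ : E i = fun x => Einf x * \prod_k (expR (- (lam ^+ 2 / (B i k * ss k ^+ 2) * x 0 k ^+ 2)))%:C); last first.
      by apply/funext => x; rewrite E_ rmorph_prod.
    apply: sepcM => //.
    have h k : sepc (fun x => (expR (- (lam ^+ 2 / (B i k * ss k ^+ 2) * x 0 k ^+ 2)))%:C).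
      have ce : ccontinuous (fun y : R => (expR (- (lam ^+ 2 / (B i k * ss k ^+ 2) * y ^+ 2)))%:C).
        apply: ccont_real => y.
        exact: is_derive_cont (is_derive_comp (is_derive_expR _) (is_derive_opp (is_derive_sqr y (lam ^+ 2 / (B i k * ss k ^+ 2))))).
      exact: (sepc_coord k ce).
    exact: (sepc_prod (index_enum _) xpredT h).
  - exact: sepcM.
  - by move=> i; apply: dom_bddM dF0 (nE i).
  - move=> z; apply: ccvgM; first exact: ccvg_cst.
    rewrite -[Einf z]mulr1; under eq_fun do rewrite E_.
    apply: ccvgM; first exact: ccvg_cst.
    pose h (p : R) : R := \prod_k expR (- (lam ^+ 2 / ss k ^+ 2 * z 0 k ^+ 2 * p ^+ 2)).
    have ch' : ccontinuous (fun p => (h p)%:C).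
      have hk k : ccontinuous (fun p : R => (expR (- (lam ^+ 2 / ss k ^+ 2 * z 0 k ^+ 2 * p ^+ 2)))%:C).
        apply: ccont_real => p.
        exact: is_derive_cont (is_derive_comp (is_derive_expR _) (is_derive_opp (is_derive_sqr p _))).
      have := @ccont_prod _ _ (index_enum _) xpredT (fun k p => _) hk.
      by under eq_fun do rewrite -rmorph_prod.
    have h1 : h 0 = 1.
      by rewrite /h big1// => k _; rewrite expr0n /= mulr0 oppr0 expR0.
    have eqf i : \prod_k expR (- (lam ^+ 2 / (B i k * ss k ^+ 2) * z 0 k ^+ 2)) = h (rr i).
      apply: eq_bigr => k _; congr (expR (- _)); rewrite /B; field.
      by rewrite s0 gt_eqF.
    have := ccont_seq ch' rrc; rewrite h1.
    by under eq_fun do rewrite -eqf.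
have eqlim : nc (@gmass R n * g X) = a0 * nc (Ig (fun x => F [::] x * Einf x)).
  have lim3 : nc (((rr i)^-1 ^+ n)%:C * Ig (fun z => (gaus X (rr i) z)%:C * g z)) @[i --> \oo]
      --> a0 * nc (Ig (fun x => F [::] x * Einf x)).
    under eq_fun do rewrite eq1.
    by apply: cvgM; [exact: cvg_cst|exact: ccvg_nc].
  exact: (cvg_unique (@Rhausdorff R) lim1 lim3).
have gm : 0 < nc (@gmass R n) by rewrite nc_gt0 gmass_neq0.
rewrite ler_pdivlMl//.
have <- : nc (@gmass R n * g X) = nc (@gmass R n) * nc (v0 X) by rewrite ncM /g ncM nch mulr1.
rewrite eqlim.
have a00 : 0 <= a0 by apply: prodr_ge0 => k _; exact: sqrtr_ge0.
apply: le_trans (ler_wpM2l a00 bnd) _.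
rewrite [leLHS]mulrCA ler_wpM2l ?exprn_ge0 ?kap_ge0// [leLHS]mulrCA [leRHS]mulrC ler_wpM2l//.
  have [C h] := chain_dom cF [::].
  by apply: le_trans (nc_ge0 _) (dF 0).
rewrite /a0 -big_split /= -[n in leRHS]card_ord -prodr_const; apply: ler_prod => k _.
rewrite /eps mulr_ge0 ?sqrtr_ge0 ?mulr_ge0 ?invr_ge0 ?sqrtr_ge0//=.
rewrite mulrCA -sqrtrV ?normr_ge0// -sqrtrM ?divr_ge0 ?(ltW lam0)//.
rewrite normrN normrM (gtr0_norm lam0) normrM normfV.
(* The powers of [ss k] cancel here, which makes the bound uniform for short times. What remains per
   coordinate is 4 |cc|^(-1/2), at most 8 because |cc| >= 1/2. *)
have -> : lam / `|ss k| * (lam * (`|cc k| / `|ss k|))^-1 = `|cc k|^-1.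
  by field; rewrite !normr_eq0 s0 c0 gt_eqF.
have h : Num.sqrt `|cc k|^-1 <= 2.
  apply: (@le_trans _ _ (Num.sqrt (2 ^+ 2))); last by rewrite sqrtr_sqr ger0_norm.
  have ck : 0 < `|cc k| by rewrite normr_gt0.
  apply: ler_wsqrtr; rewrite invf_ple ?posrE ?exprn_gt0//; apply: le_trans (c2 k).
  by rewrite lef_pV2 ?posrE ?exprn_gt0// expr2; lra.
lra.
Qed.

End KernelBound.

(** * A Baire category argument for local boundedness in time *)

Section BaireBounded.
Context {R : realType}.
Local Open Scope classical_set_scope.
Implicit Types (s t r e : R).

(** [b D r] is read as: the bound D holds at time r. *)
Definition bdon (b : R -> R -> Prop) s t := exists D, forall r, s <= r <= t -> b D r.

(** Let a be the supremum of the times up to which some bound holds from s on. Before a the constant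
    [C] given by the level of s works, whatever bound was used to apply the hypothesis, and time a
    has a bound of its own; so boundedness extends to a. If a < e, a bound around a would push the
    supremum further. *)
Lemma reach_right (b : R -> R -> Prop) (A : nat -> R -> Prop) (d0 : R) :
  (forall C C' t, C <= C' -> b C t -> b C' t) -> (forall t, exists C, b C t) ->
  (forall t, exists k, A k t) ->
  (forall k, exists C, forall s t, s <= t -> t < s + d0 -> bdon b s t -> A k s -> b C t) ->
  forall s e, s <= e -> e < s + d0 ->
  exists a, [/\ s <= a <= e, bdon b s a & a = e \/ (forall eps, 0 < eps -> ~ bdon b (a - eps) (a + eps))].
Proof.
move=> bm bex Aex P s e se ed.
have [k Ak] := Aex s; have [C hC] := P k.
pose S := [set r | s <= r <= e /\ bdon b s r].
have Ss : S s.
  split; first by rewrite lexx.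
  have [D bD] := bex s; exists D => r; rewrite -eq_le => /eqP <- //.
have Sub : has_ubound S by exists e => r [/andP[]].
have supS : has_sup S by split => //; exists s.
pose a := sup S.
have sa : s <= a by exact: ub_le_sup.
have ae : a <= e by apply: ge_sup; [exists s|move=> r [/andP[]]].
have bC r : s <= r -> r < a -> b C r.
  move=> sr ra; have ar0 : 0 < a - r by rewrite subr_gt0.
  have [r' [/andP[sr' r'e] [D hD]]] := sup_adherent ar0 supS.
  rewrite opprB addrCA subrr addr0 => rr'.
  apply: (hC s) => //; first by apply: le_lt_trans ed; exact: le_trans (ltW rr') r'e.
  by exists D => z /andP[sz zr]; apply: hD; rewrite sz (le_trans zr (ltW rr')).
have Bda : bdon b s a.
  have [D hD] := bex a; exists (Num.max C D) => r /andP[sr].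
  rewrite le_eqVlt => /predU1P[->|ra].
    by apply: bm hD; rewrite le_max lexx orbT.
  by apply: bm (bC r sr ra); rewrite le_max lexx.
exists a; split=> //; first by rewrite sa.
move: ae; rewrite le_eqVlt => /predU1P[->|ae]; first by left.
right => eps eps0 [D hD]; have [D' hD'] := Bda.
pose m := Num.min (a + eps) e.
have am : a < m by rewrite lt_min ltrDl eps0.
have : S m.
  split; first by rewrite (le_trans sa (ltW am)) ge_min lexx orbT.
  exists (Num.max D D') => r /andP[sr rm].
  have [ra|ar] := leP r a.
    by apply: bm (hD' r _); rewrite ?le_max ?lexx ?orbT// sr.
  apply: bm (hD r _); rewrite ?le_max ?lexx//; apply/andP; split; first by lra.
  by apply: le_trans rm _; rewrite ge_min lexx.
by move=> /(ub_le_sup Sub); rewrite leNgt am.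
Qed.

(** [reach_right] under time reversal. *)
Lemma reach_left (b : R -> R -> Prop) (A : nat -> R -> Prop) (d0 : R) :
  (forall C C' t, C <= C' -> b C t -> b C' t) -> (forall t, exists C, b C t) ->
  (forall t, exists k, A k t) ->
  (forall k, exists C, forall s t, t <= s -> s - d0 < t -> bdon b t s -> A k s -> b C t) ->
  forall s e, e <= s -> s - d0 < e ->
  exists a, [/\ e <= a <= s, bdon b a s & a = e \/ (forall eps, 0 < eps -> ~ bdon b (a - eps) (a + eps))].
Proof.
move=> bm bex Aex P s e es ed.
have flip t1 t2 : bdon (fun C t => b C (- t)) t1 t2 <-> bdon b (- t2) (- t1).
  split=> [] [D hD]; exists D => r /andP[r1 r2].
    by rewrite -(opprK r); apply: hD; rewrite lerNr r2 lerNl r1.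
  by apply: hD; rewrite !lerN2 r1 r2.
have [||||||a [h1 h2 h3]] := @reach_right (fun C t => b C (- t)) (fun k t => A k (- t)) d0 _ _ _ _ (- s) (- e).
- by move=> C C' t; exact: bm.
- by move=> t; exact: bex.
- by move=> t; exact: Aex.
- move=> k; have [C hC] := P k; exists C => s' t' st' ts' /flip hb hA.
  by apply: (hC (- s')); rewrite ?lerN2//; lra.
- by rewrite lerN2.
- lra.
exists (- a); split.
- by move: h1 => /andP[p1 p2]; apply/andP; split; lra.
- by move/flip: h2; rewrite opprK.
case: h3 => [->|h3]; first by left; rewrite opprK.
right => eps eps0 hb; apply: (h3 _ eps0); apply/flip.
by rewrite opprD (_ : - (a - eps) = - a + eps)//; ring.
Qed.

(** Baire's theorem on the set of bad times, those with no bounded neighbourhood: if it were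
    nonempty, nested intervals around bad times would avoid A 0, A 1, ... in turn, and their common
    point would lie in no [A k]. *)
Theorem baire_bounded (b : R -> R -> Prop) (A : nat -> R -> Prop) (d0 : R) : 0 < d0 ->
  (forall C C' t, C <= C' -> b C t -> b C' t) -> (forall t, exists C, b C t) ->
  (forall t, exists k, A k t) -> (forall k, closed [set t | A k t]) ->
  (forall k, exists C, forall s t, `|t - s| < d0 -> bdon b (Num.min s t) (Num.max s t) -> A k s -> b C t) ->
  forall t1 t2, bdon b t1 t2.
Proof.
move=> d0_gt0 bm bex Aex Acl P.
have Pr k : exists C, forall s t, s <= t -> t < s + d0 -> bdon b s t -> A k s -> b C t.
  have [C hC] := P k; exists C => s t st ts hb; apply: hC.
    by rewrite ger0_norm ?subr_ge0// ltrBlDl.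
  by rewrite (min_idPl st) (max_idPr st).
have Pl k : exists C, forall s t, t <= s -> s - d0 < t -> bdon b t s -> A k s -> b C t.
  have [C hC] := P k; exists C => s t st ts hb; apply: hC.
    by rewrite ler0_norm ?subr_le0// opprB; lra.
  by rewrite (min_idPr st) (max_idPl st).
have KR := reach_right bm bex Aex Pr; have KL := reach_left bm bex Aex Pl.
pose bad e := forall eps, 0 < eps -> ~ bdon b (e - eps) (e + eps).
have nobad eb : ~ bad eb.
  move=> bade.
  (* Otherwise all bad times near e have level k. Each time near e is joined to such a bad time by
     an interval on which a bound holds, so the constant of level k bounds it; e would not be
     bad. *)
  have step k e eta : bad e -> 0 < eta -> exists e', [/\ bad e', `|e' - e| < eta & ~ A k e'].
    move=> be eta0; apply: contrapT => hn.
    have allA e' : bad e' -> `|e' - e| < eta -> A k e'.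
      by move=> h1 h2; apply: contrapT => h3; apply: hn; exists e'.
    have [C1 hC1] := Pr k; have [C2 hC2] := Pl k.
    pose et := Num.min eta d0 / 2.
    have et0 : 0 < et by rewrite divr_gt0// lt_min eta0.
    have [et1 et2] : et < eta /\ et < d0.
      have h1 : Num.min eta d0 <= eta by rewrite ge_min lexx.
      have h2 : Num.min eta d0 <= d0 by rewrite ge_min lexx orbT.
      have h3 : 0 < Num.min eta d0 by rewrite lt_min eta0.
      by rewrite /et; split; lra.
    apply: (be et et0); exists (Num.max C1 C2) => s /andP[s1 s2].
    have [se|/ltW es] := leP s e.
      have [|a [/andP[sa ae] ba ha]] := KR s e se; first by lra.
      have bada : bad a by case: ha => [->|].
      apply: bm (hC2 a s sa _ ba (allA a bada _)); rewrite ?le_max ?lexx ?orbT//; first by lra.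
      by rewrite ler0_norm ?subr_le0// opprB; lra.
    have [|a [/andP[ea as_] ba ha]] := KL s e es; first by lra.
    have bada : bad a by case: ha => [->|].
    apply: bm (hC1 a s as_ _ ba (allA a bada _)); rewrite ?le_max ?lexx//; first by lra.
    by rewrite ger0_norm ?subr_ge0//; lra.
  have step2 (k : nat) (p : R * R) : exists p' : R * R, bad p.1 -> 0 < p.2 ->
     [/\ bad p'.1, 0 < p'.2, p.1 - p.2 <= p'.1 - p'.2, p'.1 + p'.2 <= p.1 + p.2 &
        forall t, `|t - p'.1| <= p'.2 -> ~ A k t].
    have [bp|] := pselect (bad p.1); last by exists p.
    have [p0|] := ltP 0 p.2; last by move=> h; exists p => _; rewrite ltNge h.
    have [e' [be' de' nA]] := step k p.1 p.2 bp p0.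
    have : open (~` [set t | A k t]) by apply: closed_openC; exact: Acl.
    move=> /(_ e' nA) /nbhs_ballP[r /= r0 hr].
    (* The first term keeps the closed interval off [A k], the second keeps it inside the previous
       interval. *)
    pose et := Num.min (r / 2) (p.2 - `|e' - p.1|).
    have et0 : 0 < et by rewrite lt_min divr_gt0// subr_gt0.
    have h1 : et <= r / 2 by rewrite ge_min lexx.
    have h2 : et <= p.2 - `|e' - p.1| by rewrite ge_min lexx orbT.
    exists (e', et) => _ _; split => //=.
    - by have := ler_norm (- (e' - p.1)); rewrite normrN; lra.
    - by have := ler_norm (e' - p.1); lra.
    - move=> t ht; apply: (hr t); rewrite -ball_normE /= distrC.
      by apply: le_lt_trans ht _; lra.
  have /choice[f hf] := fun kp : nat * (R * R) => step2 kp.1 kp.2.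
  pose sq := fix sq i := if i is j.+1 then f (j, sq j) else (eb, 1 : R).
  have inv i : bad (sq i).1 /\ 0 < (sq i).2.
    elim: i => [|i [h1 h2]] /=; first by split.
    by have [] := hf (i, sq i) h1 h2.
  have nest i := hf (i, sq i) (inv i).1 (inv i).2.
  have lmono i j : (i <= j)%N -> (sq i).1 - (sq i).2 <= (sq j).1 - (sq j).2 /\
       (sq j).1 + (sq j).2 <= (sq i).1 + (sq i).2.
    elim: j => [|j IH]; first by rewrite leqn0 => /eqP ->.
    rewrite leq_eqVlt => /predU1P[->//|]; rewrite ltnS => /IH[h1 h2].
    by have [_ _ h3 h4 _] := nest j; split; [apply: le_trans h1 h3|apply: le_trans h4 h2].
  (* The supremum of the left endpoints belongs to all the intervals. *)
  pose L := [set x | exists i, x = (sq i).1 - (sq i).2].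
  have Lub i : ubound L ((sq i).1 + (sq i).2).
    move=> x [j ->]; have [_ p1] := inv i; have [_ p2] := inv j.
    have [ij|/ltnW ji] := leqP i j.
      by have [_ h] := lmono i j ij; lra.
    by have [h _] := lmono j i ji; lra.
  have L0 : L !=set0 by exists ((sq 0%N).1 - (sq 0%N).2); exists 0%N.
  have [k Ak] := Aex (sup L).
  have [_ _ _ _ h] := nest k; apply: (h (sup L)) Ak.
  have h1 : (sq k.+1).1 - (sq k.+1).2 <= sup L.
    by apply: ub_le_sup; [exists ((sq k).1 + (sq k).2); exact: Lub|exists k.+1].
  have h2 : sup L <= (sq k.+1).1 + (sq k.+1).2 by apply: ge_sup L0 (Lub k.+1).
  by rewrite ler_norml; apply/andP; split; move: h1 h2 => /=; lra.
have short s : bdon b s (s + d0 / 2).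
  have [||a [ha ba [<-//|/nobad//]]] := KR s (s + d0 / 2); lra.
have long s (N : nat) : bdon b s (s + N%:R * (d0 / 2)).
  elim: N => [|N [D hD]].
    have [D hD] := bex s; exists D => r; rewrite mul0r addr0 -eq_le => /eqP <- //.
  have [D' hD'] := short (s + N%:R * (d0 / 2)).
  exists (Num.max D D') => r /andP[r1 r2].
  have [r3|/ltW r3] := leP r (s + N%:R * (d0 / 2)).
    by apply: bm (hD r _); rewrite ?le_max ?lexx// r1.
  apply: bm (hD' r _); rewrite ?le_max ?lexx ?orbT// r3 /=.
  by apply: le_trans r2 _; rewrite -natr1 mulrDl mul1r addrA.
move=> t1 t2; pose N := Num.truncn ((t2 - t1) / (d0 / 2)).
have [D hD] := long t1 N.+1; exists D => r /andP[r1 r2]; apply: hD; rewrite r1 /=.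
have : (t2 - t1) / (d0 / 2) < N.+1%:R.
  have [h|h] := leP 0 ((t2 - t1) / (d0 / 2)).
    by have /andP[] := truncn_itv h.
  by apply: lt_trans h _; rewrite ltr0n.
by rewrite ltr_pdivrMr ?divr_gt0//; lra.
Qed.

End BaireBounded.

(** * The identity between Gaussian pairings at two times *)

Section Transfer.
Context {R : realType} {n : nat}.
Local Open Scope classical_set_scope.
Variables (lam : R) (q : 'I_n -> R).
Hypothesis lam0 : 0 < lam.
Hypothesis n_gt0 : (0 < n)%N.
Implicit Types (x : 'rV[R]_n) (j k : 'I_n) (s t : R).
Variables (Cs Ss : 'I_n -> R -> R).
Hypothesis dCs : forall k t, is_derive t (1 : R) (Cs k) (- q k * Ss k t).
Hypothesis dSs : forall k t, is_derive t (1 : R) (Ss k) (Cs k t).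
Hypothesis Cs0 : forall k, Cs k 0 = 1.
Hypothesis Ss0 : forall k, Ss k 0 = 0.
Variables (u : R -> 'rV[R]_n -> R[i]) (d1 d2 : 'I_n -> R -> 'rV[R]_n -> R[i]).
Hypothesis nu : forall t, nice (u t) (fun j => d1 j t) (fun j => d2 j t).
Hypothesis du : forall x t, cder (u ^~ x) t (Lop lam q (u t) (fun j => d2 j t) x).

Lemma La_exists (r B : 'I_n -> R) : (forall k, 0 < B k) ->
  exists La : 'I_n -> R -> R[i],
    (forall k t, cder (La k) t (pp' lam q Cs Ss r B k t / pp lam Cs Ss r B k t)) /\
    (forall k, La k 0 = 0).
Proof.
move=> B0.
have ex k : exists F : R -> R[i], (forall t, cder F t (pp' lam q Cs Ss r B k t / pp lam Cs Ss r B k t)) /\ F 0 = 0.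
  have dP t := cderM (cder_pp' lam dCs dSs r B k t)
    (cder_inv (pp_neq0 lam0 dCs dSs Cs0 Ss0 r B0 k) (cder_pp lam dCs dSs r B k t)).
  have [F dF] := cprimitive (cder_continuous dP).
  exists (fun t => F t - F 0); split=> [t|]; last by rewrite subrr.
  by have := cderB (dF t) (cder_cst (F 0) t); rewrite subr0.
have /choice[La hLa] := ex; exists La.
by split=> k; have [] := hLa k.
Qed.

(** A = exp(- sum_k La_k / 2) and exp(La_k) = pp_k = - i B_k Ss_k / lam at the final time. Recording
    the square of A avoids naming a branch of the root. The same A serves u and Lop u, since both
    are paired with one Gaussian family. *)
Lemma transfer (s t : R) (X : 'rV[R]_n) (B : 'I_n -> R) (r := fun k => Cs k (t - s) / Ss k (t - s)) :
  bdon (fun C t => forall x, nc (u t x) <= C /\ nc (Lop lam q (u t) (fun j => d2 j t) x) <= C)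
    (Num.min s t) (Num.max s t) ->
  (forall k, Ss k (t - s) != 0) -> (forall k, 0 < B k) ->
  exists A : R[i],
  [/\ A ^+ 2 = \prod_k ('i%C * (lam / (B k * Ss k (t - s)))%:C),
    Ig (fun x => u s x * E0 lam r B X x) = A * Ig (fun x => u t x * E1 lam Ss r B X (t - s) x) &
    Ig (fun x => Lop lam q (u s) (fun j => d2 j s) x * E0 lam r B X x) =
    A * Ig (fun x => Lop lam q (u t) (fun j => d2 j t) x * E1 lam Ss r B X (t - s) x)].
Proof.
move=> [D hD] S0 B0.
have hu : ubd lam q u d2 D (Num.min s t) (Num.max s t).
  by move=> z x zI; exact: hD.
have [La [dLa La0]] := La_exists r B0.
pose A := cexp (\sum_k - (2^-1 * La k (t - s))).
have gf := Gfam_shift (- s) (Gfam_explicit lam0 dCs dSs Cs0 Ss0 X B0 dLa).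
set al := (fun k t => alx lam q Cs Ss r B k (t + - s)) in gf.
set be := (fun k t => bex lam Cs Ss r B X k (t + - s)) in gf.
set ga := (fun k t => gax lam Cs Ss r B X La k (t + - s)) in gf.
have st : Num.min s t <= Num.max s t by rewrite ge_min le_max lexx.
have sI : Num.min s t <= s <= Num.max s t by rewrite ge_min le_max !lexx.
have tI : Num.min s t <= t <= Num.max s t by rewrite ge_min le_max !lexx !orbT.
have g0 : gph (at_ al s) (at_ be s) (at_ ga s) = E0 lam r B X.
  rewrite -(gph_at0 q lam0 Cs0 Ss0 r B X La0) /al /be /ga /at_ /=.
  by under eq_fun do rewrite subrr; under [X in gph _ X _]eq_fun do rewrite subrr;
     under [X in gph _ _ X]eq_fun do rewrite subrr.
have g1 : gph (at_ al t) (at_ be t) (at_ ga t) = fun x => A * E1 lam Ss r B X (t - s) x.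
  exact: (gph_at_tau lam0 dCs dSs Cs0 Ss0 X B0 La S0 (fun k => erefl)).
have pull (v : 'rV[R]_n -> R[i]) : sepc v -> bdd D v ->
    Ig (fun x => v x * gph (at_ al t) (at_ be t) (at_ ga t) x) =
    A * Ig (fun x => v x * E1 lam Ss r B X (t - s) x).
  move=> sv bv; have [c [M [c0 hM]]] := Gfam_bound gf st.
  have [N N0 hN] := @gph_bound R n c M c0; have {}hN := hN _ _ _ (hM t tI).
  have dg : dom (D * N) (fun x => v x * gph (at_ al t) (at_ be t) (at_ ga t) x).
    apply: dom_gph => // x; apply: le_trans (bv x) _.
    by rewrite ler_peMr ?W2_ge1//; exact: le_trans (nc_ge0 _) (bv 0).
  have sg := sepcM sv (sepc_gph (at_ al t) (at_ be t) (at_ ga t)).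
  have An : A != 0 by exact: cexp_neq0.
  rewrite -[LHS](mulVKf An) -(IgZ A^-1 sg dg); congr (A * Ig _).
  by apply/funext => x; rewrite g1 mulrCA (mulKf An).
exists A; split.
- rewrite /A expr2 -cexpD -big_split /= cexp_sum; apply: eq_bigr => k _.
  have -> : - (2^-1 * La k (t - s)) + - (2^-1 * La k (t - s)) = - La k (t - s) by field.
  rewrite cexpN (cexp_La lam0 dCs dSs Cs0 Ss0 B0 dLa La0).
  rewrite /pp /r mulfVK// subrr rmorph0 sub0r invrN.
  have iC := @i_neq0 R.
  have iV := @invr_i R.
  rewrite invfM iV mulNr opprK -fmorphV; congr (_ * _%:C).
  by field; rewrite S0 !gt_eqF.
- have := pairing_const lam0 nu du n_gt0 gf st hu sI tI.
  rewrite /pairing g0 => ->; apply: pull; first exact: nice_sepc (nu t).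
  by move=> x; have [] := hD t tI x.
- have := pairing_Lop_const lam0 nu du n_gt0 gf st hu sI tI.
  rewrite g0 => ->; apply: pull; first exact: sepc_Lu.
  by move=> x; have [] := hD t tI x.
Qed.

End Transfer.

(** * Difference quotients and rapidly decreasing families *)

Section FiniteDifferences.
Context {R : realType} {n : nat}.
Local Open Scope classical_set_scope.
Implicit Types (x : 'rV[R]_n) (j k : 'I_n) (F : seq 'I_n -> 'rV[R]_n -> R[i]).

Definition pch F := forall s j x, pder j (F s) x (F (j :: s) x).

Definition del j (h : R) (g : 'rV[R]_n -> R[i]) x : R[i] := g (upd x j (x 0 j + h)) - g x.
Fixpoint delL (l : seq ('I_n * R)) (g : 'rV[R]_n -> R[i]) : 'rV[R]_n -> R[i] :=
  if l is p :: l' then delL l' (del p.1 p.2 g) else g.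

Lemma pder_shift i j (h : R) (g g' : 'rV[R]_n -> R[i]) :
  (forall x, pder i g x (g' x)) ->
  forall x, pder i (fun z => g (upd z j (z 0 j + h))) x (g' (upd x j (x 0 j + h))).
Proof.
move=> dg x; rewrite /pder; have [ij|ij] := eqVneq i j.
  rewrite ij (_ : (fun y => _) = fun y => g (upd x j (y + h))); last first.
    by apply/funext => y; rewrite upd_upd upd_same.
  have dh : is_derive (x 0 j) (1 : R) (fun y => y + h) 1.
    have := is_derive_add (is_derive_id (x 0 j) (1 : R)) (is_derive_cst h (x 0 j) (1 : R)).
    by move/is_derive_val; apply; rewrite addr0.
  have := @cder_comp _ (fun y => g (upd x j y)) (fun y => y + h) (x 0 j) _ _ _ dh.
  rewrite ij in dg; move=> /(_ _ (pder_line dg x (x 0 j + h))).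
  by move/cder_val; apply; rewrite rmorph1 mul1r.
rewrite (_ : (fun y => _) = fun y => g (upd (upd x j (x 0 j + h)) i y)); last first.
  apply/funext => y; rewrite updE eq_sym (negbTE ij) upd_comm//.
have := dg (upd x j (x 0 j + h)); by rewrite /pder updE (negbTE ij).
Qed.

Lemma pch_del j h F : pch F -> pch (fun s => del j h (F s)).
Proof.
by move=> pF s i x; apply: cderB; [exact: (pder_shift j h (pF s i))|exact: pF].
Qed.

Lemma pchZ (c : R[i]) F : pch F -> pch (fun s x => c * F s x).
Proof. by move=> pF s i x; apply: cderZ; exact: pF. Qed.

Lemma Wt_shift x j (th : R) : 0 <= th <= 1 -> Wt x <= 3 * Wt (upd x j (x 0 j + th)).
Proof.
move=> /andP[t0 t1]; rewrite (Wt_split j) (Wt_split j (upd _ _ _)) Wsub_upd; last first.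
  by rewrite mem_rem_uniqF ?enum_uniq.
rewrite mulrA ler_wpM2r ?(ltW (Wsub_gt0 _ _))// /wj upd_same /oneDsqr.
have := sqr_ge0 (x 0 j + th); have := sqr_ge0 (x 0 j + 2 * th); nra.
Qed.

Definition hok (l : seq ('I_n * R)) := all (fun p => (0 < p.2) && (p.2 <= 1)) l.

(** Mean value estimate along coordinate [j]. The weight varies by a factor at most 3 over a step of
    length at most 1, which accounts for the constant together with a spare factor 2. *)
Lemma del_bound (K : R) j h (g g' : 'rV[R]_n -> R[i]) : 0 < h <= 1 ->
  (forall x, pder j g x (g' x)) -> (forall x, Wt x * nc (g' x) <= K) ->
  forall x, Wt x * nc (del j h g x) <= 6 * K * h.
Proof.
move=> /andP[h0 h1] dg bg x.
have K0 : 0 <= K.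
  by apply: le_trans (bg x); rewrite mulr_ge0 ?nc_ge0// ltW// Wt_gt0.
have dl := pder_line dg x.
have le : x 0 j <= x 0 j + h by rewrite lerDl ltW.
pose D := 3 * K / Wt x.
have bd t : x 0 j <= t <= x 0 j + h -> nc (g' (upd x j t)) <= D.
  move=> /andP[t1 t2].
  have th : 0 <= t - x 0 j <= 1 by apply/andP; split; lra.
  have w := Wt_shift x j th; rewrite addrC subrK in w.
  rewrite /D ler_pdivlMr ?Wt_gt0// mulrC.
  apply: (@le_trans _ _ (3 * Wt (upd x j t) * nc (g' (upd x j t)))).
    by rewrite ler_wpM2r ?nc_ge0.
  by rewrite -mulrA ler_wpM2l.
have dD t : is_derive t (1 : R) (fun y => D * y) D.
  have := is_derive_mul (is_derive_cst D t (1 : R)) (is_derive_id t (1 : R)).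
  by move/is_derive_val; apply; rewrite mul0r addr0 mulr1.
have := cder_compare le (fun t _ => dl t) (fun t _ => dD t) bd.
rewrite upd_id -/(del j h g x) -mulrBr [_ + h]addrC addrK => hh.
have hh2 : nc (del j h g x) <= 2 * (D * h) by have := nc_ge0 (del j h g x); lra.
apply: le_trans (ler_wpM2l (ltW (Wt_gt0 x)) hh2) _.
rewrite /D le_eqVlt; apply/orP; left; apply/eqP; field.
by rewrite gt_eqF// Wt_gt0.
Qed.

Lemma delL_bound (l : seq ('I_n * R)) F (K : R) : pch F -> hok l ->
  (forall x, Wt x * nc (F (map fst l) x) <= K) ->
  forall x, Wt x * nc (delL l (F [::]) x) <= 6 ^+ size l * K * \prod_(p <- l) p.2.
Proof.
elim: l F K => [|[j h] l IH] F K pF /=; first by move=> _ bF x; rewrite big_nil mulr1 mul1r.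
move=> /andP[h01 hl] bF x; rewrite big_cons /=.
have := IH _ (6 * K * h) (pch_del j h pF) hl (del_bound h01 (pF (map fst l) j) bF) x.
by rewrite exprS => hh; apply: le_trans hh _; rewrite le_eqVlt; apply/orP; left; apply/eqP; ring.
Qed.

Lemma cder_quotient (f : R -> R[i]) t l : cder f t l ->
  ccvg (fun i => (i.+1%:R : R)%:C * (f (t + i.+1%:R^-1) - f t)) l.
Proof.
move=> [d1 d2]; apply/ccvgP.
have key (g : R -> R) m : is_derive t (1 : R) g m ->
    i.+1%:R * (g (t + i.+1%:R^-1) - g t) @[i --> \oo] --> m.
  move=> dg; have /= := @ex_derive _ _ _ _ _ _ _ dg; rewrite /derivable => cv.
  have {cv} := cv; rewrite -/(derive g t 1) derive_val => /cvgr_dnbhsP /(_ (fun i => i.+1%:R^-1)).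
  have -> : (fun i : nat => (i.+1%:R : R)^-1^-1 *: ((g \o shift t) ((i.+1%:R : R)^-1 *: 1) - g t)) =
     fun i => i.+1%:R * (g (t + i.+1%:R^-1) - g t).
    by apply/funext => i; rewrite invrK /= /shift /GRing.scale /= mulr1 [_ + t]addrC.
  apply; split=> [i|]; first by rewrite invr_eq0 pnatr_eq0.
  exact: cvg_harmonic.
split.
  under eq_fun do rewrite Re_wM ReD ReN; exact: (key _ _ d1).
by under eq_fun do rewrite Im_wM ImD ImN; exact: (key _ _ d2).
Qed.

Lemma delLZ (c : R[i]) l g x : delL l (fun z => c * g z) x = c * delL l g x.
Proof.
elim: l g => [//|p l IH] g /=; rewrite -IH; congr (delL l _ x).
by apply/funext => z; rewrite /del mulrBr.
Qed.

(** The steps are sent to 0 one coordinate at a time, along h = 1 / (i + 1). The constant K passes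
    to the limit unchanged, so bounds on difference quotients return bounds on derivatives. *)
Lemma delL_inv (s : seq 'I_n) F (K : R) : pch F ->
  (forall l, map fst l = s -> hok l -> forall x, Wt x * nc (delL l (F [::]) x) <= K * \prod_(p <- l) p.2) ->
  forall x, Wt x * nc (F s x) <= K.
Proof.
elim: s F => [|j s IH] F pF hF x.
  by have := hF [::] erefl erefl x; rewrite big_nil mulr1.
pose h i : R := i.+1%:R^-1.
have h0 i : 0 < h i by rewrite invr_gt0 ltr0n.
have h1 i : h i <= 1 by rewrite invf_le1 ?ltr0n// ler1n.
have b i : Wt x * nc ((i.+1%:R : R)%:C * del j (h i) (F s) x) <= K.
  apply: (IH (fun s x => (i.+1%:R : R)%:C * del j (h i) (F s) x)).
    exact: pchZ (pch_del j (h i) pF).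
  move=> l ls hl z; rewrite delLZ ncM nc_real ger0_norm ?ler0n// mulrCA.
  have := hF ((j, h i) :: l) _ _ z; rewrite /= ls h0 h1 => /(_ erefl hl).
  rewrite big_cons /= => hh; apply: le_trans (ler_wpM2l (ler0n _ _) hh) _.
  have a0 : (i.+1%:R : R) != 0 by rewrite pnatr_eq0.
  rewrite le_eqVlt; apply/orP; left; apply/eqP; rewrite /h.
  by set a := (i.+1%:R : R) in a0 *; field.
have cv := cder_quotient (pF s j x); rewrite upd_id in cv.
have := ccvgM (ccvg_cst (Wt x)%:C) cv.
have e z : Wt x * nc z = nc ((Wt x)%:C * z) by rewrite ncM nc_real ger0_norm// ltW// Wt_gt0.
by rewrite e; apply: ccvg_le => i; rewrite -e; exact: b.
Qed.

Lemma delL_cont l (g : R -> 'rV[R]_n -> R[i]) x : (forall x, ccontinuous (g ^~ x)) ->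
  ccontinuous (fun t => delL l (g t) x).
Proof.
elim: l g => [g cg|p l IH g cg] /=; first exact: cg.
apply: (IH (fun t => del p.1 p.2 (g t))) => z.
rewrite /del (_ : (fun t => _) = fun t => g t (upd z p.1 (z 0 p.1 + p.2)) + (-1) * g t z).
  by apply: ccontD => //; apply: ccontM => //; exact: ccont_cst.
by apply/funext => t; rewrite mulN1r.
Qed.

Definition schain F := pch F /\ forall s (m : nat), exists C, forall x, Wt x ^+ m * nc (F s x) <= C.

Lemma schain_chain F : schain F -> chain F.
Proof.
move=> [h1 h2]; split=> // s; have [C hC] := h2 s 1%N.
by exists C; apply/domE => x; exact: hC.
Qed.

Lemma schainZ c F : schain F -> schain (fun s x => c * F s x).
Proof.
move=> [h1 h2]; split; first exact: pchZ.
move=> s m; have [C hC] := h2 s m; exists (nc c * C) => x.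
by rewrite ncM mulrCA ler_wpM2l ?nc_ge0.
Qed.

Lemma schainD F G : schain F -> schain G -> schain (fun s x => F s x + G s x).
Proof.
move=> [f1 f2] [g1 g2]; split=> [s j x|s m]; first by apply: cderD; [exact: f1|exact: g1].
have [C hC] := f2 s m; have [D hD] := g2 s m; exists (C + D) => x.
apply: le_trans (ler_wpM2l _ (ncD _ _)) _; first by rewrite exprn_ge0// ltW// Wt_gt0.
by rewrite mulrDr lerD.
Qed.

Lemma schain0 : schain (fun _ _ => 0).
Proof.
split=> [s j x|s m]; first exact: cder_cst.
by exists 0 => x; rewrite Normc.normc0 mulr0.
Qed.

Lemma schain_sum (I : Type) (r : seq I) (F : I -> seq 'I_n -> 'rV[R]_n -> R[i]) :
  (forall i, schain (F i)) -> schain (fun s x => \sum_(i <- r) F i s x).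
Proof.
move=> sF; elim: r => [|i r IH].
  rewrite (_ : (fun s x => _) = fun _ _ => 0); first exact: schain0.
  by apply/funext => s; apply/funext => x; rewrite big_nil.
rewrite (_ : (fun s x => _) = fun s x => F i s x + \sum_(i <- r) F i s x).
  exact: schainD.
by apply/funext => s; apply/funext => x; rewrite big_cons.
Qed.

Lemma schain_shift F l : schain F -> schain (fun s => F (s ++ l)).
Proof. by move=> [h1 h2]; split=> [s j x|s m]; [exact: h1|exact: h2]. Qed.

(** The lists obtained by deleting one occurrence of [j], with multiplicity: the Leibniz terms in
    which one derivative falls on x_j. *)
Fixpoint Lrem j (s : seq 'I_n) : seq (seq 'I_n) :=
  if s is i :: s' then (if i == j then [:: s'] else [::]) ++ map (cons i) (Lrem j s') else [::].

(* Leibniz rule: mulch j F s is the s-th derivative of x_j F [::]. *)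
Definition mulch j F s x : R[i] := (x 0 j)%:C * F s x + \sum_(l <- Lrem j s) F l x.

Lemma mulch_schain j F : schain F -> schain (mulch j F).
Proof.
move=> [h1 h2]; split.
  move=> s i x.
  have dx : pder i (fun x => (x 0 j)%:C) x (i == j)%:R.
    rewrite /pder; have [->|ij] := eqVneq i j.
      by rewrite (_ : (fun y => _) = fun y : R => y%:C); [exact: cder_coordC|apply/funext => y; rewrite upd_same].
    rewrite (_ : (fun y => _) = fun _ : R => (x 0 j)%:C); first exact: cder_cst.
    by apply/funext => y; rewrite updE eq_sym (negbTE ij).
  have ds : pder i (fun x => \sum_(l <- Lrem j s) F l x) x (\sum_(l <- Lrem j s) F (i :: l) x).
    exact: (cder_sum (Lrem j s) xpredT (fun l => h1 l i x)).
  have := cderD (pderM dx (h1 s i x)) ds; move/cder_val; apply.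
  rewrite /mulch /= big_cat big_map -addrA; congr (_ + _).
  by congr (_ + _); case: eqP => _; rewrite ?big_seq1 ?big_nil ?mul1r ?mul0r.
move=> s m; have [C hC] := h2 s m.+1.
have [D hD] : exists D, forall x, Wt x ^+ m * nc (\sum_(l <- Lrem j s) F l x) <= D.
  elim: (Lrem j s) => [|l L [D hD]]; first by exists 0 => x; rewrite big_nil Normc.normc0 mulr0.
  have [E hE] := h2 l m; exists (E + D) => x; rewrite big_cons.
  apply: le_trans (ler_wpM2l _ (ncD _ _)) _; first by rewrite exprn_ge0// ltW// Wt_gt0.
  by rewrite mulrDr lerD.
exists (C + D) => x; apply: le_trans (ler_wpM2l _ (ncD _ _)) _.
  by rewrite exprn_ge0// ltW// Wt_gt0.
rewrite mulrDr lerD//; apply: le_trans (hC x); rewrite ncM nc_real mulrA ler_wpM2r ?nc_ge0//.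
by rewrite exprSr ler_wpM2l ?coord_le// exprn_ge0// ltW// Wt_gt0.
Qed.

Lemma mulch_nil j F x : mulch j F [::] x = (x 0 j)%:C * F [::] x.
Proof. by rewrite /mulch /= big_nil addr0. Qed.

Lemma line_is_derive (f : 'rV[R]_n -> R) x j :
  derivable (f : _ -> R^o) x (basis_vec j) ->
  is_derive (x 0 j) (1 : R) (fun y => f (upd x j y)) ('D_(basis_vec j) (f : _ -> R^o) x).
Proof.
have e : (fun h : R => h^-1 *: (((fun y : R => f (upd x j y)) \o shift (x 0 j)) (h *: (1 : R)) - f (upd x j (x 0 j)))) =
   (fun h : R => h^-1 *: ((f \o shift x) (h *: basis_vec j) - f x)).
  apply/funext => h; rewrite upd_id /= /shift; congr (_ *: (f _ - _)).
  apply/rowP => k; rewrite /basis_vec !mxE eqxx /= /GRing.scale /= mulr1.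
  by case: eqP => [->|_]; rewrite ?mulr1 ?mulr0 ?add0r.
move=> df; apply: DeriveDef.
  by rewrite /derivable e.
by rewrite /derive e.
Qed.

(** Powers of the weight are multiplied out one factor at a time: 1 + x_j^2 splits into the given
    monomial bound and the one with the exponent of x_j raised by 2. The list repeating [enum 'I_n]
    m times represents the m-th power. *)
Lemma schwartz_schain (f : 'rV[R]_n -> R[i]) : schwartz f -> schain (fun s => iter_partial s f).
Proof.
move=> [sm dec]; split.
  move=> s j x; have [_ /(_ j x)[h1 h2]] := sm s.
  by split; exact: line_is_derive.
move=> s m.
have key (l : seq 'I_n) a : exists C, forall x, Wsub l x * nc ((monomial a x)%:C * iter_partial s f x) <= C.
  elim: l a => [|j l IH] a.
    by have [C hC] := dec a s; exists C => x; rewrite /Wsub big_nil mul1r.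
  have [C1 hC1] := IH a; have [C2 hC2] := IH (fun k => if k == j then (a k).+2 else a k).
  exists (C1 + C2) => x; rewrite /Wsub big_cons /wj /oneDsqr mulrDl mul1r mulrDl.
  apply: lerD; first exact: hC1.
  apply: le_trans (hC2 x); rewrite [x 0 j ^+ 2 * _]mulrC -mulrA ler_wpM2l ?(ltW (Wsub_gt0 _ _))//.
  rewrite !ncM mulrA ler_wpM2r ?nc_ge0// !nc_real -(ger0_norm (sqr_ge0 (x 0 j))) -normrM.
  rewrite /monomial (bigD1 j)//= [in leRHS](bigD1 j)//= eqxx mulrA -exprD add2n.
  rewrite (eq_bigr (fun i => x 0 i ^+ (if i == j then (a i).+2 else a i)))// => i ij.
  by rewrite (negbTE ij).
have [C hC] := key (flatten (nseq m (enum 'I_n))) (fun=> 0%N).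
exists C => x; apply: le_trans (hC x).
have -> : Wsub (flatten (nseq m (enum 'I_n))) x = Wt x ^+ m.
  rewrite /Wsub /Wt; elim: m {C hC} => [|m IH] /=; first by rewrite big_nil.
  by rewrite big_cat exprS /=; congr (_ * _).
by rewrite /monomial big1// mul1r.
Qed.

End FiniteDifferences.

(** * Bounds on u and Lop u, uniform on compact time intervals *)

Section LocalBounds.
Context {R : realType} {n : nat}.
Local Open Scope classical_set_scope.
Variables (lam : R) (q : 'I_n -> R).
Hypothesis lam0 : 0 < lam.
Hypothesis n_gt0 : (0 < n)%N.
Implicit Types (x : 'rV[R]_n) (j k : 'I_n) (t : R).
Variables (Cs Ss : 'I_n -> R -> R).
Hypothesis dCs : forall k t, is_derive t (1 : R) (Cs k) (- q k * Ss k t).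
Hypothesis dSs : forall k t, is_derive t (1 : R) (Ss k) (Cs k t).
Hypothesis Cs0 : forall k, Cs k 0 = 1.
Hypothesis Ss0 : forall k, Ss k 0 = 0.
Variable (u : R -> 'rV[R]_n -> R[i]).
Hypothesis hS : forall t, schwartz (u t).

Definition up1 j t : 'rV[R]_n -> R[i] := iter_partial [:: j] (u t).
Definition up2 j t : 'rV[R]_n -> R[i] := iter_partial [:: j; j] (u t).
Hypothesis du : forall x t, cder (u ^~ x) t (Lop lam q (u t) (fun j => up2 j t) x).

Lemma sch t : schain (fun s => iter_partial s (u t)).
Proof. exact: schwartz_schain. Qed.

Lemma schain_bdd (F : seq 'I_n -> 'rV[R]_n -> R[i]) (s : seq 'I_n) : schain F ->
  exists2 D, 0 <= D & forall x, nc (F s x) <= D.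
Proof.
move=> [_ h]; have [D hD] := h s 0%N; exists D => [|x].
  by apply: le_trans (hD 0); rewrite mul1r nc_ge0.
by have := hD x; rewrite expr0 mul1r.
Qed.

Lemma u_nice t : nice (u t) (fun j => up1 j t) (fun j => up2 j t).
Proof.
have [pF _] := sch t; have ch := schain_chain (sch t).
split.
- by move=> j x; exact: (pF [::]).
- by move=> j x; exact: (pF [:: j]).
- by move=> j; exact: (chain_sepc [:: j] ch).
- by move=> j; exact: (chain_sepc [:: j; j] ch).
have [D0 D00 h0] := schain_bdd [::] (sch t).
have /choice[D1 h1] : forall j, exists D, 0 <= D /\ forall x, nc (up1 j t x) <= D.
  by move=> j; have [D hD h] := schain_bdd [:: j] (sch t); exists D.
have /choice[D2 h2] : forall j, exists D, 0 <= D /\ forall x, nc (up2 j t x) <= D.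
  by move=> j; have [D hD h] := schain_bdd [:: j; j] (sch t); exists D.
have s1 : 0 <= \sum_j D1 j by apply: sumr_ge0 => j _; case: (h1 j).
have s2 : 0 <= \sum_j D2 j by apply: sumr_ge0 => j _; case: (h2 j).
exists (D0 + \sum_j D1 j + \sum_j D2 j); first by rewrite !addr_ge0.
move=> x; split; first by apply: le_trans (h0 x) _; rewrite -addrA lerDl addr_ge0.
move=> j.
have l1 : D1 j <= \sum_j D1 j by rewrite (bigD1 j)//= lerDl; apply: sumr_ge0 => i _; case: (h1 i).
have l2 : D2 j <= \sum_j D2 j by rewrite (bigD1 j)//= lerDl; apply: sumr_ge0 => i _; case: (h2 i).
have [_ /(_ x) g1] := h1 j; have [_ /(_ x) g2] := h2 j.
by split; lra.
Qed.

Definition mu2 j t := mulch j (mulch j (fun s => iter_partial s (u t))).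

Lemma mu2_schain j t : schain (mu2 j t).
Proof. by do 2! apply: mulch_schain; exact: sch. Qed.

(* The s-th derivative of Lop u. *)
Definition FL t (s : seq 'I_n) x : R[i] :=
  iq lam * \sum_j iter_partial (s ++ [:: j; j]) (u t) x +
  \sum_j - ('i%C * (lam * q j)%:C) * mu2 j t s x.

Lemma FL_schain t : schain (FL t).
Proof.
apply: schainD.
  apply: schainZ; apply: (@schain_sum R n _ _ (fun j s => iter_partial (s ++ [:: j; j]) (u t))) => j.
  exact: (schain_shift [:: j; j] (sch t)).
apply: (@schain_sum R n _ _ (fun j s x => - ('i%C * (lam * q j)%:C) * mu2 j t s x)) => j.
by apply: schainZ; exact: mu2_schain.
Qed.

Lemma FL_nil t x : FL t [::] x = Lop lam q (u t) (fun j => up2 j t) x.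
Proof.
rewrite /FL /Lop VqE mulr_suml -sumrN; congr (_ + _).
apply: eq_bigr => j _; rewrite /mu2 !mulch_nil expr2 !rmorphM /=; ring.
Qed.

Definition cL : R := nc (iq lam) * n%:R + \sum_j lam * `|q j|.

Lemma cL_ge0 : 0 <= cL.
Proof.
rewrite addr_ge0 ?mulr_ge0 ?nc_ge0//; apply: sumr_ge0 => j _.
by rewrite mulr_ge0// ltW.
Qed.

Lemma FL_bound t (s : seq 'I_n) (K : R) :
  (forall j x, Wt x * nc (iter_partial (s ++ [:: j; j]) (u t) x) <= K) ->
  (forall j x, Wt x * nc (mu2 j t s x) <= K) ->
  forall x, Wt x * nc (FL t s x) <= cL * K.
Proof.
move=> h1 h2 x; have W0 := Wt_gt0 x.
have h1' j : nc (iter_partial (s ++ [:: j; j]) (u t) x) <= K / Wt x.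
  by rewrite ler_pdivlMr// mulrC.
have h2' j : nc (mu2 j t s x) <= K / Wt x by rewrite ler_pdivlMr// mulrC.
rewrite mulrC -ler_pdivlMr// -mulrA /FL /cL mulrDl.
apply: le_trans (ncD _ _) _; apply: lerD.
  rewrite ncM -mulrA ler_wpM2l ?nc_ge0//; apply: le_trans (nc_sum _ _ _) _.
  rewrite mulr_natl; have -> : K / Wt x *+ n = \sum_(j < n) K / Wt x by rewrite sumr_const card_ord.
  by apply: ler_sum => j _; exact: h1'.
rewrite mulr_suml; apply: le_trans (nc_sum _ _ _) _; apply: ler_sum => j _.
rewrite ncM ncN [X in X * _]ncM nc_i mul1r nc_real normrM (gtr0_norm lam0).
by rewrite ler_wpM2l// mulr_ge0// ltW.
Qed.

(** Cs stays above 1/2 near 0 by continuity, and since Ss' = Cs this gives |Ss(t)| >= |t| / 2. *)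
Lemma short_time : exists2 d : R, 0 < d & forall k t, `|t| < d -> t != 0 ->
  Ss k t != 0 /\ 2^-1 <= `|Cs k t|.
Proof.
have ex k : exists d : R, 0 < d /\ forall t, `|t| < d -> 2^-1 < Cs k t.
  have cc : {for (0 : R), continuous (Cs k)} by exact: is_derive_cont (dCs k 0).
  have := cc; rewrite /prop_for /continuous_at Cs0 => /cvgr_gt /(_ 2^-1).
  have h21 : 2^-1 < 1 :> R by rewrite invf_lt1 ?ltr1n.
  move=> /(_ h21) /nbhs_ballP[d /= d0 hd]; exists d; split=> // t td.
  by apply: hd; rewrite -ball_normE /= sub0r normrN.
have /choice[d hd] := ex.
pose S := \sum_k (d k)^-1.
have S0 : 0 <= S by apply: sumr_ge0 => k _; rewrite invr_ge0; case: (hd k) => /ltW.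
have pS : 0 < 1 + S by rewrite ltr_wpDr.
(* A positive number below every [d k]. *)
exists (1 + S)^-1 => [|k t td t0]; first by rewrite invr_gt0.
have [dk0 hk] := hd k.
have le1 : (1 + S)^-1 <= d k.
  rewrite -[leRHS]invrK lef_pV2 ?posrE ?invr_gt0//.
  rewrite /S (bigD1 k)//= addrCA lerDl addr_ge0// sumr_ge0// => i _.
  by rewrite invr_ge0; case: (hd i) => /ltW.
have htk r : `|r| <= `|t| -> 2^-1 < Cs k r.
  by move=> rt; apply: hk; exact: le_lt_trans rt (lt_le_trans td le1).
split; last first.
  by apply: le_trans (ler_norm _); apply/ltW/htk.
have key a b : a <= b -> (forall r, a <= r <= b -> `|r| <= `|t|) -> (b - a) / 2 <= Ss k b - Ss k a.
  move=> ab hab.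
  have dm r : is_derive r (1 : R) (fun y : R => (2^-1 : R) * y) (2^-1 : R).
    have := is_derive_mul (is_derive_cst (2^-1 : R) r (1 : R)) (is_derive_id r (1 : R)).
    by move/is_derive_val; apply; rewrite mul0r addr0 mulr1.
  have := @derive_compare _ _ _ _ _ a b ab (fun r _ => dm r) (fun r _ => dSs k r).
  have h r : a <= r <= b -> `|2^-1 : R| <= Cs k r.
    by move=> rI; rewrite ger0_norm ?invr_ge0//; exact: ltW (htk r (hab r rI)).
  by move=> /(_ h); rewrite -mulrBr mulrC; apply: le_trans; exact: ler_norm.
have [tp|tn] := ltP 0 t.
  have := key 0 t (ltW tp); rewrite Ss0 !subr0 => h.
  rewrite gt_eqF//; apply: lt_le_trans (h _); first by rewrite divr_gt0.
  by move=> r /andP[r0 rt]; rewrite !ger0_norm// ltW.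
have {}tn : t < 0 by rewrite lt_neqAle t0.
have := key t 0 (ltW tn); rewrite Ss0 !sub0r => h.
rewrite lt_eqF// -oppr_gt0; apply: lt_le_trans (h _); first by rewrite divr_gt0// oppr_gt0.
by move=> r /andP[rt r0]; rewrite !ler0_norm ?lerN2// ltW.
Qed.

Definition Gt (o : option 'I_n) t : seq 'I_n -> 'rV[R]_n -> R[i] :=
  if o is Some j then mu2 j t else fun s => iter_partial s (u t).

Lemma Gt_schain o t : schain (Gt o t).
Proof. by case: o => [j|]; [exact: mu2_schain|exact: sch]. Qed.

(** The finitely many weighted derivatives that control u and Lop u themselves, for coinciding
    times, and their mixed derivatives of order one in each coordinate, as consumed by
    [kernel_bound]. [Some j] stands for x_j^2 u, the potential part of Lop u. *)
Definition tests : seq (option 'I_n * seq 'I_n) :=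
  flatten [seq (None, s) :: flatten [seq [:: (None, s ++ [:: j; j]); (Some j, s)] | j <- enum 'I_n]
          | s <- [:: [::]; enum 'I_n]].

(* The bounds on the derivatives are expressed by difference quotients, because these
   depend continuously on t: this makes the set of t with lvl k t closed. *)
Definition lvl (k : nat) t := forall p, p \in tests -> forall l, map fst l = p.2 -> hok l ->
  forall x, Wt x * nc (delL l (Gt p.1 t [::]) x) <= k%:R * \prod_(z <- l) z.2.

Lemma lvl_exists t : exists k : nat, lvl k t.
Proof.
have ex p : exists k : nat, forall l, map fst l = p.2 -> hok l ->
  forall x, Wt x * nc (delL l (Gt p.1 t [::]) x) <= k%:R * \prod_(z <- l) z.2.
  have [pG /(_ p.2 1%N)[K hK]] := Gt_schain p.1 t.
  have K0 : 0 <= K by apply: le_trans (hK 0); rewrite mulr_ge0 ?nc_ge0// exprn_ge0// ltW// Wt_gt0.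
  exists (Num.bound (6 ^+ size p.2 * K)) => l lp hl x.
  apply: le_trans (delL_bound pG hl (K := K) _ x) _.
    by move=> z; rewrite lp; exact: hK.
  have -> : size l = size p.2 by rewrite -lp size_map.
  apply: ler_wpM2r.
    elim: l hl {lp} => [|a l IH] /=; first by rewrite big_nil.
    by move=> /andP[/andP[a0 _] hl]; rewrite big_cons mulr_ge0 ?IH// ltW.
  by apply/ltW/archi_boundP; rewrite mulr_ge0.
have /choice[kf hkf] := ex.
exists (\sum_(p <- tests) kf p)%N => p pt l lp hl x.
apply: le_trans (hkf p l lp hl x) _; apply: ler_wpM2r.
  elim: l hl {lp} => [|a l IH] /=; first by rewrite big_nil.
  by move=> /andP[/andP[a0 _] hl]; rewrite big_cons mulr_ge0 ?IH// ltW.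
by rewrite ler_nat (big_rem p)//= leq_addr.
Qed.

Lemma lvl_closed (k : nat) : closed [set t | lvl k t].
Proof.
move=> t ht p pt l lp hl x.
have cG : ccontinuous (fun t => delL l (Gt p.1 t [::]) x).
  apply: (delL_cont l x (g := fun t => Gt p.1 t [::])) => z.
  have cu := cder_continuous (du z).
  case: (p.1) => [j|//]; rewrite /Gt.
  rewrite (_ : (fun t => _) = fun t => ((z 0 j)%:C * (z 0 j)%:C) * u t z).
    by apply: ccontM => //; exact: ccont_cst.
  by apply/funext => r; rewrite /mu2 !mulch_nil mulrA.
rewrite leNgt; apply/negP => hlt.
have cn : {for t, continuous (fun t => Wt x * nc (delL l (Gt p.1 t [::]) x))}.
  apply: seq_continuous => v vt; apply: cvgM; first exact: cvg_cst.
  exact: ccvg_nc (ccont_seq cG vt).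
have := cn; rewrite /prop_for /continuous_at => /cvgr_gt /(_ _ hlt) hn.
have [r [/= hr]] := ht _ hn.
by rewrite ltNge (hr p pt l lp hl x).
Qed.

Lemma lvl_bound (k : nat) t p x : lvl k t -> p \in tests -> Wt x * nc (Gt p.1 t p.2 x) <= k%:R.
Proof.
move=> hk pt; have [pG _] := Gt_schain p.1 t.
by apply: (delL_inv pG) => l lp hl z; exact: hk.
Qed.

Lemma tests_mem (s : seq 'I_n) : s \in [:: [::]; enum 'I_n] ->
  [/\ (None, s) \in tests, forall j, (None, s ++ [:: j; j]) \in tests & forall j, (Some j, s) \in tests].
Proof.
move=> hs.
have sub p : p \in (None, s) :: flatten [seq [:: (None, s ++ [:: j; j]); (Some j, s)] | j <- enum 'I_n] -> p \in tests.
  by move=> hp; apply/flatten_mapP; exists s.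
split=> [|j|j]; apply: sub; rewrite inE ?eqxx//; apply/orP; right;
  by apply/flatten_mapP; exists j; rewrite ?mem_enum// !inE eqxx ?orbT.
Qed.

Lemma lvl_F (k : nat) t (s : seq 'I_n) : lvl k t -> s \in [:: [::]; enum 'I_n] ->
  (forall x, Wt x * nc (iter_partial s (u t) x) <= k%:R) /\
  (forall x, Wt x * nc (FL t s x) <= cL * k%:R).
Proof.
move=> hk hs; have [m1 m2 m3] := tests_mem hs; split.
  by move=> x; exact: (lvl_bound x hk m1).
by apply: FL_bound => j x; [exact: (lvl_bound x hk (m2 j))|exact: (lvl_bound x hk (m3 j))].
Qed.

Lemma u_line t x z : ccontinuous (fun p : R => u t (x + p *: z)).
Proof. by apply: ccont_line; have [/(_ [::])[]] := hS t. Qed.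

Lemma coord_line x z j : ccontinuous (fun p : R => ((x + p *: z) 0 j)%:C).
Proof.
apply: ccont_real; under eq_fun do rewrite !mxE.
by move=> p; apply: cvgD; [exact: cvg_cst|apply: cvgM; [exact: cvg_id|exact: cvg_cst]].
Qed.

Lemma Lop_line t x z : ccontinuous (fun p : R => Lop lam q (u t) (fun j => up2 j t) (x + p *: z)).
Proof.
have c2 j : ccontinuous (fun p : R => up2 j t (x + p *: z)).
  by apply: ccont_line; have [/(_ [:: j; j])[]] := hS t.
have cv j : ccontinuous (fun p : R => - ('i%C * (lam * q j)%:C) * (((x + p *: z) 0 j)%:C * ((x + p *: z) 0 j)%:C * u t (x + p *: z))).
  apply: ccontM; first exact: ccont_cst.
  by apply: ccontM; [apply: ccontM; exact: coord_line|exact: u_line].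
have := ccontD (ccontM (ccont_cst (iq lam)) (ccont_sum (index_enum _) xpredT c2)) (ccont_sum (index_enum _) xpredT cv).
rewrite (_ : (fun p => _) = fun p : R => Lop lam q (u t) (fun j => up2 j t) (x + p *: z))//.
apply/funext => p; rewrite -FL_nil /FL; congr (_ + _).
by apply: eq_bigr => j _; rewrite /mu2 !mulch_nil !mulrA.
Qed.

Lemma nc_ub (K : R) (w : R[i]) x : Wt x * nc w <= K -> nc w <= K.
Proof. by apply: le_trans; rewrite ler_peMl ?nc_ge0 ?Wt_ge1. Qed.

(** [baire_bounded] with [lvl] as levels. Its last hypothesis is the dispersive estimate: any bound
    between s and t makes the pairing identity valid, and [kernel_bound] then bounds u(t) and Lop
    u(t) by the level at s alone. *)
Theorem locally_bounded t1 t2 :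
  bdon (fun C t => forall x, nc (u t x) <= C /\ nc (Lop lam q (u t) (fun j => up2 j t) x) <= C) t1 t2.
Proof.
have [d d0 hd] := short_time.
apply: (baire_bounded (A := lvl) d0).
- by move=> C C' t CC h x; have [h1 h2] := h x; split; apply: le_trans CC.
- move=> t; have [D1 p1 h1] := schain_bdd [::] (sch t).
  have [D2 p2 h2] := schain_bdd [::] (FL_schain t).
  exists (D1 + D2) => x; have := h1 x; have := h2 x; rewrite FL_nil /= => g2 g1; split; lra.
- exact: lvl_exists.
- exact: lvl_closed.
move=> k.
pose gc : R := (nc (@gmass R n))^-1 * (kap ^+ n * 8 ^+ n).
have gc0 : 0 <= gc by rewrite mulr_ge0 ?invr_ge0 ?nc_ge0// mulr_ge0// exprn_ge0// kap_ge0.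
(* One constant above the four that occur: k and cL k when s = t, gc k and gc cL k otherwise. *)
exists ((1 + gc) * (1 + cL) * k%:R) => s t ts hb hk.
have c0 := cL_ge0; have k0 : 0 <= (k%:R : R) by [].
have en0 : ([::] : seq 'I_n) \in [:: [::]; enum 'I_n] by rewrite mem_head.
have en1 : enum 'I_n \in [:: [::]; enum 'I_n] by rewrite !inE eqxx orbT.
have [e0 e1] := lvl_F hk en0; have [f0 f1] := lvl_F hk en1.
have A1 : k%:R <= (1 + gc) * (1 + cL) * k%:R.
  by rewrite -[leLHS]mul1r ler_wpM2r//; nra.
have A2 : cL * k%:R <= (1 + gc) * (1 + cL) * k%:R by rewrite ler_wpM2r//; nra.
have A3 : gc * k%:R <= (1 + gc) * (1 + cL) * k%:R by rewrite ler_wpM2r//; nra.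
have A4 : gc * (cL * k%:R) <= (1 + gc) * (1 + cL) * k%:R by rewrite mulrA ler_wpM2r//; nra.
have [<-|st] := eqVneq s t.
  move=> x; split; first exact: le_trans (nc_ub (e0 x)) A1.
  by rewrite -FL_nil; exact: le_trans (nc_ub (e1 x)) A2.
have tau0 : s - t != 0 by rewrite subr_eq0.
have tau1 : `|s - t| < d by rewrite distrC.
have S0 k' : Ss k' (s - t) != 0 by have [] := hd k' _ tau1 tau0.
have C2 k' : 2^-1 <= `|Cs k' (s - t)| by have [] := hd k' _ tau1 tau0.
(* The transfer runs from [t] to [s]: the concentrating Gaussian sits at the time where the bound is
   wanted. *)
rewrite minC maxC in hb.
have tr X B B0 := transfer lam0 n_gt0 dCs dSs Cs0 Ss0 u_nice du X (B := B) hb S0 B0.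
have [Du _ hDu] := schain_bdd [::] (sch t).
have [DL _ hDL] := schain_bdd [::] (FL_schain t).
have gm (K : R) : (nc (@gmass R n))^-1 * (kap ^+ n * (8 ^+ n * K)) = gc * K by rewrite /gc !mulrA.
move=> x; split.
  apply: le_trans A3; rewrite -gm.
  apply: (kernel_bound (C0 := Du) lam0 (sepc_u u_nice t) hDu (u_line t) (schain_chain (sch s)) _ S0 C2).
    by apply/domE; exact: f0.
  by move=> X B B0; have [A [a1 a2 _]] := tr X B B0; exists A.
apply: le_trans A4; rewrite -gm.
have bL : bdd DL (Lop lam q (u t) (fun j => up2 j t)) by move=> z; rewrite -FL_nil; exact: hDL.
have dF : dom (cL * k%:R) (FL s (enum 'I_n)) by apply/domE; exact: f1.
have KB := @kernel_bound _ _ _ lam0 (Lop lam q (u t) (fun j => up2 j t)) (FL s) DL _ _ _ (sepc_Lu lam q u_nice t) bL (@Lop_line t) (schain_chain (FL_schain s)) dF S0 C2.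
apply: KB.
move=> X B B0; have [A [a1 _ a3]] := tr X B B0; exists A; split=> //.
rewrite (_ : FL s [::] = Lop lam q (u s) (fun j => up2 j s)); first exact: a3.
by apply/funext => z; exact: FL_nil.
Qed.

End LocalBounds.

(** * Uniqueness for two-sided exponential series *)

Section Taylor.
Context {R : realType}.
Implicit Types (t x y : R) (z w : R[i]).

Definition texp (N : nat) z : R[i] := \sum_(i < N) z ^+ i / (i`!%:R).

Lemma texpS N z : texp N.+1 z = texp N z + z ^+ N / (N`!%:R).
Proof. by rewrite /texp big_ord_recr. Qed.

Lemma cder_texp N z t : cder (fun s => texp N.+1 (s%:C * z)) t (z * texp N (t%:C * z)).
Proof.
have did : cder (fun s => s%:C * z) t z.
  have := cderM (cder_real (is_derive_id t (1 : R))) (cder_cst z t).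
  by move/cder_val; apply; rewrite mulr0 add0r mul1r.
have dX k : cder (fun s => (s%:C * z) ^+ k.+1) t (k.+1%:R * z * (t%:C * z) ^+ k).
  elim: k => [|k IH].
    by apply: cder_val did _; rewrite expr0 mulr1 mul1r.
  have := cderM did IH; move/(cder_ext (g := fun s => (s%:C * z) ^+ k.+2)) => /(_ (fun s => esym (exprS _ _))).
  by move/cder_val; apply; rewrite [in RHS]exprS -[in RHS]natr1 (exprS _ k); ring.
elim: N => [|N IH].
  rewrite /texp big_ord0 mulr0.
  by apply: cder_ext (cder_cst 1 t) => s; rewrite /texp big_ord1 expr0 fact0 invr1 mul1r.
apply: (@cder_ext _ (fun s => texp N.+1 (s%:C * z) + ((N.+1)`!%:R)^-1 * (s%:C * z) ^+ N.+1)).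
  by move=> s; rewrite [in RHS]texpS [X in _ + X]mulrC.
apply: cder_val (cderD IH (cderZ _ (dX N))) _.
rewrite texpS mulrDr; congr (_ + _).
rewrite factS natrM invfM.
have n0 : N.+1%:R != 0 :> R[i] by rewrite pnatr_eq0.
have f0 : (N`!)%:R != 0 :> R[i] by rewrite pnatr_eq0 -lt0n fact_gt0.
by field; rewrite f0 /= addrC natr1.
Qed.

(** Along t z the derivative of the remainder of order N + 1 is z times that of order N, and the
    right-hand sides obey the same relation in modulus; so induction is a comparison of derivatives.
    A small [th] buys the factor th^N at the price of a larger exponent. *)
Lemma texp_bound N z (th : R) : 0 < th -> th <= 1 ->
  nc (cexp z - texp N z) <= th ^+ N * expR (nc z / th).
Proof.
move=> th0 th1.
suff key t : 0 <= t -> nc (cexp (t%:C * z) - texp N (t%:C * z)) <= th ^+ N * expR (t * (nc z / th)).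
  by have := key 1 ler01; rewrite !mul1r.
elim: N t => [|N IH] t t0.
  rewrite /texp big_ord0 subr0 expr0 mul1r nc_cexp ler_expR.
  apply: le_trans (ler_norm _) (le_trans (nc_Re _) _); rewrite ncM nc_real ger0_norm//.
  by rewrite ler_wpM2l// ler_pdivlMr// ler_piMr ?nc_ge0.
have did s : cder (fun s => s%:C * z) s z.
  have := cderM (cder_real (is_derive_id s (1 : R))) (cder_cst z s).
  by move/cder_val; apply; rewrite mulr0 add0r mul1r.
have d1 s : cder (fun s => cexp (s%:C * z) - texp N.+1 (s%:C * z)) s
    (z * (cexp (s%:C * z) - texp N (s%:C * z))).
  by apply: cder_val (cderB (cder_cexp (did s)) (cder_texp N z s)) _; rewrite mulrBr.
have d2 s : is_derive s (1 : R) (fun s => th ^+ N.+1 * expR (s * (nc z / th)))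
    (nc z * (th ^+ N * expR (s * (nc z / th)))).
  have e1 : is_derive s (1 : R) (fun s => s * (nc z / th)) (nc z / th).
    have := is_derive_mul (is_derive_id s (1 : R)) (is_derive_cst (nc z / th) s (1 : R)).
    by move/is_derive_val; apply; rewrite mulr0 add0r mul1r.
  have := is_derive_mul (is_derive_cst (th ^+ N.+1) s (1 : R)) (is_derive_comp (is_derive_expR _) e1).
  move/is_derive_val; apply; rewrite mul0r addr0 exprS.
  have n0 : th != 0 by rewrite gt_eqF.
  by rewrite /cst; field.
have := cder_compare t0 (fun s _ => d1 s) (fun s _ => d2 s).
have e0 : texp N.+1 0 = 1 :> R[i].
  rewrite /texp big_ord_recl expr0 fact0 mul1r invr1 big1 ?addr0// => i _.
  by rewrite /= expr0n /= mul0r.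
rewrite !mul0r cexp0 e0 subrr subr0 => /(_ _)/le_trans; apply.
  by move=> s /andP[s0 _]; rewrite ncM ler_wpM2l ?nc_ge0// IH.
by rewrite lerBlDr lerDl mulr_ge0 ?expR_ge0// exprn_ge0// ltW.
Qed.

Lemma pow_fact_le N z : nc (z ^+ N / (N`!%:R)) <= 2 * expR (nc z).
Proof.
have -> : z ^+ N / (N`!%:R) = (cexp z - texp N z) - (cexp z - texp N.+1 z).
  by rewrite texpS; ring.
apply: le_trans (ncB _ _) _; rewrite mulr_natl mulr2n.
by apply: lerD; apply: le_trans (texp_bound _ _ (th := 1) _ _) _;
  rewrite ?ltr01// expr1n mul1r divr1.
Qed.

Lemma texp_le N z : nc (texp N z) <= 2 * expR (nc z).
Proof.
have -> : texp N z = cexp z - (cexp z - texp N z) by ring.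
apply: le_trans (ncB _ _) _; rewrite mulr_natl mulr2n; apply: lerD.
  by rewrite nc_cexp ler_expR; apply: le_trans (ler_norm _) (nc_Re _).
by apply: le_trans (texp_bound _ _ (th := 1) _ _) _; rewrite ?ltr01// expr1n mul1r divr1.
Qed.

Lemma ncvg0_le (v : nat -> R[i]) (w : nat -> R) l : (forall i, nc (v i - l) <= w i) ->
  (w i @[i --> \oo] --> (0 : R))%classic -> ccvg v l.
Proof.
move=> h hw; apply: (squeeze_cvgr (f := fun=> 0) (h := w)) => //; last exact: cvg_cst.
by apply: nearW => i; rewrite nc_ge0 h.
Qed.

Lemma texp_cvg z : ccvg (texp ^~ z) (cexp z).
Proof.
have h2 : 0 < 2^-1 :> R by rewrite invr_gt0.
apply: (@ncvg0_le _ (fun N => 2^-1 ^+ N * expR (nc z / 2^-1))) => [N|].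
  by rewrite nc_distC; apply: texp_bound => //; rewrite invf_le1 ?ler1n.
rewrite -(mul0r (expR (nc z / 2^-1))); apply: cvgM; last exact: cvg_cst.
by apply: cvg_expr; rewrite ger0_norm ?ltW// invf_lt1 ?ltr1n.
Qed.

End Taylor.

(** * Moments of exponential sums and their propagation *)

Section Moments.
Context {R : realType}.
Local Open Scope classical_set_scope.
Implicit Types (x y : R) (z w : R[i]) (S : nat -> (R -> R[i]) -> R[i]) (g h : R -> R[i]).

(* S N g stands for a partial sum of coefficients times values of g at exponents, which
   lie in E; the bound expresses the convergence of the coefficients against exp(D |nu|). *)
Record dsum (E : R -> Prop) (D M : R) S : Prop := DSum {
  dsum_lin : forall N (a : R[i]) g h, S N (fun nu => a * g nu + h nu) = a * S N g + S N h;
  dsum_bound : forall N g C, 0 <= C -> (forall nu, E nu -> nc (g nu) <= C * expR (D * `|nu|)) ->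
    nc (S N g) <= M * C }.

Definition van S g := ccvg (fun N => S N g) 0.

(** [van S (mon n w)] expresses that the n-th derivative of the series of terms c e^(nu w) vanishes
    at [w], with no holomorphic function in sight. *)
Definition mon n w : R -> R[i] := fun nu => nu%:C ^+ n * cexp (nu%:C * w).

Variables (E : R -> Prop) (D M : R) .
Hypotheses (D0 : 0 < D) (M0 : 0 <= M).

Section OneSum.
Variables (S : nat -> (R -> R[i]) -> R[i]).
Hypothesis dS : dsum E D M S.

Lemma dsum0 N : S N (fun=> 0) = 0.
Proof.
have := dsum_lin dS N (-1) (fun=> 0) (fun=> 0).
rewrite (_ : (fun=> _) = fun=> 0); last by apply/funext => nu; rewrite mulr0 addr0.
by rewrite mulN1r addNr.
Qed.

Lemma van_lin a g h : van S g -> van S h -> van S (fun nu => a * g nu + h nu).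
Proof.
move=> vg vh; rewrite /van; under eq_fun do rewrite (dsum_lin dS).
have := ccvgD (ccvgM (ccvg_cst a) vg) vh; by rewrite mulr0 addr0.
Qed.

Lemma van0 : van S (fun=> 0).
Proof. by rewrite /van; under eq_fun do rewrite dsum0; exact: ccvg_cst. Qed.

Lemma van_sum (N : nat) (a : nat -> R[i]) (g_ : nat -> R -> R[i]) :
  (forall i, (i < N)%N -> van S (g_ i)) -> van S (fun nu => \sum_(i < N) a i * g_ i nu).
Proof.
elim: N => [|N IH] h.
  by under eq_fun do rewrite big_ord0; exact: van0.
under eq_fun do rewrite big_ord_recr /= addrC.
by apply: van_lin; [exact: h|apply: IH => i /ltnW; exact: h].
Qed.

(** The vanishing functionals are equicontinuous for the sup norm weighted by exp(-D |nu|), so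
    vanishing passes to limits in that norm. *)
Lemma van_approx g :
  (forall e : R, 0 < e -> exists2 h, van S h & forall nu, E nu -> nc (g nu - h nu) <= e * expR (D * `|nu|)) ->
  van S g.
Proof.
move=> happ; apply/cvgrPdist_lt => e e0.
pose e' := e / (2 * (M + 1)).
have M1 : 0 < M + 1 by rewrite ltr_wpDl.
have e'0 : 0 < e' by rewrite divr_gt0// mulr_gt0.
have [h vh gh] := happ e' e'0.
have e2 : 0 < e / 2 by rewrite divr_gt0.
move/cvgrPdist_lt: vh => /(_ _ e2); apply: filterS => N.
rewrite !sub0r !normrN !ger0_norm ?nc_ge0// !subr0 => hN.
have -> : S N g = S N (fun nu => 1 * (-1 * h nu + g nu) + h nu).
  by congr (S N); apply/funext => nu; ring.
rewrite (dsum_lin dS) mul1r; apply: le_lt_trans (ncD _ _) _.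
have := @dsum_bound _ _ _ _ dS N (fun nu => -1 * h nu + g nu) e' (ltW e'0) _.
move=> /(_ _)hb; have {}hb : nc (S N (fun nu => -1 * h nu + g nu)) <= M * e'.
  by apply: hb => nu Enu; rewrite mulN1r addrC; exact: gh.
have h2 : M * e' <= e / 2.
  by rewrite /e' mulrA ler_pdivrMr ?mulr_gt0//; nra.
by rewrite [ltRHS](splitr e); apply: ler_ltD => //; exact: le_trans h2.
Qed.

Lemma texp_van n N w : (forall k, van S (mon k 0)) ->
  van S (fun nu => nu%:C ^+ n * texp N (nu%:C * w)).
Proof.
move=> h; have := @van_sum N (fun i => w ^+ i / (i`!%:R)) (fun i => mon (n + i) 0) (fun i _ => h _).
congr (van S _); apply/funext => nu; rewrite /texp mulr_sumr.
by apply: eq_bigr => i _; rewrite /mon mulr0 cexp0 mulr1 exprD exprMn; ring.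
Qed.

(** Strong induction on n: for small x, nu^n is close to (n! / x^n) (e^(nu x) - sum_(i < n) (nu x)^i
    / i!), whose terms vanish by hypothesis and induction. With x = th D, [texp_bound] at order n +
    1 leaves the error c th e^(D |nu|). *)
Lemma mom_of_interval (d : R) : 0 < d ->
  (forall x, 0 <= x < d -> van S (mon 0 x%:C)) -> forall n, van S (mon n 0).
Proof.
move=> d0 hv n; elim/ltn_ind: n => n IH.
apply: van_approx => e e0.
pose c : R := n`!%:R / D ^+ n.
have c0 : 0 < c by rewrite divr_gt0 ?exprn_gt0// ltr0n fact_gt0.
(* The second bound makes the error at most [e], the third keeps x = th D below [d]. *)
pose th : R := Num.min 1 (Num.min (e / c) (d / D / 2)).
have th0 : 0 < th.
  by rewrite /th !lt_min ltr01 (divr_gt0 e0 c0) /=; do 2 (apply: divr_gt0 => //).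
have th1 : th <= 1 by rewrite /th ge_min lexx.
have the : th <= e / c by rewrite /th !ge_min lexx /= orbT.
have thd : th <= d / D / 2 by rewrite /th !ge_min lexx !orbT.
pose x := th * D.
have x0 : 0 < x by rewrite mulr_gt0.
have xd : x < d.
  have : x <= d / 2 by rewrite -ler_pdivlMr// mulrAC.
  by move=> /le_lt_trans; apply; rewrite ltr_pdivrMr// ltr_pMr// ltr1n.
pose a : R[i] := n`!%:R / x%:C ^+ n.
have a0 : x%:C ^+ n != 0 by rewrite expf_neq0// fmorph_eq0 gt_eqF.
have f0 : n`!%:R != 0 :> R[i] by rewrite pnatr_eq0 -lt0n fact_gt0.
exists (fun nu => a * (mon 0 x%:C nu) + (\sum_(i < n) (- a * (x%:C ^+ i / (i`!%:R))) * mon i 0 nu)).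
  apply: van_lin; first by apply: hv; rewrite ltW.
  exact: (@van_sum n (fun i => - a * (x%:C ^+ i / (i`!%:R))) (fun i => mon i 0)).
move=> nu _.
have -> : mon n 0 nu - (a * mon 0 x%:C nu + \sum_(i < n) (- a * (x%:C ^+ i / (i`!%:R))) * mon i 0 nu)
   = - a * (cexp (nu%:C * x%:C) - texp n.+1 (nu%:C * x%:C)).
  have -> : \sum_(i < n) (- a * (x%:C ^+ i / (i`!%:R))) * mon i 0 nu = - a * texp n (nu%:C * x%:C).
    rewrite /texp mulr_sumr; apply: eq_bigr => i _.
    by rewrite /mon mulr0 cexp0 mulr1 exprMn; ring.
  rewrite texpS /mon expr0 mul1r mulr0 cexp0 mulr1 exprMn.
  have aa : a * (x%:C ^+ n / n`!%:R) = 1 by rewrite /a; field; rewrite f0 a0.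
  by rewrite -[LHS](subrK (nu%:C ^+ n * (a * (x%:C ^+ n / n`!%:R)))) aa; ring: aa.
rewrite ncM ncN; apply: le_trans (ler_wpM2l (nc_ge0 _) (texp_bound _ _ th0 th1)) _.
have -> : nc (nu%:C * x%:C) / th = D * `|nu|.
  rewrite ncM !nc_real (gtr0_norm x0) /x; have := gt_eqF th0; move=> /negbT t0; by field.
rewrite mulrA ler_wpM2r ?expR_ge0//.
have -> : nc a * th ^+ n.+1 = c * th.
  rewrite /a /c ncM; have -> : nc (n`!%:R : R[i]) = n`!%:R.
    by rewrite -(rmorph_nat (real_complex R)) nc_real ger0_norm.
  have -> : nc ((x%:C ^+ n)^-1 : R[i]) = (x ^+ n)^-1.
    by rewrite -rmorphXn -fmorphV nc_real ger0_norm// invr_ge0 exprn_ge0// ltW.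
  rewrite /x exprMn exprS; have tn : th ^+ n != 0 by rewrite expf_neq0// gt_eqF.
  have Dn : D ^+ n != 0 by rewrite expf_neq0// gt_eqF.
  by field; rewrite tn Dn.
by rewrite mulrC -ler_pdivlMr.
Qed.

Lemma abs_pow_le n x : `|x| ^+ n <= n`!%:R * (2 / D) ^+ n * (2 * expR (D / 2 * `|x|)).
Proof.
have := pow_fact_le n ((D / 2 * `|x|)%:C).
have D2 : 0 < D / 2 by rewrite divr_gt0.
rewrite ncM nc_X !nc_real normrM normr_id (gtr0_norm D2).
have -> : nc ((n`!%:R)^-1 : R[i]) = (n`!%:R)^-1.
  by rewrite -(rmorph_nat (real_complex R)) -fmorphV nc_real ger0_norm.
have nf : 0 < n`!%:R :> R by rewrite ltr0n fact_gt0.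
rewrite ler_pdivrMr// exprMn => h.
have Dn : 0 < (D / 2) ^+ n by rewrite exprn_gt0.
rewrite -(ler_pM2l Dn); apply: le_trans h _; rewrite le_eqVlt; apply/orP; left; apply/eqP.
rewrite !expr_div_n.
have n2 : 2 ^+ n != 0 :> R by rewrite expf_neq0.
have nD : D ^+ n != 0 by rewrite expf_neq0// gt_eqF.
by field; rewrite n2 nD.
Qed.

(** Expand e^(nu w) by Taylor. The budget e^(D |nu|) is shared equally: D / 2 for the power nu^n,
    and 2 |w| <= D / 2 for the remainder with [th] = 1/2. *)
Lemma mom_shift w : nc w <= D / 4 -> (forall n, van S (mon n 0)) -> forall n, van S (mon n w).
Proof.
move=> wD hm n; apply: van_approx => e e0.
pose c : R := n`!%:R * (2 / D) ^+ n * 2.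
have c0 : 0 < c by rewrite !mulr_gt0 ?exprn_gt0 ?divr_gt0// ltr0n fact_gt0.
have h2 : 0 < 2^-1 :> R by rewrite invr_gt0.
have [N hN] : exists N, c * 2^-1 ^+ N <= e.
  have : (fun N => c * 2^-1 ^+ N : R^o) @ \oo --> (0 : R).
    rewrite -(mulr0 c); apply: cvgM; first exact: cvg_cst.
    by apply: cvg_expr; rewrite ger0_norm ?ltW// invf_lt1 ?ltr1n.
  move/cvgrPdist_le => /(_ _ e0)[N _ /(_ N (leqnn N))] /=.
  by rewrite sub0r normrN => h; exists N; exact: le_trans (ler_norm _) h.
exists (fun nu => nu%:C ^+ n * texp N (nu%:C * w)); first exact: texp_van.
move=> nu _; rewrite /mon -mulrBr ncM nc_X nc_real.
have t1 : 2^-1 <= 1 :> R by rewrite invf_le1 ?ler1n.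
apply: le_trans (ler_pM _ (nc_ge0 _) (abs_pow_le n nu) (texp_bound N _ h2 t1)) _.
  exact: exprn_ge0.
have -> : n`!%:R * (2 / D) ^+ n * (2 * expR (D / 2 * `|nu|)) * (2^-1 ^+ N * expR (nc (nu%:C * w) / 2^-1))
  = (c * 2^-1 ^+ N) * expR (D / 2 * `|nu| + nc (nu%:C * w) / 2^-1).
  by rewrite expRD /c; ring.
apply: ler_pM => //; [by rewrite mulr_ge0 ?exprn_ge0// ltW|].
rewrite ler_expR ncM nc_real invrK.
have : `|nu| * nc w <= `|nu| * (D / 4) by rewrite ler_wpM2l.
lra.
Qed.

End OneSum.

Definition twist S w : nat -> (R -> R[i]) -> R[i] := fun N g => S N (fun nu => g nu * cexp (nu%:C * w)).

Lemma twist_dsum S w : dsum E D M S -> (forall nu, E nu -> nc (cexp (nu%:C * w)) <= 1) ->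
  dsum E D M (twist S w).
Proof.
move=> dS w1; split => [N a g h|N g C C0 hg].
  rewrite /twist -(dsum_lin dS); congr (S N); apply/funext => nu; ring.
apply: (dsum_bound dS) => // nu Enu; rewrite ncM; apply: le_trans (hg nu Enu).
by rewrite ler_piMr ?nc_ge0// w1.
Qed.

(** Each step twists the coefficients by e^(nu w). As this factor has modulus at most 1 on the
    exponents in [E], the bounds are preserved and the step can be repeated. *)
Lemma van_far S w (m : nat) : dsum E D M S -> (forall nu, E nu -> nc (cexp (nu%:C * w)) <= 1) ->
  nc w <= D / 4 -> (forall n, van S (mon n 0)) -> forall n, van S (mon n (m%:R * w)).
Proof.
move=> dS w1 wD; elim: m S dS => [|m IH] S dS hm n.
  by rewrite mul0r; exact: hm.
have tw k v : van (twist S w) (mon k v) = van S (mon k (v + w)).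
  congr (ccvg _ _); apply/funext => N; rewrite /twist; congr (S N); apply/funext => nu.
  by rewrite /mon -mulrA -cexpD mulrDr.
have -> : m.+1%:R * w = m%:R * w + w by rewrite -natr1 mulrDl mul1r.
rewrite -tw; apply: IH; first exact: twist_dsum.
by move=> k; rewrite tw add0r; exact: (mom_shift dS wD hm).
Qed.

End Moments.

Section TwoSided.
Context {R : realType}.
Local Open Scope classical_set_scope.
Implicit Types (x y : R) (z w : R[i]) (E : R -> Prop) (g h : R -> R[i]).

Definition fam (c : nat -> R[i]) (nu : nat -> R) : nat -> (R -> R[i]) -> R[i] :=
  fun N g => \sum_(k < N) c k * g (nu k).

Lemma geo_le (th : R) N : 0 <= th -> th < 1 -> \sum_(k < N) th ^+ k <= (1 - th)^-1.
Proof.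
move=> t0 t1; have d0 : 0 < 1 - th by rewrite subr_gt0.
rewrite -[leRHS]mul1r ler_pdivlMr// mulrC -opprB mulNr -subrX1 opprB.
by rewrite lerBlDr lerDl exprn_ge0.
Qed.

Lemma fam_dsum E (D C th : R) c nu : 0 <= th -> th < 1 -> 0 <= C ->
  (forall k, E (nu k)) -> (forall k, nc (c k) * expR (D * `|nu k|) <= C * th ^+ k) ->
  dsum E D (C / (1 - th)) (fam c nu).
Proof.
move=> t0 t1 C0 hE hc; split => [N a g h|N g B B0 hg].
  rewrite /fam mulr_sumr -big_split /=; apply: eq_bigr => k _; ring.
rewrite /fam; apply: le_trans (nc_sum _ _ _) _.
apply: le_trans (_ : _ <= \sum_(k < N) C * B * th ^+ k) _.
  apply: ler_sum => k _; rewrite ncM.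
  apply: le_trans (ler_wpM2l (nc_ge0 _) (hg _ (hE k))) _.
  by rewrite mulrCA (mulrC C) -mulrA ler_wpM2l.
rewrite -mulr_sumr -mulrA [leRHS]mulrC [X in _ <= X]mulrA [X in _ <= X](_ : _ = C * B * (1 - th)^-1); last by ring.
by rewrite mulrA ler_wpM2l ?mulr_ge0// geo_le.
Qed.

Lemma dsum_add E (D M1 M2 : R) S1 S2 : dsum E D M1 S1 -> dsum E D M2 S2 ->
  dsum E D (M1 + M2) (fun N g => S1 N g + S2 N g).
Proof.
move=> d1 d2; split => [N a g h|N g C C0 hg].
  by rewrite (dsum_lin d1) (dsum_lin d2); ring.
apply: le_trans (ncD _ _) _; rewrite mulrDl.
by apply: lerD; [exact: (dsum_bound d1)|exact: (dsum_bound d2)].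
Qed.

Lemma cexp_nat z (k : nat) : cexp (k%:R * z) = cexp z ^+ k.
Proof.
elim: k => [|k IH]; first by rewrite mul0r cexp0 expr0.
by rewrite -natr1 mulrDl mul1r cexpD IH exprSr.
Qed.

Lemma cexp_pi : cexp ('i%C * pi%:C) = -1 :> R[i].
Proof.
have -> : 'i%C * pi%:C = 0 +i* pi :> R[i].
  by apply: eq_ReIm; rewrite ?ReM ?ImM /=; ring.
rewrite /cexp /= expR0 cospi sinpi mul1r.
by apply: eq_ReIm => /=; rewrite ?oppr0.
Qed.

Lemma cexp_2pi : cexp ((2 * pi)%:C * 'i%C) = 1 :> R[i].
Proof.
have -> : (2 * pi)%:C * 'i%C = 2%:R * ('i%C * pi%:C) :> R[i].
  by rewrite rmorphM rmorph_nat; ring.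
by rewrite cexp_nat cexp_pi sqrrN expr1n.
Qed.

(** Either F = G throughout the interval, or F differs from G at some point and, by continuity, near
    it, where F = - G is then forced. *)
Lemma sign_interval (F G : R -> R[i]) (lo hi : R) : lo < hi -> ccontinuous F -> ccontinuous G ->
  (forall x, F x ^+ 2 = G x ^+ 2) ->
  exists x1 d (s : R[i]), [/\ 0 < d, lo < x1 - d, x1 + d < hi, s ^+ 2 = 1 &
    forall x, `|x - x1| < d -> F x = s * G x].
Proof.
move=> lohi cF cG FG.
have [[x1 [/andP[x1a x1b] ne]]|hne] := pselect (exists x1, lo < x1 < hi /\ F x1 != G x1); last first.
  exists ((lo + hi) / 2), ((hi - lo) / 4), 1; split; rewrite ?expr1n//; try lra.
  move=> x; rewrite ltr_norml mul1r => /andP[h1 h2].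
  have [//|ne] := eqVneq (F x) (G x).
  by exfalso; apply: hne; exists x; split => //; apply/andP; split; lra.
have cn : {for x1, continuous (fun x => nc (F x - G x))}.
  apply: seq_continuous => v vt.
  have := ccvgD (ccont_seq cF vt) (ccvgM (ccvg_cst (-1)) (ccont_seq cG vt)).
  by move/ccvg_nc; under eq_fun do rewrite mulN1r; rewrite mulN1r.
have n0 : 0 < nc (F x1 - G x1) by rewrite nc_gt0 subr_eq0.
have := cn; rewrite /prop_for /continuous_at => /cvgr_gt /(_ _ n0) /nbhs_ballP[r /= r0 hr].
exists x1, (Num.min r (Num.min ((x1 - lo) / 2) ((hi - x1) / 2))), (-1).
set d := Num.min _ _.
have d1 : d <= r by rewrite /d ge_min lexx.
have d2 : d <= (x1 - lo) / 2 by rewrite /d !ge_min lexx !orbT.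
have d3 : d <= (hi - x1) / 2 by rewrite /d !ge_min lexx !orbT.
split.
- by rewrite /d !lt_min r0 /=; apply/andP; split; apply: divr_gt0; rewrite ?subr_gt0.
- lra.
- lra.
- by rewrite sqrrN expr1n.
move=> x xd; have : x \in [set x | 0 < nc (F x - G x)].
  by rewrite inE; apply: hr; rewrite -ball_normE /= distrC; exact: lt_le_trans d1.
rewrite inE /= nc_gt0 => ne2.
have : (F x - G x) * (F x + G x) = 0 by rewrite -subr_sqr FG subrr.
by move/eqP; rewrite mulf_eq0 (negbTE ne2) /= addr_eq0 mulN1r => /eqP.
Qed.

Lemma ex_nat_div (y D : R) : 0 < D -> exists2 m : nat, (0 < m)%N & `|y| / m%:R <= D.
Proof.
move=> D0; pose m := (Num.bound (`|y| / D)).+1.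
have m0 : 0 < m%:R :> R by rewrite ltr0n.
exists m => //; rewrite ler_pdivrMr// mulrC -ler_pdivrMr//.
apply: le_trans (ltW (archi_boundP _)) _; first by rewrite divr_ge0// ltW.
by rewrite ler_nat.
Qed.

(* F = s G on an interval for a sign s, so the moments sum_nu c_nu nu^n e^(nu x) of
   F - s G vanish for x in it, hence, by Taylor expansion, along any path from x in the
   strip. Translation by 2 pi i multiplies the terms of F by -1 and fixes those of G,
   which decouples the two families. *)
Lemma two_sided (F G : R -> R[i]) (a b : nat -> R[i]) (lo hi C : R) : lo < hi ->
  ccontinuous F -> ccontinuous G -> (forall x, F x ^+ 2 = G x ^+ 2) ->
  (forall x, x < hi -> ccvg (fun N => \sum_(k < N) a k * cexp (((k%:R + 2^-1) * x)%:C)) (F x)) ->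
  (forall x, lo < x -> ccvg (fun N => \sum_(k < N) b k * cexp ((- k%:R * x)%:C)) (G x)) ->
  (forall k, nc (a k) * expR (k%:R * hi) <= C) -> (forall k, nc (b k) * expR (- k%:R * lo) <= C) ->
  forall x, hi <= x -> G x = 0.
Proof.
move=> lohi cF cG FG aF bG ha hb x hx.
have [x1 [d [s [d0 x1a x1b s2 Fs]]]] := sign_interval lohi cF cG FG.
have C0 : 0 <= C by apply: le_trans (ha 0%N); rewrite mulr_ge0 ?nc_ge0 ?expR_ge0.
have ns : nc s = 1.
  apply/eqP; rewrite -(@eqrXn2 _ 2) ?nc_ge0//; by rewrite -nc_X s2 expr1n Normc.normc1.
pose nu1 (k : nat) : R := k%:R + 2^-1; pose nu2 (k : nat) : R := - k%:R.
pose c1 k := a k * cexp ((nu1 k * x1)%:C); pose c2 k := - s * (b k * cexp ((nu2 k * x1)%:C)).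
(* The exponents of [G] are nonpositive, so a shift to the right never enlarges its terms; this
   allows the last move from x1 to x. *)
pose E2 (nu : R) := exists k : nat, nu = - k%:R.
have exE (y : R) : y < 0 -> 0 <= expR y /\ expR y < 1.
  by move=> y0; split; [exact: expR_ge0|rewrite -expR0 ltr_expR].
have [p10 p11] : 0 <= expR (x1 + d - hi) /\ expR (x1 + d - hi) < 1 by apply: exE; lra.
have [p20 p21] : 0 <= expR (lo - x1 + d) /\ expR (lo - x1 + d) < 1 by apply: exE; lra.
have nu2E k : E2 (nu2 k) by exists k.
have b1 k : nc (c1 k) * expR (d * `|nu1 k|) <= (C * expR (2^-1 * (x1 + d))) * expR (x1 + d - hi) ^+ k.
  have v0 : 0 <= nu1 k by rewrite /nu1 addr_ge0// invr_ge0.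
  rewrite /c1 ncM nc_cexp /= ger0_norm// -mulrA -expRD -expRM_natl.
  have -> : nu1 k * x1 + d * nu1 k = k%:R * hi + (2^-1 * (x1 + d) + k%:R * (x1 + d - hi)).
    by rewrite /nu1; ring.
  by rewrite expRD mulrA expRD -[leRHS]mulrA ler_wpM2r ?ha ?mulr_ge0 ?expR_ge0//.
have b2 k : nc (c2 k) * expR (d * `|nu2 k|) <= C * expR (lo - x1 + d) ^+ k.
  rewrite /c2 ncM ncN ns mul1r ncM nc_cexp /= /nu2 normrN ger0_norm// -mulrA -expRD -expRM_natl.
  have -> : - k%:R * x1 + d * k%:R = - k%:R * lo + k%:R * (lo - x1 + d) by ring.
  by rewrite expRD mulrA ler_wpM2r ?expR_ge0// hb.
have ds2 := fam_dsum p20 p21 C0 nu2E b2.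
have CC0 : 0 <= C * expR (2^-1 * (x1 + d)) by rewrite mulr_ge0 ?expR_ge0.
have ds1 := fam_dsum (E := fun=> True) p10 p11 CC0 (fun=> I) b1.
have ds2' := fam_dsum (E := fun=> True) p20 p21 C0 (fun=> I) b2.
have ds := dsum_add ds1 ds2'.
have M2 : 0 <= C / (1 - expR (lo - x1 + d)) by rewrite divr_ge0// subr_ge0 ltW.
have M12 : 0 <= C * expR (2^-1 * (x1 + d)) / (1 - expR (x1 + d - hi)) + C / (1 - expR (lo - x1 + d)).
  by rewrite addr_ge0// divr_ge0// subr_ge0 ltW.
have famF y N : fam c1 nu1 N (mon 0 y%:C) = \sum_(k < N) a k * cexp (((k%:R + 2^-1) * (x1 + y))%:C).
  apply: eq_bigr => k _; rewrite /c1 /mon expr0 mul1r -mulrA; congr (_ * _).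
  by rewrite -rmorphM -cexpD -rmorphD -mulrDr.
have famG y N : fam c2 nu2 N (mon 0 y%:C) = - s * \sum_(k < N) b k * cexp ((- k%:R * (x1 + y))%:C).
  rewrite mulr_sumr; apply: eq_bigr => k _; rewrite /c2 /mon expr0 mul1r -mulrA; congr (_ * _); rewrite -mulrA; congr (_ * _).
  by rewrite -rmorphM -cexpD -rmorphD -mulrDr.
have van1 y : 0 <= y < d -> van (fun N g => fam c1 nu1 N g + fam c2 nu2 N g) (mon 0 y%:C).
  move=> /andP[y0 yd]; rewrite /van; under eq_fun do rewrite famF famG.
  have xy : x1 + y < hi by lra.
  have yx : lo < x1 + y by lra.
  have := ccvgD (aF _ xy) (ccvgM (ccvg_cst (- s)) (bG _ yx)).
  rewrite (Fs (x1 + y)); last by rewrite addrC addKr ger0_norm.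
  by rewrite mulNr subrr.
have mom := mom_of_interval d0 M12 ds d0 van1.
have dd4 : 0 < d / 4 by rewrite divr_gt0.
have [m m0 hm] := ex_nat_div (2 * pi) dd4.
have m0' : m%:R != 0 :> R[i] by rewrite pnatr_eq0 -lt0n.
pose w : R[i] := ((2 * pi) / m%:R)%:C * 'i%C.
have mw : m%:R * w = (2 * pi)%:C * 'i%C.
  by rewrite /w rmorphM fmorphV rmorph_nat; field.
have w1 (nu : R) : True -> nc (cexp (nu%:C * w)) <= 1.
  move=> _; rewrite nc_cexp /w mulrA -rmorphM ReM /= mulr0 mul0r subr0 expR0//.
have wd : nc w <= d / 4.
  rewrite /w ncM nc_i mulr1 nc_real normrM [X in _ * X]ger0_norm ?invr_ge0//.
have far := van_far d0 M12 m ds w1 wd mom.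
(* The mean of the moments at 0 and at 2 pi i: the half-integer exponents cancel and the integer
   ones remain. *)
have mom2 n : van (fam c2 nu2) (mon n 0).
  have := ccvgM (ccvg_cst 2^-1) (ccvgD (mom n) (far n)).
  rewrite addr0 mulr0 mw /van; congr (ccvg _ _); apply/funext => N.
  suff [-> ->] : fam c1 nu1 N (mon n ((2 * pi)%:C * 'i%C)) = - fam c1 nu1 N (mon n 0) /\
     fam c2 nu2 N (mon n ((2 * pi)%:C * 'i%C)) = fam c2 nu2 N (mon n 0).
    have t0 : 2%:R != 0 :> R[i] by rewrite pnatr_eq0.
    by field.
  split.
    rewrite -sumrN; apply: eq_bigr => k _; rewrite /mon -mulrN -mulrN; congr (_ * (_ * _)).
    rewrite mulr0 cexp0.
    have -> : (nu1 k)%:C * ((2 * pi)%:C * 'i%C) = k%:R * ((2 * pi)%:C * 'i%C) + 'i%C * pi%:C :> R[i].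
      rewrite /nu1 rmorphD rmorph_nat fmorphV rmorph_nat rmorphM rmorph_nat.
      have t0 : 2%:R != 0 :> R[i] by rewrite pnatr_eq0.
      by field.
    by rewrite cexpD cexp_nat cexp_2pi cexp_pi expr1n mul1r.
  apply: eq_bigr => k _; rewrite /mon; congr (_ * (_ * _)).
  rewrite mulr0 cexp0 /nu2 rmorphN rmorph_nat mulNr cexpN cexp_nat cexp_2pi expr1n.
  by rewrite invr1.
have [m' m'0 hm'] := ex_nat_div (x - x1) dd4.
have xx1 : 0 <= x - x1 by lra.
pose w' : R[i] := ((x - x1) / m'%:R)%:C.
have w'd : nc w' <= d / 4.
  by rewrite /w' nc_real normrM [X in _ * X]ger0_norm ?invr_ge0.
have w'1 nu : E2 nu -> nc (cexp (nu%:C * w')) <= 1.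
  move=> [k ->]; rewrite /w' -rmorphM nc_cexp /= -expR0 ler_expR mulNr oppr_le0.
  by rewrite mulr_ge0// divr_ge0.
have := van_far d0 M2 m' ds2 w'1 w'd mom2 0%N.
have -> : m'%:R * w' = (x - x1)%:C.
  have t0 : m'%:R != 0 :> R[i] by rewrite pnatr_eq0 -lt0n.
  by rewrite /w' rmorphM fmorphV rmorph_nat; field.
rewrite /van; under eq_fun do rewrite famG.
rewrite subrKC => v0.
have yx : lo < x by lra.
have := ccvg_unique v0 (ccvgM (ccvg_cst (- s)) (bG _ yx)).
move/esym/eqP; rewrite mulf_eq0 oppr_eq0 => /orP[/eqP s0|/eqP//].
by move: ns; rewrite s0 Normc.normc0 => /esym/eqP; rewrite oner_eq0.
Qed.

End TwoSided.

(** * The Gaussian transforms of u(0) and u(T) *)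

Section GaussianSeries.
Context {R : realType} {n : nat}.
Local Open Scope classical_set_scope.
Implicit Types (x : 'rV[R]_n) (j k : 'I_n).

Lemma Wt_gauss_le (d : R) x : 0 < d -> Wt x * expR (- d * sqr_enorm x) <= (1 + d^-1) ^+ n.
Proof.
move=> d0; have dV : 0 < d^-1 by rewrite invr_gt0.
rewrite /Wt /Wsub big_enum /= /sqr_enorm mulr_sumr expR_sum -big_split /=.
rewrite -[X in (1 + d^-1) ^+ X](card_ord n) -prodr_const; apply: ler_prod => k _.
have w0 : 0 < wj k x := wj_gt0 k x.
rewrite mulr_ge0 ?expR_ge0 ?(ltW w0)//= mulNr expRN ler_pdivrMr ?expR_gt0//.
apply: le_trans (_ : _ <= (1 + d^-1) * (1 + d * x 0 k ^+ 2)) _; last first.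
  by apply: ler_wpM2l; [rewrite addr_ge0// ltW|exact: expR_ge1Dx].
rewrite /wj /oneDsqr mulrDr mulrDl mulrA mulrDl mulVf ?gt_eqF// !mul1r mulr1.
have : 0 <= x 0 k ^+ 2 by rewrite sqr_ge0.
have : 0 <= d * x 0 k ^+ 2 by rewrite mulr_ge0 ?sqr_ge0 ?ltW.
by move=> *; lra.
Qed.

Variables (V : 'rV[R]_n -> R[i]) (K al rho : R) (j : 'I_n) (y0 : R).
Hypotheses (sV : sepc V) (bV : forall x, nc (V x) <= K * expR (- al * sqr_enorm x)).
Hypotheses (rho0 : 0 < rho) (rho_al : rho < al).

Definition sqd x : R := (x 0 j - y0) ^+ 2.
Definition gser (s : R) : R[i] := Ig (fun x => V x * cexp (- (s * sqd x)%:C)).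
Definition gcoef (k : nat) : R[i] := Ig (fun x => V x * ((- (sqd x)%:C) ^+ k / (k`!%:R))).

(** The surplus al - rho = 2 d is split: one d pays for the weight, the other absorbs the cross term
    of (x_j - y0)^2 by completing the square. *)
Lemma gser_dom : exists2 C, 0 <= C & forall x, Wt x * (nc (V x) * expR (rho * sqd x)) <= C.
Proof.
have K0 : 0 <= K.
  have := le_trans (nc_ge0 _) (bV 0); by rewrite pmulr_lge0 ?expR_gt0.
pose d := (al - rho) / 2.
have d0 : 0 < d by rewrite divr_gt0 ?subr_gt0.
pose c := rho ^+ 2 * y0 ^+ 2 / d + rho * y0 ^+ 2.
exists (K * (expR c * (1 + d^-1) ^+ n)).
  by rewrite mulr_ge0// mulr_ge0 ?expR_ge0// exprn_ge0// addr_ge0// invr_ge0 ltW.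
move=> x; have W0 := ltW (Wt_gt0 x).
apply: le_trans (_ : _ <= Wt x * (K * expR (- d * sqr_enorm x + c))) _; last first.
  rewrite expRD mulrCA ler_wpM2l// mulrA mulrC ler_wpM2l ?expR_ge0//.
  exact: Wt_gauss_le.
rewrite ler_wpM2l//; apply: le_trans (ler_wpM2r (expR_ge0 _) (bV x)) _.
rewrite -mulrA -expRD ler_wpM2l// ler_expR.
have xj : x 0 j ^+ 2 <= sqr_enorm x.
  by rewrite /sqr_enorm (bigD1 j)//= lerDl; apply: sumr_ge0 => k _; exact: sqr_ge0.
have e : (rho + d) * x 0 j ^+ 2 + c - rho * sqd x = d * (x 0 j + rho * y0 / d) ^+ 2.
  by rewrite /sqd /c; field; rewrite gt_eqF.
have h1 : 0 <= d * (x 0 j + rho * y0 / d) ^+ 2 by rewrite mulr_ge0 ?sqr_ge0 ?ltW.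
have h2 : (rho + d) * x 0 j ^+ 2 <= (rho + d) * sqr_enorm x by rewrite ler_wpM2l// addr_ge0 ?ltW.
have ad : al = rho + d + d by rewrite /d; lra.
rewrite ad; move: e h1 h2; nra.
Qed.

Lemma cont_shift_sqr (c y1 : R) : ccontinuous (fun y : R => (c * (y - y1) ^+ 2)%:C).
Proof.
apply: ccont_real => y; apply: cvgM; first exact: cvg_cst.
apply: (@continuous_comp _ _ _ (fun y : R => y - y1) (fun y => y ^+ 2)).
  by apply: cvgB; [exact: cvg_id|exact: cvg_cst].
exact: exprn_continuous.
Qed.

Lemma ccont_cexp (f : R -> R[i]) : ccontinuous f -> ccontinuous (fun y => cexp (f y)).
Proof.
move=> [f1 f2]; rewrite /cexp; apply: ccontM.
  apply: ccont_real => y; apply: continuous_comp; [exact: f1|exact: continuous_expR].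
split => y /=; apply: continuous_comp; [exact: f2|exact: continuous_cos|exact: f2|exact: continuous_sin].
Qed.

Lemma sepc_sqd : sepc (fun x => (sqd x)%:C).
Proof.
have := sepc_coord j (cont_shift_sqr 1 y0).
by rewrite /sqd; under eq_fun do rewrite mul1r.
Qed.

Lemma sepc_exp (s : R) : sepc (fun x => cexp (- (s * sqd x)%:C)).
Proof.
have := sepc_coord j (ccont_cexp (cont_shift_sqr (- s) y0)).
by rewrite /sqd; under eq_fun do rewrite mulNr rmorphN.
Qed.

Lemma sepc_pow (f : 'rV[R]_n -> R[i]) (k : nat) : sepc f -> sepc (fun x => f x ^+ k).
Proof.
move=> sf; elim: k => [|k IH]; first by under eq_fun do rewrite expr0; exact: sepc_cst.
by under eq_fun do rewrite exprS; exact: (sepcM sf IH).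
Qed.

Lemma sepc_gcoef (k : nat) : sepc (fun x => V x * ((- (sqd x)%:C) ^+ k / (k`!%:R))).
Proof.
apply: (sepcM sV); apply: sepcM; last exact: sepc_cst.
apply: sepc_pow; under eq_fun do rewrite -mulN1r.
exact: (sepcM (sepc_cst (-1)) sepc_sqd).
Qed.

Lemma gcoef_dom : exists2 C, 0 <= C & forall (s : R) (k : nat), 0 <= s -> s <= rho ->
  dom C (fun x => (s ^+ k)%:C * (V x * ((- (sqd x)%:C) ^+ k / (k`!%:R)))).
Proof.
have [C C0 hC] := gser_dom; exists (2 * C) => [|s k s0 sr]; first by rewrite mulr_ge0.
apply/domE => x.
have -> : (s ^+ k)%:C * (V x * ((- (sqd x)%:C) ^+ k / (k`!%:R))) = V x * ((- (s * sqd x)%:C) ^+ k / (k`!%:R)).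
  by rewrite rmorphXn /= (rmorphM _ s) -mulrN exprMn; ring.
have W0 := ltW (Wt_gt0 x); have q0 : 0 <= sqd x by exact: sqr_ge0.
apply: le_trans (_ : _ <= Wt x * (nc (V x) * (2 * expR (rho * sqd x)))) _; last first.
  by have := hC x; nra.
rewrite ler_wpM2l// ncM ler_wpM2l ?nc_ge0//; apply: le_trans (pow_fact_le _ _) _.
rewrite ler_wpM2l// ler_expR ncN nc_real ger0_norm ?(mulr_ge0 s0 q0)//.
by rewrite ler_wpM2r.
Qed.

(** The k-th Taylor term of exp(- rho (x_j - y0)^2) is at most 2 exp(rho (x_j - y0)^2), which the
    decay of [V] beats uniformly in k. *)
Lemma gcoef_bound : exists C, forall k : nat, nc (gcoef k) * rho ^+ k <= C.
Proof.
have [C C0 hC] := gcoef_dom; exists (kap ^+ n * C) => k.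
have rk : 0 < rho ^+ k by rewrite exprn_gt0.
have d1 := hC rho k (ltW rho0) (lexx _).
have d2 := domZ ((rho ^- k)%:C) d1.
have e (x : 'rV[R]_n) : (rho ^- k)%:C * ((rho ^+ k)%:C * (V x * ((- (sqd x)%:C) ^+ k / (k`!%:R)))) = V x * ((- (sqd x)%:C) ^+ k / (k`!%:R)).
  by rewrite mulrA -rmorphM mulVf ?gt_eqF// mul1r.
rewrite (_ : (fun x => _) = fun x => V x * ((- (sqd x)%:C) ^+ k / (k`!%:R))) in d2; last exact/funext.
have := Ig_bound (sepcM (sepc_cst ((rho ^+ k)%:C)) (sepc_gcoef k)) d1.
rewrite (IgZ _ (sepc_gcoef k) d2) ncM nc_real ger0_norm ?(ltW rk)// mulrC; exact.
Qed.

Lemma gser_cvg (s : R) : 0 <= s -> s <= rho ->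
  ccvg (fun N => \sum_(k < N) gcoef k * (s ^+ k)%:C) (gser s).
Proof.
move=> s0 sr; have [C C0 hC] := gcoef_dom; have [C' C'0 hC'] := gser_dom.
have key N : \sum_(k < N) gcoef k * (s ^+ k)%:C = Ig (fun x => V x * texp N (- (s * sqd x)%:C)).
  transitivity (Ig (fun x => \sum_(k < N) (s ^+ k)%:C * (V x * ((- (sqd x)%:C) ^+ k / (k`!%:R))))).
    rewrite (@Ig_sum _ _ _ (index_enum _) _ (fun=> C)).
    - apply: eq_bigr => k _; have [Ck hCk] : exists Ck, dom Ck (fun x => V x * ((- (sqd x)%:C) ^+ k / (k`!%:R))).
        exists (nc (rho ^- k)%:C * C); have := domZ ((rho ^- k)%:C) (hC rho k (ltW rho0) (lexx _)).
        rewrite (_ : (fun x => _) = fun x => V x * ((- (sqd x)%:C) ^+ k / (k`!%:R)))//.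
        apply/funext => x; rewrite mulrA -rmorphM mulVf ?mul1r// gt_eqF// exprn_gt0//.
      by rewrite (IgZ _ (sepc_gcoef k) hCk) mulrC.
    - by move=> k; exact: (sepcM (sepc_cst _) (sepc_gcoef k)).
    - by move=> k; exact: hC.
  apply: Ig_ext => x; rewrite /texp mulr_sumr; apply: eq_bigr => k _.
  by rewrite rmorphXn /= (rmorphM _ s) -mulrN exprMn; ring.
under eq_fun do rewrite key.
have spow (k : nat) : sepc (fun x : 'rV[R]_n => (- (s * sqd x)%:C) ^+ k / (k`!%:R)).
  apply: sepcM; last exact: sepc_cst.
  apply: sepc_pow; under eq_fun do rewrite -mulN1r rmorphM.
  exact: (sepcM (sepc_cst (-1)) (sepcM (sepc_cst _) sepc_sqd)).
apply: (@Ig_cvg _ _ _ _ (2 * C')).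
- by move=> N; apply: (sepcM sV); exact: (sepc_sum (index_enum _) xpredT (fun k : 'I_N => spow k)).
- exact: (sepcM sV (sepc_exp s)).
- move=> N; apply/domE => x.
  have W0 := ltW (Wt_gt0 x); have q0 : 0 <= sqd x by exact: sqr_ge0.
  apply: le_trans (_ : _ <= Wt x * (nc (V x) * (2 * expR (rho * sqd x)))) _; last first.
    by have := hC' x; nra.
  rewrite ler_wpM2l// ncM ler_wpM2l ?nc_ge0//; apply: le_trans (texp_le _ _) _.
  rewrite ler_wpM2l// ler_expR ncN nc_real ger0_norm ?(mulr_ge0 s0 q0)//.
  by rewrite ler_wpM2r.
- by move=> x; apply: ccvgM; [exact: ccvg_cst|exact: texp_cvg].
Qed.

Lemma gser_cont (f : R -> R) : continuous f -> (forall t : R, 0 <= f t) ->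
  ccontinuous (fun t : R => gser (f t)).
Proof.
move=> cf f0; have [C C0 hC] := gser_dom.
apply: seq_ccont => v p vp.
apply: (@Ig_cvg _ _ (fun i x => V x * cexp (- (f (v i) * sqd x)%:C)) _ C).
- by move=> i; exact: (sepcM sV (sepc_exp _)).
- exact: (sepcM sV (sepc_exp _)).
- move=> i; apply/domE => x; apply: le_trans (hC x).
  rewrite ler_wpM2l ?(ltW (Wt_gt0 x))// ncM ler_wpM2l ?nc_ge0// nc_cexp /= ler_expR.
  have q0 : 0 <= sqd x by exact: sqr_ge0.
  have : 0 <= f (v i) * sqd x by rewrite mulr_ge0.
  have : 0 <= rho * sqd x by rewrite mulr_ge0// ltW.
  lra.
move=> x; apply: ccvgM; first exact: ccvg_cst.
have c : ccontinuous (fun y : R => cexp (- (f y * sqd x)%:C)).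
  apply: ccont_cexp; under eq_fun do rewrite -rmorphN.
  apply: ccont_real => y; apply: cvgN; apply: cvgM; [exact: cf|exact: cvg_cst].
exact: (ccont_seq c vp).
Qed.

End GaussianSeries.

(** * A vanishing criterion and the separation of coordinate j *)

Section Uniqueness.
Context {R : realType} {n : nat}.
Local Open Scope classical_set_scope.
Implicit Types (x X : 'rV[R]_n) (j k : 'I_n).

Lemma sepc_cexp_sum (f : 'I_n -> R -> R[i]) : (forall k, ccontinuous (f k)) ->
  sepc (fun x => cexp (\sum_k f k (x 0 k))).
Proof.
move=> cf; have h := sepc_prod (index_enum _) xpredT (fun k => sepc_coord k (ccont_cexp (cf k))).
by under eq_fun do rewrite cexp_sum.
Qed.

Lemma line_cexp_sum (f : 'I_n -> R -> R[i]) x z : (forall k, ccontinuous (f k)) ->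
  ccontinuous (fun p : R => cexp (\sum_k f k ((x + p *: z) 0 k))).
Proof.
move=> cf; apply: ccont_cexp; apply: (@ccont_sum R _ (index_enum _) xpredT (fun k p => f k ((x + p *: z) 0 k))) => k.
apply: ccont_comp; first exact: cf.
under eq_fun do rewrite !mxE.
by move=> p; apply: cvgD; [exact: cvg_cst|apply: cvgM; [exact: cvg_id|exact: cvg_cst]].
Qed.

Lemma cont_chirp1 (c : R) : ccontinuous (fun y : R => 'i%C * (c * y ^+ 2)%:C).
Proof. exact: cder_continuous (fun y => cderZ 'i%C (cder_real (is_derive_sqr y c))). Qed.

Variable lam : R.

Lemma cont_E0 (r B : 'I_n -> R) X k :
  ccontinuous (fun y : R => 'i%C * (lam * r k * y ^+ 2)%:C - (B k * (y - X 0 k) ^+ 2)%:C).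
Proof.
have := ccontD (cont_chirp1 (lam * r k)) (cont_shift_sqr (- B k) (X 0 k)).
by under eq_fun do rewrite mulNr rmorphN.
Qed.

Lemma sepc_E0 r B X : sepc (E0 lam r B X).
Proof. exact: (sepc_cexp_sum (cont_E0 r B X)). Qed.

Lemma nc_E0 r B X x : (forall k, 0 <= B k) -> nc (E0 lam r B X x) <= 1.
Proof.
move=> B0; rewrite /E0 nc_cexp Re_sum -expR0 ler_expR; apply: sumr_le0 => k _.
rewrite ReD ReN ReM /=.
have : 0 <= B k * (x 0 k - X 0 k) ^+ 2 by rewrite mulr_ge0// sqr_ge0.
lra.
Qed.

Lemma sepc_E1 (Ss : 'I_n -> R -> R) r B X (t : R) : sepc (E1 lam Ss r B X t).
Proof.
apply: (@sepc_cexp_sum (fun k y => - (lam ^+ 2 / (B k * Ss k t ^+ 2) * y ^+ 2)%:C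
  + 'i%C * (- (lam * r k * y ^+ 2) + 2 * lam * X 0 k * y / Ss k t)%:C)) => k.
have h1 := cder_continuous (fun y => cderN (cder_real (is_derive_sqr y (lam ^+ 2 / (B k * Ss k t ^+ 2))))).
have dl (y : R) : is_derive y (1 : R) (fun y => 2 * lam * X 0 k / Ss k t * y) (2 * lam * X 0 k / Ss k t).
  have := is_derive_mul (is_derive_cst (2 * lam * X 0 k / Ss k t) y (1 : R)) (is_derive_id y (1 : R)).
  by move/is_derive_val; apply; rewrite mul0r addr0 mulr1.
have h2 := cder_continuous (fun y => cderZ 'i%C (cder_real (is_derive_add (is_derive_sqr y (- (lam * r k))) (dl y)))).
have := ccontD h1 h2; congr (ccontinuous _); apply/funext => y.
by congr (_ + _ * (_ + _)%:C); ring.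
Qed.

Lemma nc_E1 (Ss : 'I_n -> R -> R) r B X (t : R) x : (forall k, 0 <= B k) -> nc (E1 lam Ss r B X t x) <= 1.
Proof.
move=> B0; rewrite /E1 nc_cexp Re_sum -expR0 ler_expR; apply: sumr_le0 => k _.
rewrite ReD ReN ReM /=.
have : 0 <= lam ^+ 2 / (B k * Ss k t ^+ 2) * x 0 k ^+ 2.
  by rewrite mulr_ge0 ?sqr_ge0// divr_ge0 ?sqr_ge0// mulr_ge0 ?sqr_ge0.
lra.
Qed.

(* With c = 0 this removes the quadratic term of coordinate j from E0, and also from
   E1, whose coefficient lam^2 / (c Ss^2) is then 0 by the convention x / 0 = 0. *)
Definition setc j (c b : R) k : R := if k == j then c else b.

Lemma E0_split r j (c b : R) X x :
  E0 lam r (setc j c b) X x = E0 lam r (setc j 0 b) X x * cexp (- (c * sqd j (X 0 j) x)%:C).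
Proof.
rewrite /E0 -cexpD; congr cexp; rewrite (bigD1 j)//= [in RHS](bigD1 j)//= [in RHS]addrAC.
congr (_ + _); last by apply: eq_bigr => k kj; rewrite /setc (negbTE kj).
by rewrite /setc eqxx mul0r rmorph0 subr0.
Qed.

Lemma E1_split (Ss : 'I_n -> R -> R) r j (c b : R) X (t : R) x :
  E1 lam Ss r (setc j c b) X t x = E1 lam Ss r (setc j 0 b) X t x *
  cexp (- (lam ^+ 2 / Ss j t ^+ 2 * c^-1 * sqd j 0 x)%:C).
Proof.
rewrite /E1 -cexpD; congr cexp; rewrite (bigD1 j)//= [in RHS](bigD1 j)//= [in RHS]addrAC.
congr (_ + _); last by apply: eq_bigr => k kj; rewrite /setc (negbTE kj).
rewrite /setc eqxx mul0r invr0 mulr0 mul0r rmorph0 oppr0 add0r addrC /sqd subr0.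
by congr (- _%:C + _); rewrite invfM; ring.
Qed.

(** As b -> oo the Gaussians concentrate at [X], and the chirp in [E0] does not change the modulus
    there, so [approx_id] isolates v(X). *)
Lemma gauss_vanish (v : 'rV[R]_n -> R[i]) (C rho : R) (r : 'I_n -> R) X : sepc v -> bdd C v ->
  (forall z, ccontinuous (fun p : R => v (X + p *: z))) -> 0 <= rho ->
  (forall b, rho <= b -> 0 < b -> Ig (fun x => v x * E0 lam r (fun=> b) X x) = 0) -> v X = 0.
Proof.
move=> cv bv lv rho0 h.
(* Adding [rho] ensures b = rr^(-2) >= rho for every index. *)
pose rr (i : nat) : R := (i.+1%:R + rho)^-1.
have p0 (i : nat) : 0 < i.+1%:R + rho by rewrite ltr_wpDr// ltr0n.
have rr0 i : 0 < rr i by rewrite invr_gt0.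
have rrc : rr i @[i --> \oo] --> (0 : R).
  apply: (squeeze_cvgr (f := fun=> 0) (h := fun i => i.+1%:R^-1 : R)); [|exact: cvg_cst|exact: cvg_harmonic].
  apply: nearW => i; rewrite ltW//= /rr lef_pV2 ?posrE ?p0 ?ltr0n//.
  by rewrite lerDl.
pose ch x : R[i] := cexp (\sum_k 'i%C * (lam * r k * x 0 k ^+ 2)%:C).
have sch : sepc ch := sepc_cexp_sum (fun k => cont_chirp1 (lam * r k)).
have lch z : ccontinuous (fun p : R => ch (X + p *: z)).
  exact: (@line_cexp_sum (fun k y => 'i%C * (lam * r k * y ^+ 2)%:C) X z (fun k => cont_chirp1 (lam * r k))).
have nch x : nc (ch x) = 1.
  by rewrite /ch cexp_sum nc_prod big1// => k _; rewrite nc_chirp.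
have bg : bdd C (fun x => v x * ch x) by move=> x; rewrite ncM nch mulr1; exact: bv.
have := approx_id (sepcM cv sch) (fun z => ccontM (lv z) (lch z)) bg rr0 rrc.
rewrite (_ : (fun i => _) = fun=> 0); last first.
  apply/funext => i; rewrite [X in _ * X](_ : _ = 0) ?mulr0//.
  have b0 : 0 < rr i ^- 2 by rewrite invr_gt0 exprn_gt0.
  have rb : rho <= rr i ^- 2.
    rewrite /rr exprVn invrK; have := p0 i; have : 1 <= i.+1%:R :> R by rewrite ler1n.
    nra.
  rewrite -(h _ rb b0); apply: Ig_ext => x; rewrite mulrCA; congr (_ * _).
  rewrite /E0 big_split /= cexpD -/(ch x) mulrC; congr (_ * _).
  rewrite /gaus /gaus0 /sqr_enorm sumrN -rmorph_sum -rmorphN cexp_real; congr (expR _)%:C.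
  by congr (- _); apply: eq_bigr => k _; rewrite !mxE exprMn exprVn.
move=> h0; have /esym/eqP := ccvg_unique (ccvg_cst 0) h0.
rewrite mulf_eq0 (negbTE gmass_neq0) /= mulf_eq0 => /orP[/eqP//|].
by rewrite -nc_eq0 nch oner_eq0.
Qed.

(** The midpoint of 1 and 1/kap works by the inequality of arithmetic and geometric means. It is
    used to replace the decay rates by slightly smaller ones whose product still satisfies the
    strict inequality; [kap] is a local variable here. *)
Lemma ex_ratio (kap : R) : 1 < kap -> exists t : R, [/\ 0 < t, t < 1 & 1 < t ^+ 2 * kap].
Proof.
move=> k1; have k0 : 0 < kap by apply: lt_trans k1.
have kV : kap^-1 < 1 by rewrite invf_lt1.
have kV0 : 0 < kap^-1 by rewrite invr_gt0.
exists ((1 + kap^-1) / 2); split; try lra.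
rewrite -ltr_pdivrMr// div1r -subr_gt0.
have -> : ((1 + kap^-1) / 2) ^+ 2 - kap^-1 = ((1 - kap^-1) / 2) ^+ 2 by field; rewrite gt_eqF.
by rewrite exprn_gt0// divr_gt0// subr_gt0.
Qed.

End Uniqueness.

(** * Hardy's argument in coordinate j *)

Section Hardy.
Context {R : realType} {n : nat}.
Local Open Scope classical_set_scope.
Implicit Types (x X : 'rV[R]_n) (j k : 'I_n).
Variables (lam : R) (q : 'I_n -> R).
Hypothesis lam0 : 0 < lam.
Hypothesis n_gt0 : (0 < n)%N.
Variables (Cs Ss : 'I_n -> R -> R).
Hypothesis dCs : forall k t, is_derive t (1 : R) (Cs k) (- q k * Ss k t).
Hypothesis dSs : forall k t, is_derive t (1 : R) (Ss k) (Cs k t).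
Hypothesis Cs0 : forall k, Cs k 0 = 1.
Hypothesis Ss0 : forall k, Ss k 0 = 0.
Variable (u : R -> 'rV[R]_n -> R[i]).
Hypothesis hS : forall t, schwartz (u t).
Hypothesis du : forall x t, cder (u ^~ x) t (Lop lam q (u t) (fun j => up2 u j t) x).

Let unice := u_nice hS.
Let lb := locally_bounded lam0 n_gt0 dCs dSs Cs0 Ss0 hS du.

Lemma u_bdd t : exists C, bdd C (u t).
Proof. by have [C h] := lb t t; exists C => x; have [] := h t _ x; rewrite ?lexx. Qed.

(** A Gaussian family concentrated at [X] at time t is carried to time 0, where the pairing is 0;
    [gauss_vanish] concludes. Both signs of t are covered. *)
Lemma zero_forward : (forall x, u 0 x = 0) -> forall t x, u t x = 0.
Proof.
move=> u00 t X; have [C bC] := u_bdd t.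
apply: (gauss_vanish (lam := lam) (r := fun=> 0) (sepc_u unice t) bC (fun z => u_line hS t X z) (lexx 0)) => b _ b0.
have B0 (k : 'I_n) : 0 < (fun=> b : R) k by [].
have [La [dLa La0]] := La_exists lam0 dCs dSs Cs0 Ss0 (fun=> 0) B0.
have gf := Gfam_shift (- t) (Gfam_explicit lam0 dCs dSs Cs0 Ss0 X B0 dLa).
set al := (fun k s => _) in gf.
set be := (fun k s => _) in gf.
set ga := (fun k s => _) in gf.
have g0 : gph (at_ al t) (at_ be t) (at_ ga t) = E0 lam (fun=> 0) (fun=> b) X.
  rewrite -(gph_at0 q lam0 Cs0 Ss0 (fun=> 0) (fun=> b) X La0) /al /be /ga /at_ /=.
  by under eq_fun do rewrite subrr; under [X in gph _ X _]eq_fun do rewrite subrr;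
     under [X in gph _ _ X]eq_fun do rewrite subrr.
have st : Num.min 0 t <= Num.max 0 t by rewrite ge_min le_max lexx.
have sI : Num.min 0 t <= 0 <= Num.max 0 t by rewrite ge_min le_max !lexx.
have tI : Num.min 0 t <= t <= Num.max 0 t by rewrite ge_min le_max !lexx !orbT.
have [D hD] := lb (Num.min 0 t) (Num.max 0 t).
have hu : ubd lam q u (up2 u) D (Num.min 0 t) (Num.max 0 t) by move=> z x zI; exact: hD.
have := pairing_const lam0 unice du n_gt0 gf st hu tI sI.
rewrite /pairing g0 => ->; rewrite -[RHS](@Ig0 R n); apply: Ig_ext => x.
by rewrite u00 mul0r.
Qed.

Lemma cexp_sqr_half (s : R) : cexp ((s / 2)%:C) ^+ 2 = (expR s)%:C.
Proof. by rewrite expr2 -cexpD -rmorphD -splitr cexp_real. Qed.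

Variables (T al be K : R) (j : 'I_n).
Hypotheses (al0 : 0 < al) (be0 : 0 < be).
Hypothesis ST : forall k, Ss k T != 0.
Hypothesis h0 : forall x, nc (u 0 x) <= K * expR (- al * sqr_enorm x).
Hypothesis hT : forall x, nc (u T x) <= K * expR (- be * sqr_enorm x).
Hypothesis hab : 1 < al * be * (Ss j T / lam) ^+ 2.

Lemma hardy_zero x : u 0 x = 0.
Proof.
have [t [t0 t1 ht]] := ex_ratio hab.
have r1 : 0 < al * t by rewrite mulr_gt0.
have r1a : al * t < al by rewrite gtr_pMr.
have r2 : 0 < be * t by rewrite mulr_gt0.
have r2b : be * t < be by rewrite gtr_pMr.
have [C bC] := u_bdd 0.
pose r k := Cs k T / Ss k T.
(* The pairing has to vanish for b >= al t, at or past the edge of the domain used for the series of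
   [P]. It is reached through P = A Q, once [Q] is known to vanish there. *)
apply: (gauss_vanish (lam := lam) (r := r) (sepc_u unice 0) bC (fun z => u_line hS 0 x z) (ltW r1)) => b bge b0.
set X := x.
have Sj2 : 0 < Ss j T ^+ 2 by rewrite lt_def sqrf_eq0 sqr_ge0 andbT ST.
pose eta := lam ^+ 2 / Ss j T ^+ 2.
have eta0 : 0 < eta by apply: divr_gt0 => //; rewrite exprn_gt0.
pose V0 z := u 0 z * E0 lam r (setc j 0 b) X z.
pose V1 z := u T z * E1 lam Ss r (setc j 0 b) X T z.
have s0 k : 0 <= setc j 0 b k by rewrite /setc; case: eqP => // _; exact: ltW.
have sV0 : sepc V0 := sepcM (sepc_u unice 0) (sepc_E0 lam r _ X).
have sV1 : sepc V1 := sepcM (sepc_u unice T) (sepc_E1 lam Ss r _ X T).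
have bV0 z : nc (V0 z) <= K * expR (- al * sqr_enorm z).
  by apply: le_trans (h0 z); rewrite ncM ler_piMr ?nc_ge0// nc_E0.
have bV1 z : nc (V1 z) <= K * expR (- be * sqr_enorm z).
  by apply: le_trans (hT z); rewrite ncM ler_piMr ?nc_ge0// nc_E1.
pose kap0 : R[i] := \prod_k ('i%C * (lam / (setc j 1 b k * Ss k T))%:C).
have iC := @i_neq0 R.
have kap00 : kap0 != 0.
  apply/prodf_neq0 => k _; rewrite mulf_neq0// fmorph_eq0 mulf_neq0 ?(negbT (gt_eqF lam0))//.
  rewrite invr_eq0 mulf_neq0// /setc; case: (k =P j) => _; first exact: oner_neq0.
  by rewrite gt_eqF.
(* The variable is s = ln B_j; all other coordinates keep the parameter b inside [V0] and [V1]. *)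
pose P s := gser V0 j (X 0 j) (expR s).
pose Q s := gser V1 j 0 (eta * expR (- s)).
have tr (s : R) : exists2 A : R[i], A ^+ 2 = kap0 * (expR (- s))%:C & P s = A * Q s.
  have B0 k : 0 < setc j (expR s) b k by rewrite /setc; case: eqP => _ //; exact: expR_gt0.
  have := transfer lam0 n_gt0 dCs dSs Cs0 Ss0 unice du X (s := 0) (t := T) (B := setc j (expR s) b) (lb _ _).
  rewrite subr0 => /(_ ST B0)[A [hA PQ _]]; exists A.
    rewrite hA /kap0 (bigD1 j)//= [in RHS](bigD1 j)//= [RHS]mulrAC; congr (_ * _); last first.
      by apply: eq_bigr => k kj; rewrite /setc (negbTE kj).
    rewrite /setc eqxx mul1r -mulrA -rmorphM; congr (_ * _%:C).
    by rewrite expRN invfM mulrAC mulrA.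
  rewrite /P /Q /gser; transitivity (Ig (fun z => u 0 z * E0 lam r (setc j (expR s) b) X z)).
    by apply: Ig_ext => z; rewrite E0_split mulrA.
  rewrite PQ; congr (_ * _); apply: Ig_ext => z; rewrite E1_split mulrA expRN.
  by [].
(* Any square root will do, as F and Q are compared through their squares. *)
pose c := sqrtc kap0^-1.
have c2 : c ^+ 2 = kap0^-1 by exact: sqr_sqrtc.
pose F s := c * cexp ((s / 2)%:C) * P s.
have FQ s : F s ^+ 2 = Q s ^+ 2.
  have [A A2 PA] := tr s; rewrite /F PA; move: (cexp_sqr_half s); move: (cexp _) => e e2; rewrite !exprMn c2 A2 e2.
  transitivity ((kap0^-1 * kap0) * ((expR s)%:C * (expR (- s))%:C) * Q s ^+ 2); first by ring.
  by rewrite mulVf// -rmorphM -expRD subrr expR0 !mul1r.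
have cP : ccontinuous P.
  by have := gser_cont j (X 0 j) sV0 bV0 r1 r1a (@continuous_expR R) (fun s => expR_ge0 s); exact.
have cQ : ccontinuous Q.
  apply: (gser_cont j 0 sV1 bV1 r2 r2b) => [s|s]; last by rewrite mulr_ge0 ?expR_ge0 ?(ltW eta0).
  apply: cvgM; first exact: cvg_cst.
  by apply: (@continuous_comp _ _ _ (fun s : R => - s) expR); [apply: cvgN; exact: cvg_id|exact: continuous_expR].
have cF : ccontinuous F.
  apply: ccontM => //; apply: ccontM; first exact: ccont_cst.
  apply: ccont_cexp; apply: ccont_real => s; apply: cvgM; [exact: cvg_id|exact: cvg_cst].
have [C1 hC1] := gcoef_bound j (X 0 j) sV0 bV0 r1 r1a.
have [C2 hC2] := gcoef_bound j 0 sV1 bV1 r2 r2b.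
have C10 : 0 <= C1 by apply: le_trans (hC1 0%N); rewrite mulr1 nc_ge0.
have C20 : 0 <= C2 by apply: le_trans (hC2 0%N); rewrite mulr1 nc_ge0.
(* The edges of the two domains of convergence in the variable s. Here lo < hi amounts to 1 < t^2 al
   be (Ss_j(T) / lam)^2, which is how [t] was chosen. *)
pose hi := ln (al * t); pose lo := - ln (be * t / eta).
have r2e : 0 < be * t / eta by rewrite divr_gt0.
have ehi : expR hi = al * t by rewrite lnK.
have elo : expR (- lo) = be * t / eta by rewrite opprK lnK.
have lohi : lo < hi.
  rewrite -ltr_expR ehi -[lo]opprK expRN elo invf_div ltr_pdivrMr// /eta ltr_pdivrMr//.
  rewrite [ltRHS](_ : _ = lam ^+ 2 * (t ^+ 2 * (al * be * (Ss j T / lam) ^+ 2))).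
    by rewrite ltr_pMr// exprn_gt0.
  by field; rewrite gt_eqF.
have Q0 := @two_sided _ F Q (fun k : nat => c * gcoef V0 j (X 0 j) k)
  (fun k : nat => gcoef V1 j 0 k * (eta ^+ k)%:C) lo hi (nc c * C1 + C2) lohi cF cQ FQ.
have {}Q0 : forall s, hi <= s -> Q s = 0.
  apply: Q0.
  - move=> s sh; have es : expR s <= al * t by rewrite -ehi ler_expR ltW.
    have := ccvgM (ccvg_cst (c * cexp ((s / 2)%:C))) (gser_cvg j (X 0 j) sV0 bV0 r1 r1a (expR_ge0 s) es).
    congr (ccvg _ _); apply/funext => N; rewrite mulr_sumr; apply: eq_bigr => k _.
    rewrite -mulrA -[RHS]mulrA; congr (_ * _); rewrite mulrCA; congr (_ * _).
    rewrite mulrDl rmorphD cexpD mulrC; congr (_ * _); last by rewrite mulrC.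
    by rewrite cexp_real expRM_natl.
  - move=> s ls; have es : eta * expR (- s) <= be * t.
      by rewrite mulrC -ler_pdivlMr// -elo ler_expR lerN2 ltW.
    have es0 : 0 <= eta * expR (- s) by rewrite mulr_ge0 ?expR_ge0 ?(ltW eta0).
    have := gser_cvg j 0 sV1 bV1 r2 r2b es0 es.
    congr (ccvg _ _); apply/funext => N; apply: eq_bigr => k _.
    rewrite -[RHS]mulrA; congr (_ * _); rewrite exprMn rmorphM; congr (_ * _).
    have -> : - k%:R * s = k%:R * - s by rewrite mulNr mulrN.
    by rewrite cexp_real expRM_natl.
  - move=> k; rewrite expRM_natl ehi ncM -mulrA; apply: ler_wpDr => //.
    by rewrite ler_wpM2l ?nc_ge0.
  move=> k; rewrite mulNr -mulrN expRM_natl elo ncM nc_real ger0_norm ?exprn_ge0 ?(ltW eta0)//.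
  rewrite -mulrA -exprMn (_ : eta * (be * t / eta) = be * t); last by field; rewrite gt_eqF.
  by apply: ler_wpDl; first by rewrite mulr_ge0 ?nc_ge0.
have [A _ PA] := tr (ln b).
have bi : hi <= ln b by rewrite ler_ln ?posrE.
have Pz : P (ln b) = 0 by rewrite PA (Q0 _ bi) mulr0.
have eb : (fun=> b) = setc j b b by apply/funext => k; rewrite /setc; case: ifP.
rewrite eb -[RHS]Pz /P /gser lnK ?posrE//; apply: Ig_ext => z.
by rewrite /V0 (E0_split lam r j b b X z) mulrA.
Qed.

End Hardy.

(** * The functions sin(omega t) / omega and cos(omega t) for real or imaginary omega *)

Section Trigonometric.
Context {R : realType}.
Implicit Types (t : R) (w z : R[i]).

Lemma csin0 : csin 0 = 0 :> R[i].
Proof. by rewrite /csin mulr0 oppr0 subrr mul0r. Qed.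

Lemma csinE z : csin z = (cexp ('i%C * z) - cexp (- ('i%C * z))) * (- 'i%C / 2).
Proof. by rewrite /csin invfM invr_i mulrC -[in RHS]mulrC; congr (_ * _); rewrite mulrC. Qed.

Lemma cexp_i (x : R) : cexp ('i%C * x%:C) = (cos x)%:C + 'i%C * (sin x)%:C.
Proof.
have -> : 'i%C * x%:C = 0 +i* x by apply: eq_ReIm; rewrite ?ReM ?ImM /=; ring.
by rewrite /cexp /= expR0 mul1r; apply: eq_ReIm; rewrite ?(ReM, ImM, ReD, ImD) /=; ring.
Qed.

(** A real square forces [w] to be real or purely imaginary; the quotient is sin(a t) / a in the
    first case and sinh(a t) / a in the second. *)
Lemma csin_real_quot w t : w != 0 -> w ^+ 2 \is Num.real -> cIm (csin (w * t%:C) / w) = 0.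
Proof.
move=> w0 wr; have i0 := i_neq0; have i2 := sqr_i R; have t0 : 2%:R != 0 :> R[i] by rewrite pnatr_eq0.
suff [x ->] : exists x : R, csin (w * t%:C) / w = x%:C by [].
have h : cRe w * cIm w = 0.
  have : cIm (w ^+ 2) = 0 by rewrite -(RRe_real wr).
  by rewrite expr2 ImM; lra.
have [wre|wim] : w = (cRe w)%:C \/ w = 'i%C * (cIm w)%:C.
  move/eqP: h; rewrite mulf_eq0 => /orP[] /eqP h; [right|left].
    by rewrite [LHS]complexRI h rmorph0 add0r.
  by rewrite [LHS]complexRI h rmorph0 mulr0 addr0.
- have r0 : (cRe w)%:C != 0 :> R[i] by rewrite -wre.
  exists (sin (cRe w * t) / cRe w).
  have en : - ('i%C * (cRe w * t)%:C) = 'i%C * (- (cRe w * t))%:C :> R[i] by rewrite rmorphN mulrN.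
  rewrite wre /= csinE -rmorphM en !cexp_i cosN sinN rmorphN rmorphM fmorphV /=.
  transitivity (- 'i%C ^+ 2 * (sin (cRe w * t))%:C / (cRe w)%:C :> R[i]); first by field; rewrite r0.
  by rewrite i2 opprK mul1r.
have r0 : (cIm w)%:C != 0 :> R[i] by apply/eqP => h0; move: w0; rewrite wim h0 mulr0 eqxx.
exists ((expR (cIm w * t) - expR (- (cIm w * t))) / (2 * cIm w)).
have iw : 'i%C * (w * t%:C) = (- (cIm w * t))%:C.
  rewrite {1}wim rmorphN rmorphM; transitivity ('i%C ^+ 2 * ((cIm w)%:C * t%:C) : R[i]); first by ring.
  by rewrite i2 mulN1r.
rewrite csinE iw -rmorphN opprK !cexp_real [X in _ / X]wim invfM invr_i !(rmorphM, rmorphB, fmorphV) rmorph_nat /=.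
transitivity ('i%C ^+ 2 * ((expR (- (cIm w * t)))%:C - (expR (cIm w * t))%:C) / (2%:R * (cIm w)%:C) : R[i]).
  by field; rewrite r0.
by rewrite i2; field; rewrite r0.
Qed.

Lemma cder_iw w t : cder (fun s => 'i%C * (w * s%:C)) t ('i%C * w).
Proof.
have := cderZ 'i%C (cderZ w (cder_real (is_derive_id t (1 : R)))).
by move/cder_val; apply; rewrite mulr1.
Qed.

Lemma cder_csin w t : w != 0 ->
  cder (fun s => csin (w * s%:C) / w) t ((cexp ('i%C * (w * t%:C)) + cexp (- ('i%C * (w * t%:C)))) / 2).
Proof.
move=> w0; have d1 := cder_cexp (cder_iw w t); have d2 := cder_cexp (cderN (cder_iw w t)).
have i2 := sqr_i R; have t0 : 2%:R != 0 :> R[i] by rewrite pnatr_eq0.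
have := cderZ (- 'i%C / 2 / w) (cderB d1 d2).
move/(cder_ext (g := fun s => csin (w * s%:C) / w)) => /(_ _)d.
apply: cder_val (d _) _ => [s|]; first by rewrite csinE; ring.
move: (cexp _) (cexp _) => e1 e2.
transitivity (- 'i%C ^+ 2 * (e1 + e2) / 2 : R[i]); first by field.
by rewrite i2 opprK mul1r addrC.
Qed.

Lemma cder_ccos w (q : R) t : w != 0 -> w ^+ 2 = q%:C ->
  cder (fun s => (cexp ('i%C * (w * s%:C)) + cexp (- ('i%C * (w * s%:C)))) / 2) t (- q%:C * (csin (w * t%:C) / w)).
Proof.
move=> w0 <-; have d1 := cder_cexp (cder_iw w t); have d2 := cder_cexp (cderN (cder_iw w t)).
have t0 : 2%:R != 0 :> R[i] by rewrite pnatr_eq0.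
have := cderZ (2^-1) (cderD d1 d2).
move/(cder_ext (g := fun s => (cexp ('i%C * (w * s%:C)) + cexp (- ('i%C * (w * s%:C)))) / 2)) => /(_ _)d.
apply: cder_val (d _) _ => [s|]; first by rewrite mulrC.
rewrite csinE; move: (cexp _) (cexp _) => e1 e2.
by field.
Qed.

End Trigonometric.

Theorem corollary4p2 (R : realType) (n : nat) (hn : (1 <= n)%N)
  (hbar m : R) (hhbar : 0 < hbar) (hm : 0 < m)
  (omega : 'I_n -> R[i]) (homega : forall j, omega j ^+ 2 \is Num.real)
  (u : 'rV[R]_n -> R -> R[i])
  (hschwartz : forall t : R, schwartz (fun x => u x t))
  (hsol : solves_oscillator hbar m omega u)
  (T alpha beta K : R) (halpha : 0 < alpha) (hbeta : 0 < beta) (hK : 0 < K)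
  (h0 : forall x, Normc.normc (u x 0) <= K * expR (- alpha * sqr_enorm x))
  (hT : forall x, Normc.normc (u x T) <= K * expR (- beta * sqr_enorm x))
  (hsin : forall j, csin (omega j * T%:C) != 0)
  (hmax : 1 < alpha * beta * (2 * hbar / m) ^+ 2 *
    \big[Num.max/0]_(j < n)
      Normc.normc (csin (omega j * T%:C) / omega j) ^+ 2) :
  forall x t, u x t = 0.
Proof.
(* The hypothesis on the sines excludes omega_j = 0, so the quotients by omega_j are genuine. *)
have w0 j : omega j != 0.
  by apply/eqP => wj; have := hsin j; rewrite wj mul0r csin0 eqxx.
pose lam := m / (2 * hbar).
have lam0 : 0 < lam by rewrite divr_gt0// mulr_gt0.
pose q j := cRe (omega j ^+ 2).
have qE j : omega j ^+ 2 = (q j)%:C by rewrite /q RRe_real.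
pose Cs j t := cRe ((cexp ('i%C * (omega j * t%:C)) + cexp (- ('i%C * (omega j * t%:C)))) / 2).
pose Ss j t := cRe (csin (omega j * t%:C) / omega j).
have SsE j t : (Ss j t)%:C = csin (omega j * t%:C) / omega j.
  by rewrite /Ss [RHS]complexRI csin_real_quot// rmorph0 mulr0 addr0.
have dSs j t : is_derive t (1 : R) (Ss j) (Cs j t).
  by have [] := cder_csin t (w0 j).
have dCs j t : is_derive t (1 : R) (Cs j) (- q j * Ss j t).
  have [] := cder_ccos t (w0 j) (qE j); rewrite -SsE -rmorphN -rmorphM /=.
  by [].
have Cs0 j : Cs j 0 = 1.
  rewrite /Cs !mulr0 oppr0 cexp0 (_ : (1 + 1) / 2 = 1)//.
  by field.
have Ss0 j : Ss j 0 = 0 by rewrite /Ss mulr0 csin0 mul0r.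
have ST j : Ss j T != 0.
  apply/eqP => z; have := mulf_neq0 (hsin j) (invr_neq0 (w0 j)).
  by rewrite -SsE z eqxx.
pose v t x := u x t.
have hS t : schwartz (v t) by exact: hschwartz.
have dv x t : cder (v ^~ x) t (Lop lam q (v t) (fun j => up2 v j t) x).
  have [[d1 d2] e] := hsol x t.
  have : cder (u x) t (cderive (1 : R^o) (u x) t) by split; exact: derivableP.
  move/cder_val; apply.
  have l0 : (2 * m)%:C != 0 :> R[i] by rewrite fmorph_eq0 mulf_neq0 ?gt_eqF.
  have hb0 : hbar%:C != 0 :> R[i] by rewrite fmorph_eq0 gt_eqF.
  have i0 := @i_neq0 R; have i2 := sqr_i R.
  (* Compared after multiplication by i hbar: with lam = m / (2 hbar) one has hbar / (4 lam) =
     hbar^2 / (2 m) and hbar lam = m / 2. *)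
  apply: (mulfI (mulf_neq0 i0 hb0)); rewrite [LHS]e /oscillator_hamiltonian.
  have -> : laplacian (u ^~ t) x = \sum_k up2 v k t x by [].
  have -> : \sum_k omega k ^+ 2 * (x 0 k ^+ 2)%:C = (\sum_k q k * x 0 k ^+ 2)%:C.
    rewrite rmorph_sum; apply: eq_bigr => k _; by rewrite qE [RHS]rmorphM.
  rewrite /Lop /iq /Vq -/(v t x); move: (\sum_k up2 v k t x) (\sum_k q k * x 0 k ^+ 2) (v t x) => L V z.
  have -> : 'i%C * hbar%:C * ('i%C * (4 * lam)^-1%:C * L - 'i%C * (lam * V)%:C * z) =
    'i%C ^+ 2 * ((hbar / (4 * lam))%:C * L - (hbar * lam)%:C * V%:C * z) by rewrite !rmorphM /=; ring.
  have -> : hbar / (4 * lam) = hbar ^+ 2 / (2 * m) by rewrite /lam; field; rewrite !gt_eqF.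
  have -> : hbar * lam = m / 2 by rewrite /lam; field; rewrite gt_eqF.
  by rewrite i2; ring.
(* Were every coordinate to fail, each term of the maximum and its default value 0 would be at most
   1 / c, against the hypothesis. *)
have [j hj] : exists j, 1 < alpha * beta * (Ss j T / lam) ^+ 2.
  apply: contrapT => hne.
  pose c := alpha * beta * (2 * hbar / m) ^+ 2.
  have c0 : 0 < c by apply: mulr_gt0; [exact: mulr_gt0|rewrite exprn_gt0// divr_gt0// mulr_gt0].
  have : \big[Num.max/0]_(j < n) Normc.normc (csin (omega j * T%:C) / omega j) ^+ 2 <= c^-1.
    apply: bigmax_le => [|j _]; first by rewrite invr_ge0 ltW.
    rewrite -SsE nc_real real_normK ?num_real// -[leRHS]mul1r ler_pdivlMr//.
    rewrite leNgt; apply/negP => h; apply: hne; exists j.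
    have -> : alpha * beta * (Ss j T / lam) ^+ 2 = Ss j T ^+ 2 * c by rewrite /c /lam; field; rewrite !gt_eqF.
    exact: h.
  by rewrite -(ler_pM2l c0) divff ?gt_eqF// leNgt hmax.
have z0 x : v 0 x = 0.
  exact: (hardy_zero lam0 hn dCs dSs Cs0 Ss0 hS dv halpha hbeta ST h0 hT hj).
by move=> x t; exact: (zero_forward lam0 hn dCs dSs Cs0 Ss0 hS dv z0 t x).
Qed.
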